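(* Let $\mathcal D$ be a divisorial model for a generalized hypersurface $\mathcal F$ on $({\mathbb C}^n,0)$. Then $\mathcal D$ is a non-dicritical $\mathbb C$-divisor. Moreover, any other $\mathbb C$-divisor on $({\mathbb C}^n,0)$ is a divisorial model for $\mathcal F$ if and only if it is projectively equivalent to $\mathcal D$.
   Context: Foliations: a germ of codimension one singular holomorphic foliation $\mathcal F$ on $({\mathbb C}^n,0)$, $n\ge 2$, is given by an integrable holomorphic 1-form $\omega$ without common factors in its coefficients. For a holomorphic map $\phi$, the pull-back $\phi^*{\mathcal F}$ exists if and only if $\phi^*\omega\neq 0$, and is then the foliation generated by $\phi^*\omega$. A subvariety is invariant if $\omega$ pulls back to zero on it. Generalized hypersurface: $\mathcal F$ is non-dicritical and there is no holomorphic $\phi:({\mathbb C}^2,0)\to({\mathbb C}^n,0)$ such that $\phi^*{\mathcal F}$ is a saddle-node (singular foliation germ on $({\mathbb C}^2,0)$ defined by a vector field whose linear part has exactly one zero eigenvalue). A foliation is dicritical if there is a holomorphic $\phi:({\mathbb C}^2,0)\to({\mathbb C}^n,0)$ with $\phi^*{\mathcal F}=(dx=0)$ and $\phi(y=0)$ invariant for $\mathcal F$ (i.e. $\omega$ pulls back to $0$ under $x\mapsto\phi(x,0)$). In dimension two, generalized hypersurfaces are called generalized curves. A generalized hypersurface has finitely many (and at least one) irreducible invariant hypersurface germs. $\mathbb C$-divisors: a $\mathbb C$-divisor on a non-singular complex analytic variety (or germ) $M$ is a finite formal sum ${\mathcal D}=\sum_H\lambda_HH$, $H$ irreducible hypersurfaces,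 $\lambda_H\in{\mathbb C}$; $\operatorname{Supp}({\mathcal D})$ is the union of the $H$ with $\lambda_H\ne0$. A holomorphic map $\phi:N\to M$ is ${\mathcal D}$-transverse if its image is not contained in $\operatorname{Supp}({\mathcal D})$; then $\phi^*{\mathcal D}=\sum\lambda_H\phi^*(H)$, where locally $\phi^*(H)$ is the divisor (zeros with multiplicity) of $f\circ\phi$, $f=0$ being a local reduced equation of $H$. Two nonzero $\mathbb C$-divisors ${\mathcal D}_1,{\mathcal D}_2$ on $({\mathbb C}^n,0)$ are projectively equivalent if ${\mathcal D}_2=\lambda{\mathcal D}_1$ for some $\lambda\in{\mathbb C}^*$. A $\mathbb C$-divisor ${\mathcal D}$ on $({\mathbb C}^n,0)$ is dicritical if there is a ${\mathcal D}$-transverse holomorphic map $\phi:({\mathbb C}^2,0)\to({\mathbb C}^n,0)$ such that $\phi(y=0)\subset\operatorname{Supp}({\mathcal D})$ and $\phi^*{\mathcal D}=0$; otherwise it is non-dicritical. Indices: if ${\mathcal D}=\mu\Gamma+\sum_{i=2}^s\lambda_iH_i$ is a $\mathbb C$-divisor on $({\mathbb C}^2,0)$ with $\mu\neq0$ and $\Gamma,H_2,\dots,H_s$ distinct irreducible branches, put $I_0({\mathcal D},\Gamma)=-\frac1\mu\sum_{i=2}^s\lambda_i(\Gamma,H_i)_0$, where $(\cdot,\cdot)_0$ is the intersection multiplicity. If $\mathcal G$ is a foliation on $({\mathbb C}^2,0)$ generated by a holomorphic $\omega$ without common factors and $\Gamma=(f=0)$ is an invariant branch ($f$ irreducible), write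 $g\omega=h\,df+f\alpha$ with $\alpha$ a holomorphic 1-form, $g,h$ holomorphic and $f$ not dividing $g$; the Camacho-Sad index is $\operatorname{CS}_0({\mathcal G},\Gamma)=\frac{-1}{2\pi i}\int_{\gamma}\frac{\alpha}{h}$, where $\gamma$ is the image of a small standard loop under a Puiseux parametrization of $\Gamma$. Divisorial model in dimension two: a $\mathbb C$-divisor $\mathcal D$ on $({\mathbb C}^2,0)$ is a divisorial model for a generalized curve $\mathcal G$ on $({\mathbb C}^2,0)$ if (1) $\operatorname{Supp}({\mathcal D})$ is the union of the invariant branches of $\mathcal G$, and (2) $I_0({\mathcal D},\Gamma)=\operatorname{CS}_0({\mathcal G},\Gamma)$ for every irreducible branch $\Gamma$ of $\operatorname{Supp}({\mathcal D})$. Divisorial model in dimension $n$: a $\mathbb C$-divisor $\mathcal D$ on $({\mathbb C}^n,0)$ is a divisorial model for a generalized hypersurface $\mathcal F$ on $({\mathbb C}^n,0)$ if (1) $\operatorname{Supp}({\mathcal D})$ is the union of the germs at $0$ of invariant hypersurfaces of $\mathcal F$, and (2) for every ${\mathcal D}$-transverse holomorphic map $\phi:({\mathbb C}^2,0)\to({\mathbb C}^n,0)$, $\phi^*{\mathcal D}$ is a divisorial model for $\phi^*{\mathcal F}$ (which exists and is a generalized curve). *)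

(* Defs.v *)
From HB Require Import structures.
From mathcomp Require Import all_boot all_order all_algebra.
From mathcomp Require Import generic_quotient complex mpoly freeg.
From mathcomp Require Import all_classical all_reals all_analysis.

Set Implicit Arguments.
Unset Strict Implicit.
Unset Printing Implicit Defensive.

Import Order.TTheory GRing.Theory Num.Theory numFieldNormedType.Exports.

Local Open Scope classical_set_scope.
Local Open Scope ring_scope.

Section Convergence.
Variables (R : realType) (n : nat).
Local Notation C := R[i].
Implicit Types (f g : 'X_{1..n} -> C).

(* Every finite subsum of \sum_m |f m| r^|m| is at most b. *)
Definition summable_by (r b : C) f :=
  forall s : seq 'X_{1..n}, uniq s -> \sum_(m <- s) `|f m| * r ^+ mdeg m <= b.

(* In the partial order of R[i], 0 < r forces r to be real. *)
Definition convergent f := exists r b, 0 < r /\ summable_by r b f.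

Lemma summable_by_le (r r' b : C) f :
  0 <= r' <= r -> summable_by r b f -> summable_by r' b f.
Proof.
case/andP=> r0 rr Hf s us; apply: le_trans (Hf s us).
by apply: ler_sum => m _; rewrite ler_wpM2l ?lerXn2r ?nnegrE // (le_trans r0).
Qed.

Lemma ler_sum_uniq (T : eqType) (s t : seq T) (F : T -> C) :
  uniq s -> {subset s <= t} -> (forall x, 0 <= F x) ->
  \sum_(x <- s) F x <= \sum_(x <- t) F x.
Proof.
move=> us st F0.
have ut := undup_uniq t.
have : \sum_(x <- s) F x <= \sum_(x <- undup t) F x.
  rewrite [leRHS](bigID (mem s)) /= -[leLHS]addr0 lerD ?sumr_ge0 //.
  rewrite -[X in _ <= X]big_filter le_eqVlt; apply/orP; left; apply/eqP/perm_big.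
  apply: uniq_perm; rewrite ?filter_uniq // => x.
  by rewrite mem_filter mem_undup /=; case: (boolP (x \in s)) => // /st ->.
move/le_trans; apply; elim: t {st ut} => [|x t IH] //=.
case: ifP => _; rewrite !big_cons ?lerD2l //.
by rewrite -[leLHS]add0r lerD.
Qed.

Lemma summable_by_bm (r b : C) f d : 0 <= r -> summable_by r b f ->
  \sum_(k : 'X_{1..n < d}) `|f k| * r ^+ mdeg k <= b.
Proof.
move=> r0 Hf.
have := Hf [seq bmnm k | k <- enum {: 'X_{1..n < d}}].
rewrite big_map big_enum; apply.
by rewrite map_inj_uniq ?enum_uniq //; apply: val_inj.
Qed.

Lemma summable_by_ge0 (r b : C) f : summable_by r b f -> 0 <= b.
Proof. by move=> /(_ [::] isT); rewrite big_nil. Qed.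

Lemma mpoly_convergent (p : {mpoly C[n]}) : convergent (fun m => p@_m).
Proof.
exists 1, (\sum_(m <- msupp p) `|p@_m|); split=> // s us.
under eq_bigr do rewrite expr1n mulr1.
rewrite (bigID (mem (msupp p))) /= [X in _ + X]big1 => [|m]; last first.
  by move/memN_msupp_eq0=> ->; rewrite normr0.
rewrite addr0 -big_filter; apply: ler_sum_uniq; rewrite ?filter_uniq // => m.
by rewrite mem_filter => /andP[].
Qed.

Lemma add_summable_by (r b c : C) f g :
  summable_by r b f -> summable_by r c g ->
  0 <= r -> summable_by r (b + c) (fun m => f m + g m).
Proof.
move=> Hf Hg r0 s us; apply: le_trans (lerD (Hf s us) (Hg s us)).
rewrite -big_split; apply: ler_sum => m _ /=.
by rewrite -mulrDl ler_wpM2r ?exprn_ge0 // ler_normD.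
Qed.

Lemma min_radius (r r' : C) : 0 < r -> 0 < r' ->
  exists2 t, 0 < t & (0 <= t <= r) && (0 <= t <= r').
Proof.
move=> r0 r0'; have cmp : r >=< r'.
  by apply: real_comparable; apply: ger0_real; apply: ltW.
have [h|h] := comparable_leP cmp.
  by exists r => //; rewrite lexx h ltW.
by exists r' => //; rewrite lexx !ltW.
Qed.

Lemma add_convergent f g :
  convergent f -> convergent g -> convergent (fun m => f m + g m).
Proof.
case=> r [b [r0 Hf]] [r' [b' [r0' Hg]]].
have [t t0 /andP[h h']] := min_radius r0 r0'.
exists t, (b + b'); split=> //.
by apply: add_summable_by (ltW t0); [apply: summable_by_le Hf | apply: summable_by_le Hg].
Qed.

Lemma opp_convergent f : convergent f -> convergent (fun m => - f m).
Proof.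
case=> r [b [r0 Hf]]; exists r, b; split=> // s us; apply: le_trans (Hf s us).
by under eq_bigr do rewrite normrN.
Qed.

Definition cauchy_product f g (m : 'X_{1..n}) : C :=
  \sum_(k : 'X_{1..n < (mdeg m).+1, (mdeg m).+1} | m == (k.1 + k.2)%MM)
    f k.1 * g k.2.

Definition mtrunc (d : nat) f : {mpoly C[n]} :=
  \sum_(k : 'X_{1..n < d}) f k *: 'X_[k].

Lemma mcoeff_mtrunc d f m : (mdeg m < d)%N -> (mtrunc d f)@_m = f m.
Proof. exact: mcoeff_mpoly. Qed.

Lemma cauchy_productE d f g m : (mdeg m < d)%N ->
  cauchy_product f g m = (mtrunc d f * mtrunc d g)@_m.
Proof.
move=> md; rewrite mcoeffM; apply: eq_bigr => -[k1 k2] _ /=.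
by rewrite !mcoeff_mtrunc // (leq_trans (bmdeg _)).
Qed.

Lemma cauchy_product_bm d f g m : (mdeg m < d)%N ->
  cauchy_product f g m =
  \sum_(k : 'X_{1..n < d, d} | m == (k.1 + k.2)%MM) f k.1 * g k.2.
Proof.
move=> md; rewrite (cauchy_productE _ _ md) mcoeffM.
rewrite -(mcoeff_poly_mul _ _ (ltnSn _)) (mcoeff_poly_mul _ _ md).
by apply: eq_bigr => -[k1 k2] _ /=; rewrite !mcoeff_mtrunc // bmdeg.
Qed.

Lemma mul_summable_by (r b c : C) f g : 0 <= r ->
  summable_by r b f -> summable_by r c g ->
  summable_by r (b * c) (cauchy_product f g).
Proof.
move=> r0 Hf Hg s us.
pose d := (\max_(m <- s) mdeg m).+1.
have Hd m : m \in s -> (mdeg m < d)%N.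
  by move=> ms; rewrite ltnS; apply: leq_bigmax_seq.
pose F (k : 'X_{1..n}) := `|f k| * r ^+ mdeg k.
pose G (k : 'X_{1..n}) := `|g k| * r ^+ mdeg k.
have F0 k : 0 <= F k by rewrite mulr_ge0 ?exprn_ge0.
have G0 k : 0 <= G k by rewrite mulr_ge0 ?exprn_ge0.
apply: (@le_trans _ _ (\sum_(m <- s) \sum_(k : 'X_{1..n < d, d} | m == (k.1 + k.2)%MM)
    F k.1 * G k.2)).
  rewrite big_seq [leRHS]big_seq; apply: ler_sum => m ms.
  rewrite (cauchy_product_bm _ _ (Hd _ ms)).
  apply: (le_trans (ler_wpM2r _ (ler_norm_sum _ _ _))); first exact: exprn_ge0.
  rewrite mulr_suml; apply: ler_sum => k /eqP ->.
  by rewrite normrM mdegD exprD mulrACA.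
rewrite (exchange_big_dep xpredT) //=.
apply: (@le_trans _ _ (\sum_(k : 'X_{1..n < d, d}) F k.1 * G k.2)).
  apply: ler_sum => k _; rewrite -big_filter.
  have Hp : perm_eq [seq i <- s | i == (k.1 + k.2)%MM]
     (if (k.1 + k.2)%MM \in s then [:: (k.1 + k.2)%MM] else [::]).
    apply: uniq_perm; rewrite ?filter_uniq //; first by case: ifP.
    move=> x; rewrite mem_filter; case: (eqVneq x) => [->|ne] /=.
      by case: ifP; rewrite ?inE ?eqxx.
    by case: ifP; rewrite // inE (negbTE ne).
  by rewrite (perm_big _ Hp) /=; case: ifP; rewrite ?big_seq1 ?big_nil // mulr_ge0.
rewrite -(pair_big xpredT xpredT (fun k1 k2 : 'X_{1..n < d} => F k1 * G k2)) /=.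
under eq_bigr do rewrite -mulr_sumr.
rewrite -mulr_suml ler_pM ?sumr_ge0 //; exact: summable_by_bm.
Qed.

Lemma cauchy_product_convergent f g :
  convergent f -> convergent g -> convergent (cauchy_product f g).
Proof.
case=> r [b [r0 Hf]] [r' [b' [r0' Hg]]].
have [t t0 /andP[h h']] := min_radius r0 r0'.
exists t, (b * b'); split=> //.
apply: mul_summable_by (ltW t0) _ _; [exact: summable_by_le Hf | exact: summable_by_le Hg].
Qed.

Definition partial (i : 'I_n) f (m : 'X_{1..n}) : C :=
  f (m + U_(i))%MM *+ (m i).+1.

Lemma partial_convergent i f : convergent f -> convergent (partial i f).
Proof.
case=> r [b [r0 Hf]]; exists (r / 2), (r^-1 * b); split; first exact: divr_gt0.
move=> s us; have := Hf [seq (m + U_(i))%MM | m <- s].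
rewrite map_inj_uniq => [/(_ us)|]; last exact: addIm.
rewrite big_map -(ler_pM2l (x := r^-1)) ?invr_gt0 //; apply: le_trans.
rewrite mulr_sumr; apply: ler_sum => m _.
rewrite mdegD mdeg1 addn1 exprS [leRHS]mulrCA (mulKf (lt0r_neq0 r0)).
rewrite /partial normrMn -[X in X * _ <= _]mulr_natr -mulrA ler_wpM2l //.
rewrite expr_div_n mulrCA -[leRHS]mulr1 ler_wpM2l ?exprn_ge0 ?(ltW r0) //.
rewrite ler_pdivrMr ?exprn_gt0 // mul1r -natrX ler_nat.
apply: (@leq_trans (2 ^ m i)); first exact: ltn_expl.
by rewrite leq_exp2l // mdegE (bigD1 i) //= leq_addr.
Qed.

End Convergence.

(* A germ at 0 of holomorphic function on C^n, given by its Taylor series. *)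
Record germ (R : realType) (n : nat) := Germ {
  gcoef :> 'X_{1..n} -> R[i];
  germ_convergent : convergent gcoef }.

HB.instance Definition _ (R : realType) n := gen_eqMixin (germ R n).
HB.instance Definition _ (R : realType) n := gen_choiceMixin (germ R n).

Section GermRing.
Variables (R : realType) (n : nat).
Local Notation C := R[i].
Implicit Types (f g h : germ R n).

Lemma germP f g : f =1 g -> f = g.
Proof.
case: f g => [f Hf] [g Hg] /= /funext fg; rewrite fg in Hf *.
by congr Germ; apply: Prop_irrelevance.
Qed.

Definition germ_of_mpoly (p : {mpoly C[n]}) : germ R n :=
  Germ (mpoly_convergent p).

Definition gadd f g :=
  Germ (add_convergent (germ_convergent f) (germ_convergent g)).
Definition gopp f := Germ (opp_convergent (germ_convergent f)).
Definition gmul f g :=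
  Germ (cauchy_product_convergent (germ_convergent f) (germ_convergent g)).

Lemma gaddA : associative gadd.
Proof. by move=> f g h; apply: germP => m /=; rewrite addrA. Qed.

Lemma gaddC : commutative gadd.
Proof. by move=> f g; apply: germP => m /=; rewrite addrC. Qed.

Lemma gadd0 : left_id (germ_of_mpoly 0) gadd.
Proof. by move=> f; apply: germP => m /=; rewrite mcoeff0 add0r. Qed.

Lemma gaddN : left_inverse (germ_of_mpoly 0) gopp gadd.
Proof. by move=> f; apply: germP => m /=; rewrite mcoeff0 addNr. Qed.

HB.instance Definition _ :=
  GRing.isZmodule.Build (germ R n) gaddA gaddC gadd0 gaddN.

Lemma mcoeffM_trunc d (p p' q q' : {mpoly C[n]}) m : (mdeg m < d)%N ->
  (forall k, (mdeg k < d)%N -> p@_k = p'@_k) ->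
  (forall k, (mdeg k < d)%N -> q@_k = q'@_k) ->
  (p * q)@_m = (p' * q')@_m.
Proof.
move=> md Hp Hq; rewrite !mcoeffM; apply: eq_bigr => -[k1 k2] _ /=.
by rewrite Hp ?Hq // (leq_trans (bmdeg _)).
Qed.

Lemma gmulE f g d m : (mdeg m < d)%N ->
  gmul f g m = (mtrunc d f * mtrunc d g)@_m.
Proof. exact: cauchy_productE. Qed.

Lemma gmulA : associative gmul.
Proof.
move=> f g h; apply: germP => m; have md := ltnSn (mdeg m).
rewrite !(gmulE _ _ md).
transitivity ((mtrunc (mdeg m).+1 f * (mtrunc (mdeg m).+1 g * mtrunc (mdeg m).+1 h))@_m).
  apply: (mcoeffM_trunc md) => // k kd.
  by rewrite mcoeff_mtrunc // (gmulE _ _ kd).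
rewrite mulrA; apply: (mcoeffM_trunc md) => // k kd.
by rewrite mcoeff_mtrunc // (gmulE _ _ kd).
Qed.

Lemma gmulC : commutative gmul.
Proof.
by move=> f g; apply: germP => m; rewrite !(gmulE _ _ (ltnSn _)) mulrC.
Qed.

Lemma gmul1 : left_id (germ_of_mpoly 1) gmul.
Proof.
move=> f; apply: germP => m; have md := ltnSn (mdeg m).
rewrite (gmulE _ _ md) -[RHS](mcoeff_mtrunc f md) -[in RHS](mul1r (mtrunc _ _)).
by apply: (mcoeffM_trunc md) => // k kd; rewrite mcoeff_mtrunc.
Qed.

Lemma gmulDl : left_distributive gmul gadd.
Proof.
move=> f g h; apply: germP => m; have md := ltnSn (mdeg m).
rewrite /= -!/(gcoef (gmul _ _) _) !(cauchy_productE _ _ md) -mcoeffD -mulrDl.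
by apply: (mcoeffM_trunc md) => // k kd; rewrite mcoeffD !mcoeff_mtrunc.
Qed.

Lemma gone_neq0 : germ_of_mpoly 1 != 0.
Proof.
apply/eqP => /(congr1 (fun f : germ R n => f 0%MM)) /=.
by rewrite mcoeff1 eqxx mcoeff0 => /eqP; rewrite oner_eq0.
Qed.

HB.instance Definition _ := GRing.Zmodule_isComNzRing.Build (germ R n)
  gmulA gmulC gmul1 gmulDl gone_neq0.

Definition gunit : pred (germ R n) := fun f => `[< exists g, g * f = 1 >].
Definition ginv f := xget f [set g | g * f = 1].

Lemma gmulVf : {in gunit, left_inverse 1 ginv *%R}.
Proof. by move=> f /asboolP[g gf]; rewrite /ginv; case: xgetP => // /(_ g). Qed.

Lemma gunitP f g : g * f = 1 -> gunit f.
Proof. by move=> gf; apply/asboolP; exists g. Qed.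

Lemma ginv_out : {in [predC gunit], ginv =1 id}.
Proof.
move=> f /asboolPn Hf; rewrite /ginv; case: xgetP => // g _ gf.
by case: Hf; exists g.
Qed.

HB.instance Definition _ := GRing.ComNzRing_hasMulInverse.Build (germ R n)
  gmulVf gunitP ginv_out.

Lemma gcoefD f g m : (f + g) m = f m + g m. Proof. by []. Qed.
Lemma gcoefN f m : (- f) m = - f m. Proof. by []. Qed.
Lemma gcoefM f g m : (f * g) m = cauchy_product f g m. Proof. by []. Qed.
Lemma gcoef0 m : (0 : germ R n) m = 0. Proof. exact: mcoeff0. Qed.
Lemma gcoef1 m : (1 : germ R n) m = (m == 0%MM)%:R.
Proof. by rewrite -[LHS]/((1 : {mpoly C[n]})@_m) mcoeff1. Qed.

Definition gconst (c : C) := germ_of_mpoly c%:MP.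
Definition gvar (i : 'I_n) := germ_of_mpoly 'X_i.

Definition gpartial (i : 'I_n) f := Germ (partial_convergent i (germ_convergent f)).

Lemma summable_by1 (r : C) : 0 <= r -> summable_by r 1 (1 : germ R n).
Proof.
move=> r0 s us; under eq_bigr do rewrite gcoef1.
have := @ler_sum_uniq R _ [seq m <- s | m == 0%MM] [:: 0%MM]
   (fun m => `|(m == 0%MM)%:R : C| * r ^+ mdeg m).
rewrite big_filter big_seq1 eqxx normr1 mdeg0 mulr1 => H.
rewrite (bigID (fun m => m == 0%MM)) /= [X in _ + X]big1 ?addr0 => [|m /negbTE ->].
  apply: H => [|m|m]; rewrite ?filter_uniq ?mem_filter ?inE //; first by case/andP.
  by rewrite mulr_ge0 ?exprn_ge0.
by rewrite normr0 mul0r.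
Qed.

Lemma summable_byX (r b : C) f k : 0 <= r ->
  summable_by r b f -> summable_by r (b ^+ k) (f ^+ k).
Proof.
move=> r0 Hf; elim: k => [|k IH]; first by rewrite !expr0; apply: summable_by1.
by rewrite !exprS; apply: mul_summable_by.
Qed.

Lemma summable_by_prod (I : Type) (s : seq I) (r : C) (b : I -> C) (f : I -> germ R n) :
  0 <= r -> (forall i, summable_by r (b i) (f i)) ->
  summable_by r (\prod_(i <- s) b i) (\prod_(i <- s) f i).
Proof.
move=> r0 Hf; elim: s => [|i s IH]; first by rewrite !big_nil; apply: summable_by1.
by rewrite !big_cons; apply: mul_summable_by.
Qed.

(* Shrinking the radius makes the sum of a series without constant term small. *)
Lemma summable_by_small (r b e : C) f : f 0%MM = 0 -> 0 < r -> 0 < e ->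
  summable_by r b f ->
  exists2 t, 0 < t <= r & forall t', 0 <= t' <= t -> summable_by t' e f.
Proof.
move=> f0 r0 e0 Hf; have b0 := summable_by_ge0 Hf.
have b1 : 0 < b + 1 by rewrite ltr_wpDl.
have [c c0 /andP[/andP[_ c1] /andP[_ ce]]] :=
  min_radius ltr01 (divr_gt0 e0 b1).
exists (c * r); first by rewrite mulr_gt0 //= ger_pMl.
move=> t' Ht'; apply: (@summable_by_le _ _ (c * r)) => // s us.
apply: (@le_trans _ _ (c * b)); last first.
  rewrite (le_trans _ (_ : c * (b + 1) <= e)) //.
    by rewrite ler_wpM2l ?(ltW c0) // lerDl.
  by rewrite -ler_pdivlMr.
apply: le_trans (ler_wpM2l (ltW c0) (Hf s us)); rewrite mulr_sumr.
apply: ler_sum => m _; have [->|m0] := eqVneq m 0%MM.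
  by rewrite f0 normr0 !mul0r mulr0.
rewrite mulrCA ler_wpM2l // exprMn ler_wpM2r ?exprn_ge0 ?(ltW r0) //.
by rewrite -[leRHS]expr1 ler_wiXn2l ?(ltW c0) // lt0n mdeg_eq0.
Qed.

End GermRing.

(* A germ of holomorphic map (C^m, 0) -> (C^n, 0). *)
Record holo_map (R : realType) (m n : nat) := HoloMap {
  hcoord :> 'I_n -> germ R m;
  hcoord0 : forall i, hcoord i 0%MM = 0 }.

Section Composition.
Variables (R : realType) (m n : nat).
Local Notation C := R[i].
Implicit Types (f : germ R n) (phi : holo_map R m n).

(* As phi has no constant term, only the monomials of f of degree at most |a|
   contribute to the coefficient of index a of f \o phi. *)
Definition comp_coef f phi (a : 'X_{1..m}) : C :=
  \sum_(k : 'X_{1..n < (mdeg a).+1}) f k * (\prod_i phi i ^+ k i) a.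

Lemma holo_map_radius phi (r : C) : 0 < r ->
  exists2 t, 0 < t & forall i, summable_by t r (phi i).
Proof.
move=> r0; have H i : exists t : C, 0 < t /\
    forall t', 0 <= t' <= t -> summable_by t' r (phi i).
  have [r' [b [r'0 Hb]]] := germ_convergent (phi i).
  have [t /andP[t0 _] Ht] := summable_by_small (hcoord0 phi i) r'0 r0 Hb.
  by exists t.
have : exists2 t : C, 0 < t & forall i, i \in enum 'I_n -> summable_by t r (phi i).
  have Hs : forall s : seq 'I_n, exists2 t : C, 0 < t &
    forall i, i \in s -> forall t', 0 <= t' <= t -> summable_by t' r (phi i).
    elim=> [|i s [t t0 Ht]]; first by exists 1.
    have [t1 [t10 Ht1]] := H i.
    have [u u0 /andP[/andP[_ ut] /andP[_ ut1]]] := min_radius t0 t10.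
    exists u => // j; rewrite inE => /orP[/eqP ->|js] t' /andP[t'0 t'u].
      by apply: Ht1; rewrite t'0 (le_trans t'u).
    by apply: Ht => //; rewrite t'0 (le_trans t'u).
  have [t t0 Ht] := Hs (enum 'I_n).
  by exists t => // i /Ht; apply; rewrite lexx ltW.
by case=> t t0 Ht; exists t => // i; apply: Ht; rewrite mem_enum.
Qed.

Lemma comp_convergent f phi : convergent (comp_coef f phi).
Proof.
have [r [b [r0 Hf]]] := germ_convergent f.
have [t t0 Ht] := holo_map_radius phi r0.
have Hk (k : 'X_{1..n}) : summable_by t (r ^+ mdeg k) (\prod_i phi i ^+ k i).
  rewrite mdegE (big_morph (fun j => r ^+ j) (exprD r) (expr0 r)).
  by apply: summable_by_prod => [|i]; [exact: ltW | apply: summable_byX => //; exact: ltW].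
exists t, b; split=> // s us.
pose d := (\max_(a <- s) mdeg a).+1.
apply: (@le_trans _ _ (\sum_(a <- s) \sum_(k : 'X_{1..n < d})
    `|f k| * (`|(\prod_i phi i ^+ k i) a| * t ^+ mdeg a))).
  rewrite big_seq [leRHS]big_seq; apply: ler_sum => a as_.
  apply: (le_trans (ler_wpM2r _ (ler_norm_sum _ _ _))); first by rewrite exprn_ge0 ?ltW.
  rewrite mulr_suml.
  pose F (k : 'X_{1..n}) := `|f k| * (`|(\prod_i phi i ^+ k i) a| * t ^+ mdeg a).
  have F0 k : 0 <= F k by rewrite !mulr_ge0 ?exprn_ge0 // ltW.
  under eq_bigr do rewrite normrM -mulrA.
  have Fbm d' : \sum_(k : 'X_{1..n < d'}) F k =
      \sum_(k <- [seq bmnm k | k <- enum {: 'X_{1..n < d'}}]) F k.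
    by rewrite big_map big_enum.
  rewrite -[leLHS]/(\sum_(k : 'X_{1..n < (mdeg a).+1}) F k).
  rewrite -[leRHS]/(\sum_(k : 'X_{1..n < d}) F k) !Fbm.
  apply: ler_sum_uniq => //.
    by rewrite map_inj_uniq ?enum_uniq //; apply: val_inj.
  move=> k /mapP[k' _ ->]; have kd : (mdeg k' < d)%N.
    by apply: (leq_trans (bmdeg k')); rewrite ltnS; apply: leq_bigmax_seq.
  by apply/mapP; exists (BMultinom kd); rewrite ?mem_enum.
rewrite exchange_big /=.
apply: le_trans (summable_by_bm d (ltW r0) Hf).
by apply: ler_sum => k _; rewrite -mulr_sumr ler_wpM2l // Hk.
Qed.

Definition gcomp f phi : germ R m := Germ (comp_convergent f phi).

End Composition.

Section Maps.
Variable R : realType.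

Lemma hcomp0 l m n (phi : holo_map R m n) (psi : holo_map R l m) i :
  gcomp (phi i) psi 0%MM = 0.
Proof.
rewrite /= /comp_coef big1 // => -[k kd] _ /=.
have /eqP -> : k == 0%MM by move: kd; rewrite mdeg0 ltnS leqn0 mdeg_eq0.
by rewrite hcoord0 mul0r.
Qed.

Definition hcomp l m n (phi : holo_map R m n) (psi : holo_map R l m) :
  holo_map R l n := HoloMap (hcomp0 phi psi).

Lemma axis_map0 (i : 'I_2) :
  (if i == ord0 then gvar R (ord0 : 'I_1) else 0) 0%MM = 0.
Proof.
case: ifP => _; last exact: gcoef0.
by rewrite /= mcoeffX mnm1_eq0.
Qed.

(* x |-> (x, 0), the parametrization of the axis y = 0 *)
Definition axis_map : holo_map R 1 2 := HoloMap axis_map0.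

End Maps.

Section Foliations.
Variable R : realType.
Local Notation C := R[i].

Definition gdvd n (f g : germ R n) := exists h, g = h * f.

(* The row w stands for the 1-form \sum_i w 0 i dx_i. *)
Definition form n := 'rV[germ R n]_n.
Identity Coercion form_matrix : form >-> matrix.

Definition dform n (f : germ R n) : form n := \row_i gpartial i f.

Definition pullback_form m n (phi : holo_map R m n) (w : form n) : form m :=
  \row_j \sum_i gcomp (w ord0 i) phi * gpartial j (phi i).

(* w /\ dw = 0, coefficientwise *)
Definition integrable_form n (w : form n) := forall i j k : 'I_n,
  w ord0 i * (gpartial j (w ord0 k) - gpartial k (w ord0 j)) +
  w ord0 j * (gpartial k (w ord0 i) - gpartial i (w ord0 k)) +
  w ord0 k * (gpartial i (w ord0 j) - gpartial j (w ord0 i)) = 0.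

Record foliation n := Foliation {
  fol_form :> form n;
  fol_integrable : integrable_form fol_form;
  fol_coprime : forall g, (forall i, gdvd g (fol_form ord0 i)) ->
    g \is a GRing.unit }.

(* phi^* F exists and is the foliation defined by eta. *)
Definition pullback_to m n (phi : holo_map R m n) (F : foliation n)
    (eta : form m) :=
  pullback_form phi F != 0 /\ exists g, pullback_form phi F = g *: eta.

Definition dicritical_foliation n (F : foliation n) :=
  exists phi : holo_map R 2 n,
    pullback_to phi F (dform (gvar R (ord0 : 'I_2))) /\
    pullback_form (hcomp phi (axis_map R)) F = 0.

(* The vector field - b d/dx + a d/dy, which spans the kernel of
   G = a dx + b dy. *)
Definition dual_field (G : form 2) (i : 'I_2) : germ R 2 :=
  if i == ord0 then - G ord0 ord_max else G ord0 ord0.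

Definition linear_part (X : 'I_2 -> germ R 2) : 'M[C]_2 :=
  \matrix_(i, j) gpartial j (X i) 0%MM.

Definition saddle_node (G : foliation 2) :=
  (forall i, G ord0 i 0%MM = 0) /\
  exists2 mu : C, mu != 0 &
    char_poly (linear_part (dual_field G)) = 'X * ('X - mu%:P).

Definition generalized_hypersurface n (F : foliation n) :=
  ~ dicritical_foliation F /\
  ~ exists (phi : holo_map R 2 n) (G : foliation 2),
      pullback_to phi F G /\ saddle_node G.

End Foliations.

Section Hypersurfaces.
Local Open Scope quotient_scope.
Variables (R : realType) (n : nat).

Definition irreducible_germ (f : germ R n) :=
  f \isn't a GRing.unit /\
  forall g h, f = g * h -> g \is a GRing.unit \/ h \is a GRing.unit.

Definition irr_germ := {f : germ R n | `[< irreducible_germ f >]}.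

Definition associated : rel irr_germ := fun f g =>
  `[< exists2 u, u \is a GRing.unit & val f = u * val g >].

Lemma associated_refl : reflexive associated.
Proof. by move=> f; apply/asboolP; exists 1; rewrite ?unitr1 ?mul1r. Qed.

Lemma associated_sym : ssrbool.symmetric associated.
Proof.
have H f g : associated f g -> associated g f.
  move=> /asboolP[u uu fg]; apply/asboolP; exists u^-1; rewrite ?unitrV //.
  by rewrite fg mulKr.
by move=> f g; apply/idP/idP; apply: H.
Qed.

Lemma associated_trans : transitive associated.
Proof.
move=> g f h /asboolP[u uu fg] /asboolP[v uv gh]; apply/asboolP.
by exists (u * v); rewrite ?unitrM ?uu // fg gh mulrA.
Qed.

Canonical associated_equiv :=
  EquivRel associated associated_refl associated_sym associated_trans.

(* A germ at 0 of irreducible hypersurface, as the class up to units of its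
   reduced equations. *)
Definition hypersurface := {eq_quot associated}.
HB.instance Definition _ := Choice.on hypersurface.

Definition equation (H : hypersurface) : germ R n := val (repr H).

Definition divisor := {freeg hypersurface / R[i]}.
HB.instance Definition _ := Choice.on divisor.
HB.instance Definition _ := GRing.Lmodule.on divisor.

(* The form of F pulls back to 0 under every germ of holomorphic map with image
   in H. *)
Definition invariant_hypersurface (F : foliation R n) (H : hypersurface) :=
  forall m (psi : holo_map R m n),
    gcomp (equation H) psi = 0 -> pullback_form psi F = 0.

Definition support_equation (D : divisor) : germ R n :=
  \prod_(H <- dom D) equation H.

(* The divisor of zeros of f: \sum_(H <- s) H for any factorization
   f = u * \prod_(H <- s) equation H with u a unit. *)
Definition zero_divisor (f : germ R n) : divisor :=
  xget 0 [set E | exists (u : germ R n) (s : seq hypersurface),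
    [/\ u \is a GRing.unit, f = u * \prod_(H <- s) equation H &
        E = \sum_(H <- s) << H >>]].

Definition projectively_equivalent (D1 D2 : divisor) :=
  [/\ D1 != 0, D2 != 0 & exists2 l : R[i], l != 0 & D2 = l *: D1].

End Hypersurfaces.

Section DivisorPullback.
Variables (R : realType) (m n : nat).
Implicit Types (phi : holo_map R m n) (D : divisor R n).

(* The image of phi is contained in Supp(D). *)
Definition into_support phi D := gcomp (support_equation D) phi = 0.

Definition transverse phi D := ~ into_support phi D.

Definition pullback_divisor phi D : divisor R m :=
  \sum_(H <- dom D) coeff H D *: zero_divisor (gcomp (equation H) phi).

End DivisorPullback.

Definition dicritical_divisor R n (D : divisor R n) :=
  exists phi : holo_map R 2 n,
    [/\ transverse phi D, into_support (hcomp phi (axis_map R)) D &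
        pullback_divisor phi D = 0].

Section Indices.
Local Open Scope complex_scope.
Variable R : realType.
Local Notation C := R[i].

(* dim_C O_2 / (f, g) *)
Definition intersection_multiplicity (f g : germ R 2) : nat :=
  xget 0%N [set d | exists e : 'I_d -> germ R 2, forall h, exists! c : 'rV[C]_d,
    exists a b, h = \sum_i gconst 2 (c ord0 i) * e i + a * f + b * g].

Definition divisor_index (D : divisor R 2) (Gamma : hypersurface R 2) : C :=
  - (coeff Gamma D)^-1 * \sum_(H <- dom D | H != Gamma)
      coeff H D * (intersection_multiplicity (equation Gamma) (equation H))%:R.

Definition complex_limit (u : nat -> C) : C :=
  limn (fun k => complex.Re (u k)) +i* limn (fun k => complex.Im (u k)).

(* The sum of the series f at z, for z in its disc of convergence. *)
Definition eval1 (f : germ R 1) (z : C) : C :=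
  complex_limit (fun N => \sum_(k < N) f (U_(ord0) *+ k)%MM * z ^+ k).

(* An injective parametrization of the branch f = 0. *)
Definition puiseux_parametrization (f : germ R 2) (gamma : holo_map R 1 2) :=
  gcomp f gamma = 0 /\
  exists2 r : C, 0 < r & forall s t : C, `|s| < r -> `|t| < r ->
    (forall i, eval1 (gamma i) s = eval1 (gamma i) t) -> s = t.

Definition circle (r theta : R) : C := r * cos theta +i* (r * sin theta).

(* \int_(|t| = r) F(t) dt, with dt = i t dtheta on the circle *)
Definition circle_integral (r : R) (F : C -> C) : C :=
  let G theta := F (circle r theta) * ((0 +i* 1) * circle r theta) in
  (\int[lebesgue_measure]_(theta in `[0, 2 * pi]) complex.Re (G theta))%R
  +i* (\int[lebesgue_measure]_(theta in `[0, 2 * pi]) complex.Im (G theta))%R.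

(* The value of the index computed from a decomposition g G = h df + f alpha and
   an injective parametrization of f = 0; it does not depend on these choices. *)
Definition is_camacho_sad (G : form R 2) (f : germ R 2) (c : C) :=
  exists (g h : germ R 2) (alpha : form R 2) (gamma : holo_map R 1 2),
    [/\ ~ gdvd f g, g *: G = h *: dform f + f *: alpha,
        puiseux_parametrization f gamma &
        \forall r \near 0^'+, c = - (2 * (pi +i* 0) * (0 +i* 1))^-1 *
          circle_integral r (fun t =>
            eval1 (pullback_form gamma alpha ord0 ord0) t /
            eval1 (gcomp h gamma) t)].

Definition camacho_sad (G : foliation R 2) (Gamma : hypersurface R 2) : C :=
  xget 0 [set c | is_camacho_sad G (equation Gamma) c].

End Indices.

Section Models.
Variable R : realType.

(* Finite unions of irreducible hypersurfaces are compared through their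
   irreducible components. *)
Definition support_is_invariant n (D : divisor R n) (F : foliation R n) :=
  forall H : hypersurface R n, H \in dom D <-> invariant_hypersurface F H.

Definition divisorial_model2 (D : divisor R 2) (G : foliation R 2) :=
  support_is_invariant D G /\
  forall Gamma, Gamma \in dom D -> divisor_index D Gamma = camacho_sad G Gamma.

Definition divisorial_model n (D : divisor R n) (F : foliation R n) :=
  support_is_invariant D F /\
  forall phi : holo_map R 2 n, transverse phi D ->
    pullback_form phi F != 0 /\
    forall G : foliation R 2, pullback_to phi F G ->
      generalized_hypersurface G /\
      divisorial_model2 (pullback_divisor phi D) G.

End Models.

(* Main.v *)
Require Import Defs.
From HB Require Import structures.
From mathcomp Require Import all_boot all_order all_algebra.
From mathcomp Require Import generic_quotient complex mpoly freeg.
From mathcomp Require Import all_classical all_reals all_analysis.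
From mathcomp Require Import ring zify.

(** A map [phi] from the plane which carries [y = 0] into an invariant
    hypersurface pulls the non-dicritical foliation back to one leaving [y = 0]
    invariant: otherwise the flow, issued from the axis [y = 0], of the vector field
    tangent to the pulled back foliation would exhibit the original one as
    dicritical.  Hence no divisorial model is dicritical.

    For uniqueness let [D = \sum_H l_H H] be a model and let [phi] be such that
    [equation H \o phi = x^(a_H) y^(b_H) * unit] for all [H].  Then
    [phi^* D = A [x = 0] + B [y = 0]] with [A = \sum_H l_H a_H] and
    [B = \sum_H l_H b_H], so the index along [x = 0] shows that [B / A] is the same
    for all models.  Choose coordinates in which no equation vanishes identically on
    a given line, and an arc (a Puiseux root) contained in one hypersurface [H] and
    in no other one; let [Phi (x, y)] translate the arc in the direction of the line.
    Composing [Phi] with monomial maps adapted to the Newton polygons of the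
    equations gives a chain of maps [phi] as above, which starts with [A]
    proportional to [l_H] and ends with [B] proportional to [\sum_K l_K d_K], where
    [d_K] is the order of the equation of [K] on the line.  So
    [l_H / \sum_K l_K d_K] is the same for all models. *)

Set Implicit Arguments.
Unset Strict Implicit.
Unset Printing Implicit Defensive.

Import Order.TTheory GRing.Theory Num.Theory.
Local Open Scope ring_scope.

(** * Order of vanishing *)

Section OrderOfVanishing.
Variables (R : realType) (n : nat).
Local Notation C := R[i].
Implicit Types (f g : germ R n) (p q : {mpoly C[n]}).

(** The Camacho-Sad index is never computed: two models share the foliation [G] pulled back by phi,
    so their indices along [x = 0] are the same unknown number. The obstacle is cancellation: A and
    B are complex combinations of orders, and if A vanishes the index says nothing. The chain
    therefore uses maps (x, y) |-> (x^k y^(k+1), (x y)^M), which contract [y = 0] to the origin. The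
    form of the foliation pulls back to 0 on that axis for free, non-dicriticality then makes
    [y = 0] invariant, hence a component of phi^* D, and B is nonzero. The order along [y = 0] for k
    is the order along [x = 0] for k + 1, so this B is the next A. The number M is a factorial, so
    as to be divisible by the horizontal length of every edge that matters; this is what makes each
    equation a monomial times a unit after each map. Germs being bare convergent series,
    factorization has to be built as well: it serves to compute zero divisors and to separate
    hypersurfaces. Irreducible germs are shown to be prime by induction on the dimension, through
    Weierstrass preparation and resultants. *)

Definition vanish (d : nat) f := forall m, (mdeg m < d)%N -> f m = 0.

Lemma gcoefB f g m : (f - g) m = f m - g m. Proof. by []. Qed.

Lemma gcoef_sum (I : Type) (s : seq I) (P : pred I) (F : I -> germ R n) m :
  (\sum_(i <- s | P i) F i) m = \sum_(i <- s | P i) F i m.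
Proof.
by elim/big_ind2: _ => [|f1 x1 f2 x2 <- <-|i _] //; rewrite gcoef0.
Qed.

Lemma gcoef_mpoly p m : germ_of_mpoly p m = p@_m. Proof. by []. Qed.

Lemma germ_of_mpolyB : zmod_morphism (@germ_of_mpoly R n).
Proof. by move=> p q; apply: germP => m; rewrite gcoefB /= mcoeffB. Qed.
HB.instance Definition _ := GRing.isZmodMorphism.Build _ _ _ germ_of_mpolyB.

Lemma germ_of_mpolyM : monoid_morphism (@germ_of_mpoly R n).
Proof.
split=> // p q; apply: germP => m.
rewrite (gmulE _ _ (ltnSn (mdeg m))); apply: (mcoeffM_trunc (ltnSn _)) => k kd;
  by rewrite mcoeff_mtrunc.
Qed.
HB.instance Definition _ := GRing.isMonoidMorphism.Build _ _ _ germ_of_mpolyM.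

Lemma vanish0 f : vanish 0 f. Proof. by []. Qed.

Lemma vanish_le d e f : (d <= e)%N -> vanish e f -> vanish d f.
Proof. by move=> de Hf m md; apply: Hf; apply: leq_trans de. Qed.

(** The powers of the maximal ideal intersect in 0. Many identities below are checked modulo each
    power, where germs can be replaced by polynomials. *)
Lemma vanishP f : (forall d, vanish d f) -> f = 0.
Proof. by move=> Hf; apply: germP => m; rewrite gcoef0 (Hf (mdeg m).+1). Qed.

Lemma vanishD d f g : vanish d f -> vanish d g -> vanish d (f + g).
Proof. by move=> Hf Hg m md; rewrite gcoefD Hf ?Hg ?addr0. Qed.

Lemma vanish_sum d (I : Type) (s : seq I) (F : I -> germ R n) :
  (forall i, vanish d (F i)) -> vanish d (\sum_(i <- s) F i).
Proof. by move=> HF m md; rewrite gcoef_sum big1 // => i _; apply: HF. Qed.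

Lemma vanishM d e f g : vanish d f -> vanish e g -> vanish (d + e) (f * g).
Proof.
move=> Hf Hg m md; rewrite gcoefM; apply: big1 => -[[k1 ?] [k2 ?]] /= /eqP mk.
have [kd|kd] := ltnP (mdeg k1) d; first by rewrite Hf ?mul0r.
have := congr1 (@mdeg n) mk; rewrite mdegD => E.
by rewrite Hg ?mulr0 // -(ltn_add2l d) (leq_ltn_trans _ md) // E leq_add2r.
Qed.

Lemma vanishX d f k : vanish d f -> vanish (k * d) (f ^+ k).
Proof.
move=> Hf; elim: k => [|k IH]; first by rewrite mul0n.
by rewrite exprS mulSn; apply: vanishM.
Qed.

Lemma gcoefM_bm d f g m : (mdeg m < d)%N ->
  (f * g) m = (mtrunc d f * mtrunc d g)@_m.
Proof. exact: gmulE. Qed.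

Lemma vanish_trunc d f : vanish d (f - germ_of_mpoly (mtrunc d f)).
Proof. by move=> m md; rewrite gcoefB gcoef_mpoly mcoeff_mtrunc ?subrr. Qed.

Lemma gcoef_const (c : C) f m : (gconst n c * f) m = c * f m.
Proof.
rewrite (gcoefM_bm _ _ (ltnSn (mdeg m))).
rewrite (_ : (_ * _)@_m = (c%:MP * mtrunc (mdeg m).+1 f)@_m).
  by rewrite mcoeffCM mcoeff_mtrunc.
apply: (mcoeffM_trunc (ltnSn _)) => // k kd.
by rewrite mcoeff_mtrunc.
Qed.

Lemma gconstB : zmod_morphism (@gconst R n).
Proof. by move=> a b; rewrite /gconst mpolyCB rmorphB. Qed.
HB.instance Definition _ := GRing.isZmodMorphism.Build _ _ _ gconstB.

Lemma gconstM : monoid_morphism (@gconst R n).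
Proof. by split=> [|a b]; rewrite /gconst ?mpolyC1 ?rmorph1 // mpolyCM rmorphM. Qed.
HB.instance Definition _ := GRing.isMonoidMorphism.Build _ _ _ gconstM.

Lemma gconstE (c : C) m : gconst n c m = c * (m == 0%MM)%:R.
Proof. by rewrite gcoef_mpoly mcoeffC. Qed.

Lemma gcoefM0 f g : (f * g) 0%MM = f 0%MM * g 0%MM.
Proof.
by rewrite (gcoefM_bm _ _ (d := 1)) ?mdeg0 // (rmorphM (mcoeff 0%MM)) /= !mcoeff_mtrunc ?mdeg0.
Qed.

Lemma gcoefX0 f k : (f ^+ k) 0%MM = f 0%MM ^+ k.
Proof.
elim: k => [|k IH]; first by rewrite !expr0 gcoef1 eqxx.
by rewrite !exprS gcoefM0 IH.
Qed.

Lemma vanish1 f : f 0%MM = 0 -> vanish 1 f.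
Proof. by move=> f0 m; rewrite ltnS leqn0 mdeg_eq0 => /eqP ->. Qed.

(* Multinomials are ordered by degree first, compatibly with addition. *)
Lemma min_monom f : f != 0 ->
  exists2 m, f m != 0 & forall k, (k < m)%O -> f k = 0.
Proof.
move=> f0; have [m fm] : exists m, f m != 0.
  apply: contrapT => H; case/eqP: f0; apply: germP => m; rewrite gcoef0.
  by apply: contrapT => /eqP fm; apply: H; exists m.
elim/(well_founded_ind (@ltom_wf n)): m fm => m IH fm.
have [H|/existsNP[k]] := pselect (forall k, (k < m)%O -> f k = 0); first by exists m.
by case/not_implyP=> km /eqP fk; apply: (IH k).
Qed.

(** In any other decomposition m' + k' = m + k, either m' < m or k' < k, because the order is
    compatible with addition; so one factor of that term is 0. *)
Lemma min_monomM f g m k :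
  (forall m', (m' < m)%O -> f m' = 0) -> (forall k', (k' < k)%O -> g k' = 0) ->
  (f * g) (m + k)%MM = f m * g k.
Proof.
move=> Hf Hg; rewrite gcoefM /cauchy_product.
have mlt : (mdeg m < (mdeg (m + k)).+1)%N by rewrite mdegD ltnS leq_addr.
have klt : (mdeg k < (mdeg (m + k)).+1)%N by rewrite mdegD ltnS leq_addl.
rewrite (bigD1 (BMultinom mlt, BMultinom klt)) //= big1 ?addr0 // => -[m' k'] /=.
case/andP=> /eqP mk; rewrite -pair_eqE /= negb_and => ne.
have [lt|ge] := ltP (m' : 'X_{1..n}) m; first by rewrite Hf ?mul0r.
have [lt'|ge'] := ltP (k' : 'X_{1..n}) k; first by rewrite Hg ?mulr0.
case/orP: ne => ne.
  have lt : (m < (m' : 'X_{1..n}))%O by rewrite lt_neqAle ge andbT eq_sym; exact: ne.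
  by have := ltmc_le_add lt ge'; rewrite -[X in (_ < X)%O]mk ltxx.
have lt : (k < (k' : 'X_{1..n}))%O by rewrite lt_neqAle ge' andbT eq_sym; exact: ne.
by have := lemc_lt_add ge lt; rewrite -[X in (_ < X)%O]mk ltxx.
Qed.

Lemma germ_mulf_eq0 f g : f * g = 0 -> (f == 0) || (g == 0).
Proof.
move=> fg; apply: contraT; rewrite negb_or => /andP[/min_monom[m fm Hm] /min_monom[k gk Hk]].
have := min_monomM Hm Hk; rewrite fg gcoef0 => /esym/eqP.
by rewrite mulf_eq0 (negbTE fm) (negbTE gk).
Qed.

End OrderOfVanishing.

HB.instance Definition _ (R : realType) n :=
  GRing.ComUnitRing_isIntegral.Build (germ R n) (@germ_mulf_eq0 R n).

(** * Convergence of series of germs *)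

Section WeightedNorms.
Variables (R : realType) (n : nat).
Local Notation C := R[i].
Implicit Types (f g : germ R n) (W : 'X_{1..n} -> C) (b c : C).

(** A weighted l^1 norm bounded by b. General weights are needed to give the last variable a radius
    of its own. *)
Definition wsummable W b (f : 'X_{1..n} -> C) :=
  forall s : seq 'X_{1..n}, uniq s -> \sum_(m <- s) `|f m| * W m <= b.

Definition weight W := [/\ forall m, 0 <= W m,
  forall m k, W (m + k)%MM = W m * W k & exists2 t, 0 < t & forall m, t ^+ mdeg m <= W m].

Lemma weightX (r : C) : 0 < r -> weight (fun m => r ^+ mdeg m).
Proof.
move=> r0; split=> [m|m k|]; first by rewrite exprn_ge0 ?ltW.
  by rewrite mdegD exprD.
by exists r.
Qed.

(** Rescaling the coefficients by W reduces to radius 1, where [mul_summable_by] applies. *)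
Lemma wsummable1E W b (f : 'X_{1..n} -> C) : (forall m, 0 <= W m) ->
  wsummable W b f <-> summable_by 1 b (fun m => f m * W m).
Proof.
move=> W0; split=> Hf s us; have := Hf s us; under [leLHS]eq_bigr => m _.
- by rewrite (_ : _ * _ = `|f m * W m| * 1 ^+ mdeg m);
    [over | rewrite expr1n mulr1 normrM (ger0_norm (W0 m))].
- by [].
- by rewrite expr1n mulr1 normrM (ger0_norm (W0 m)); over.
- by [].
Qed.

Lemma wsummableM W b c f g : weight W ->
  wsummable W b f -> wsummable W c g -> wsummable W (b * c) (f * g).
Proof.
case=> W0 WD _; rewrite !wsummable1E // => Hf Hg.
have := mul_summable_by ler01 Hf Hg.
congr summable_by; apply: funext => m; rewrite /cauchy_product gcoefM mulr_suml.
by apply: eq_bigr => -[[k1 ?] [k2 ?]] /= /eqP ->; rewrite WD mulrACA.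
Qed.

Lemma wsummable_convergent W b (f : 'X_{1..n} -> C) :
  weight W -> wsummable W b f -> convergent f.
Proof.
case=> W0 _ [t t0 Ht] Hf; exists t, b; split=> // s us.
by apply: le_trans (Hf s us); apply: ler_sum => m _; rewrite ler_wpM2l.
Qed.

(** Intended for h k of order at least k: the terms with k > |m| then contribute nothing to the
    coefficient of index m. *)
Definition series_coef (h : nat -> germ R n) (m : 'X_{1..n}) : C :=
  \sum_(k < (mdeg m).+1) h k m.

Lemma wsummable_series W (b : nat -> C) c (h : nat -> germ R n) :
  (forall m, 0 <= W m) -> (forall k, wsummable W (b k) (h k)) ->
  (forall N, \sum_(k < N) b k <= c) -> wsummable W c (series_coef h).
Proof.
move=> W0 Hh bc s us; pose N := (\max_(m <- s) mdeg m).+1.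
apply: le_trans (bc N).
apply: (@le_trans _ _ (\sum_(m <- s) \sum_(k < N) `|h k m| * W m)).
  rewrite big_seq [leRHS]big_seq; apply: ler_sum => m ms.
  apply: (le_trans (ler_wpM2r (W0 m) (ler_norm_sum _ _ _))).
  rewrite mulr_suml -(big_mkord xpredT (fun k => `|h k m| * W m)).
  rewrite -[leRHS](big_mkord xpredT (fun k => `|h k m| * W m)).
  have mN : ((mdeg m).+1 <= N)%N by rewrite ltnS; apply: leq_bigmax_seq.
  rewrite [leRHS](big_cat_nat (n := (mdeg m).+1)) //= lerDl.
  by apply: sumr_ge0 => k _; rewrite mulr_ge0.
by rewrite exchange_big /=; apply: ler_sum => k _; apply: Hh.
Qed.

Lemma gseries W (b : nat -> C) c (h : nat -> germ R n) : weight W ->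
  (forall k, vanish k (h k)) -> (forall k, wsummable W (b k) (h k)) ->
  (forall N, \sum_(k < N) b k <= c) ->
  exists g, forall d, vanish d (g - \sum_(k < d) h k).
Proof.
move=> HW hk Hh bc; have [W0 _ _] := HW.
exists (Germ (wsummable_convergent HW (wsummable_series W0 Hh bc))).
move=> d m md; rewrite gcoefB gcoef_sum /= /series_coef.
rewrite -!(big_mkord xpredT (fun k => h k m)) [X in _ - X](big_cat_nat (n := (mdeg m).+1)) //=.
rewrite [X in _ - (_ + X)]big_nat_cond [X in _ - (_ + X)]big1 ?addr0 ?subrr //.
by move=> k /andP[/andP[mk _] _]; rewrite hk.
Qed.

Lemma geometric_sum_le (q : C) N : 0 <= q -> q <= 2^-1 -> \sum_(k < N) q ^+ k <= 2.
Proof.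
move=> q0 q1; apply: (@le_trans _ _ (2 - 2 * 2^-1 ^+ N)); last first.
  by rewrite gerDl oppr_le0 mulr_ge0 ?exprn_ge0 ?invr_ge0.
elim: N => [|N IH]; first by rewrite big_ord0 expr0 mulr1 subrr.
rewrite big_ord_recr /=; apply: (le_trans (lerD IH (_ : _ <= 2^-1 ^+ N))).
  by rewrite lerXn2r // nnegrE invr_ge0.
rewrite -addrA lerD2l exprS mulrA divff ?pnatr_eq0 // mul1r.
by rewrite mulr_natl mulr2n opprD addrNK.
Qed.

(** A geometric series: h = 1 - f / f(0) has no constant term, hence norm at most 1/2 on a small
    polydisc, and the sum of the powers of h inverts 1 - h. *)
Lemma germ_unitP f : reflect (f 0%MM != 0) (f \is a GRing.unit).
Proof.
apply: (iffP idP) => [fu|f0].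
  apply/eqP => f0; have : (f^-1 * f) 0%MM = (1 : germ R n) 0%MM by rewrite mulVr.
  by rewrite gcoefM0 f0 mulr0 gcoef1 eqxx => /esym/eqP; rewrite oner_eq0.
pose h := 1 - gconst n (f 0%MM)^-1 * f.
have h0 : h 0%MM = 0 by rewrite gcoefB gcoef_const mulVf // gcoef1 eqxx subrr.
have [r [b [r0 Hb]]] := germ_convergent h.
have half0 : 0 < 2^-1 :> C by rewrite invr_gt0 ltr0n.
have [t /andP[t0 _] Ht] := summable_by_small h0 r0 half0 Hb.
have {}Ht : summable_by t 2^-1 h by apply: Ht; rewrite lexx ltW.
have [g Hg] : exists g, forall d, vanish d (g - \sum_(k < d) h ^+ k).
  apply: (gseries (weightX t0) (b := fun k => 2^-1 ^+ k) (c := 2)) => [k|k|N].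
  - by have := vanishX (k := k) (vanish1 h0); rewrite muln1.
  - by apply: summable_byX Ht; exact: ltW.
  - by apply: geometric_sum_le; rewrite ?lexx // ltW.
have Eg : g * (1 - h) = 1.
  apply/eqP; rewrite -subr_eq0; apply/eqP/vanishP => d.
  have -> : g * (1 - h) - 1 = (g - \sum_(k < d) h ^+ k) * (1 - h) - h ^+ d.
    have -> : h ^+ d = 1 + (h - 1) * \sum_(k < d) h ^+ k by rewrite -subrX1 addrC subrK.
    by ring.
  apply: vanishD; first by have := vanishM (Hg d) (@vanish0 _ _ (1 - h)); rewrite addn0.
  have := vanishX (k := d) (vanish1 h0); rewrite muln1 => Hd m md.
  by rewrite gcoefN Hd ?oppr0.
apply: (@gunitP _ _ _ (g * gconst n (f 0%MM)^-1)).
by rewrite -mulrA -[RHS]Eg /h opprB addrC subrK.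
Qed.

End WeightedNorms.

(** * Composition of germs *)

Section CompositionAlgebra.
Variables (R : realType) (m n : nat).
Local Notation C := R[i].
Implicit Types (f g : germ R n) (p : {mpoly C[n]}) (phi : holo_map R m n).

Local Notation subst phi := (mmap (@gconst R m) (hcoord phi)).

Lemma vanish_monom phi (k : 'X_{1..n}) : vanish (mdeg k) (\prod_i phi i ^+ k i).
Proof.
rewrite mdegE; elim: (index_enum _) => [|i s IH]; first by rewrite !big_nil.
rewrite !big_cons; apply: vanishM => //.
by have := vanishX (k := k i) (vanish1 (hcoord0 phi i)); rewrite muln1.
Qed.

Lemma vanish_subst phi p d : (forall k, (mdeg k < d)%N -> p@_k = 0) ->
  vanish d (subst phi p).
Proof.
move=> Hp; apply: vanish_sum => k a ad; rewrite gcoef_const.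
have [kd|kd] := ltnP (mdeg k) d; first by rewrite Hp ?mul0r.
by rewrite (vanish_monom phi) ?mulr0 // (leq_trans ad).
Qed.

(** Since phi has no constant term, composition agrees up to order d with a polynomial substitution.
    The ring morphism laws of composition are inherited from [mmap] in this way. *)
Lemma gcomp_subst phi f d : vanish d (gcomp f phi - subst phi (mtrunc d f)).
Proof.
move=> a ad; rewrite gcoefB.
have -> : gcomp f phi a = subst phi (mtrunc (mdeg a).+1 f) a.
  rewrite /mtrunc raddf_sum gcoef_sum; apply: eq_bigr => k _.
  by rewrite /= mmapZ gcoef_const mmapX.
rewrite -gcoefB -rmorphB; apply: (@vanish_subst phi _ (mdeg a).+1) => // k ka.
by rewrite mcoeffB !mcoeff_mtrunc ?subrr // (leq_trans ka).
Qed.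

Lemma gcomp_mpoly phi p : gcomp (germ_of_mpoly p) phi = subst phi p.
Proof.
apply/eqP; rewrite -subr_eq0; apply/eqP/vanishP => d.
pose f := germ_of_mpoly p.
have -> : gcomp f phi - subst phi p =
   (gcomp f phi - subst phi (mtrunc d f)) + subst phi (mtrunc d f - p).
  by rewrite rmorphB /=; ring.
apply: vanishD; first exact: gcomp_subst.
by apply: vanish_subst => k kd; rewrite mcoeffB mcoeff_mtrunc // subrr.
Qed.

Lemma vanish_gcomp phi f d : vanish d f -> vanish d (gcomp f phi).
Proof.
move=> Hf; rewrite -[gcomp f phi](subrK (subst phi (mtrunc d f))).
apply: vanishD; first exact: gcomp_subst.
by apply: vanish_subst => k kd; rewrite mcoeff_mtrunc ?Hf.
Qed.

Lemma gcompB phi : zmod_morphism ((@gcomp R m n)^~ phi).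
Proof.
move=> f g; apply: germP => a; rewrite gcoefB /= /comp_coef -sumrB.
by apply: eq_bigr => k _; rewrite mulrBl.
Qed.

Lemma gcompM phi : monoid_morphism ((@gcomp R m n)^~ phi).
Proof.
split=> [|f g]; first by rewrite gcomp_mpoly rmorph1.
apply/eqP; rewrite -subr_eq0; apply/eqP/vanishP => d.
have Hf := @gcomp_subst phi f d; have Hg := @gcomp_subst phi g d.
have Hfg := @gcomp_subst phi (f * g) d.
have -> : gcomp (f * g) phi - gcomp f phi * gcomp g phi =
   (gcomp (f * g) phi - subst phi (mtrunc d (f * g))) +
   subst phi (mtrunc d (f * g) - mtrunc d f * mtrunc d g) -
   ((gcomp f phi - subst phi (mtrunc d f)) * gcomp g phi +
   subst phi (mtrunc d f) * (gcomp g phi - subst phi (mtrunc d g))).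
  by rewrite rmorphB rmorphM /=; ring.
apply: vanishD; first apply: vanishD => //.
  apply: vanish_subst => k kd; rewrite mcoeffB mcoeff_mtrunc //.
  by rewrite (gcoefM_bm _ _ kd) subrr.
have V1 := vanishM Hf (@vanish0 _ _ (gcomp g phi)).
have V2 := vanishM (@vanish0 _ _ (subst phi (mtrunc d f))) Hg.
rewrite addn0 in V1; rewrite add0n in V2.
by move=> a ad; rewrite gcoefN (vanishD V1 V2) ?oppr0.
Qed.

(** A copy of [gcomp] with the map as first argument, to carry the ring morphism structure. *)
Definition pull phi f := gcomp f phi.

HB.instance Definition _ phi :=
  GRing.isZmodMorphism.Build _ _ (pull phi) (gcompB phi).
HB.instance Definition _ phi :=
  GRing.isMonoidMorphism.Build _ _ (pull phi) (gcompM phi).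

End CompositionAlgebra.

Section Pull.
Variables (R : realType).
Local Notation C := R[i].

Lemma pullE m n (phi : holo_map R m n) f : gcomp f phi = pull phi f. Proof. by []. Qed.

Lemma pull_const m n (phi : holo_map R m n) c : pull phi (gconst n c) = gconst m c.
Proof. by rewrite /pull /gconst gcomp_mpoly mmapC. Qed.

Lemma pull_var m n (phi : holo_map R m n) i : pull phi (gvar R i) = phi i.
Proof. by rewrite /pull gcomp_mpoly mmapX mmap1U. Qed.

Lemma pull0c m n (phi : holo_map R m n) f : pull phi f 0%MM = f 0%MM.
Proof.
have V : vanish 1 (f - gconst n (f 0%MM)).
  by apply: vanish1; rewrite gcoefB gconstE eqxx mulr1 subrr.
have := vanish_gcomp phi V; rewrite pullE rmorphB /= pull_const.
move=> /(_ 0%MM); rewrite mdeg0 gcoefB gconstE eqxx mulr1 => /(_ isT)/eqP.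
by rewrite subr_eq0 => /eqP.
Qed.

Lemma pull_unit m n (phi : holo_map R m n) f :
  (pull phi f \is a GRing.unit) = (f \is a GRing.unit).
Proof. by apply/germ_unitP/germ_unitP; rewrite pull0c. Qed.

(** Both morphisms are continuous for the order of vanishing, and polynomials are dense. *)
Lemma germ_morph_ext m n (s1 s2 : {rmorphism germ R n -> germ R m}) :
  (forall d f, vanish d f -> vanish d (s1 f)) ->
  (forall d f, vanish d f -> vanish d (s2 f)) ->
  (forall c, s1 (gconst n c) = s2 (gconst n c)) ->
  (forall i, s1 (gvar R i) = s2 (gvar R i)) -> forall f, s1 f = s2 f.
Proof.
move=> V1 V2 Hc Hv f; apply/eqP; rewrite -subr_eq0; apply/eqP/vanishP => d.
have Hp p : s1 (germ_of_mpoly p) = s2 (germ_of_mpoly p).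
  rewrite [p]mpolyE !rmorph_sum; apply: eq_bigr => k _.
  rewrite -mul_mpolyC !rmorphM Hc; congr (_ * _).
  by rewrite mpolyXE_id !rmorph_prod; apply: eq_bigr => i _; rewrite !rmorphXn Hv.
have -> : s1 f - s2 f = s1 (f - germ_of_mpoly (mtrunc d f)) +
    s2 (germ_of_mpoly (mtrunc d f) - f).
  by rewrite !rmorphB /= Hp; ring.
have V := vanish_trunc f (d := d).
apply: vanishD; first exact: V1.
by rewrite -opprB rmorphN => a ad; rewrite gcoefN (V2 d) ?oppr0.
Qed.

Lemma pull_comp l m n (phi : holo_map R m n) (psi : holo_map R l m) f :
  pull psi (pull phi f) = pull (hcomp phi psi) f.
Proof.
apply: (germ_morph_ext (s1 := pull psi \o pull phi) (s2 := pull (hcomp phi psi))).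
- by move=> d g Hg; do 2!apply: vanish_gcomp.
- by move=> d g; apply: vanish_gcomp.
- by move=> c; rewrite /= !pull_const.
by move=> i; rewrite /= !pull_var.
Qed.

Lemma holo_mapP m n (phi psi : holo_map R m n) : (forall i, phi i = psi i) -> phi = psi.
Proof.
case: phi psi => [phi Hphi] [psi Hpsi] /= /funext E; rewrite E in Hphi *.
by congr HoloMap; apply: Prop_irrelevance.
Qed.

Lemma hcompE l m n (phi : holo_map R m n) (psi : holo_map R l m) i :
  hcomp phi psi i = pull psi (phi i).
Proof. by []. Qed.

Lemma hcompA k l m n (phi : holo_map R m n) (psi : holo_map R l m) (chi : holo_map R k l) :
  hcomp (hcomp phi psi) chi = hcomp phi (hcomp psi chi).
Proof. by apply: holo_mapP => i; rewrite !hcompE pull_comp. Qed.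

Lemma id_map0 n i : gvar R (i : 'I_n) 0%MM = 0.
Proof. by rewrite gcoef_mpoly mcoeffX mnm1_eq0. Qed.
Definition id_map n : holo_map R n n := HoloMap (@id_map0 n).

Lemma pull_id n f : pull (id_map n) f = f.
Proof.
apply: (germ_morph_ext (s1 := pull (id_map n)) (s2 := idfun)) => //.
- by move=> d g; apply: vanish_gcomp.
- by move=> c; rewrite /= pull_const.
by move=> i; rewrite /= pull_var.
Qed.

End Pull.

Section ChainRule.
Variable R : realType.
Local Notation C := R[i].

Lemma gpartialB n (i : 'I_n) : zmod_morphism (@gpartial R n i).
Proof. by move=> f g; apply: germP => a; rewrite /= /partial /= mulrnBl. Qed.
HB.instance Definition _ n (i : 'I_n) := GRing.isZmodMorphism.Build _ _ _ (gpartialB i).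

Lemma vanish_gpartial n (i : 'I_n) (f : germ R n) d :
  vanish d.+1 f -> vanish d (gpartial i f).
Proof.
by move=> Hf a ad; rewrite /= /partial Hf ?mul0rn // mdegD mdeg1 addn1.
Qed.

Lemma gpartial_mpoly n (i : 'I_n) (p : {mpoly C[n]}) :
  gpartial i (germ_of_mpoly p) = germ_of_mpoly (mderiv i p).
Proof. by apply: germP => a; rewrite gcoef_mpoly mcoeff_deriv. Qed.

Lemma gpartialM n (i : 'I_n) (f g : germ R n) :
  gpartial i (f * g) = gpartial i f * g + f * gpartial i g.
Proof.
apply/eqP; rewrite -subr_eq0; apply/eqP/vanishP => d.
(* Differentiation loses one order, hence the truncation at d + 1. *)
pose p := mtrunc d.+1 f; pose q := mtrunc d.+1 g.
have [Vf Vg] := (vanish_trunc f (d := d.+1), vanish_trunc g (d := d.+1)).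
rewrite -[f](subrK (germ_of_mpoly p)) -[g](subrK (germ_of_mpoly q)).
set u := f - _ in Vf *; set v := g - _ in Vg *.
have P0 (h : germ R n) : vanish 0 h by [].
have -> : gpartial i ((u + germ_of_mpoly p) * (v + germ_of_mpoly q)) -
  (gpartial i (u + germ_of_mpoly p) * (v + germ_of_mpoly q) +
   (u + germ_of_mpoly p) * gpartial i (v + germ_of_mpoly q)) =
  gpartial i (u * (v + germ_of_mpoly q)) + gpartial i (v * germ_of_mpoly p) -
  (gpartial i u * (v + germ_of_mpoly q) + u * gpartial i (v + germ_of_mpoly q)
   + v * gpartial i (germ_of_mpoly p) + gpartial i v * germ_of_mpoly p).
  rewrite (_ : (u + germ_of_mpoly p) * (v + germ_of_mpoly q) =
    u * (v + germ_of_mpoly q) + v * germ_of_mpoly p + germ_of_mpoly (p * q)); last first.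
    by rewrite rmorphM /=; ring.
  rewrite !raddfD /= !gpartial_mpoly mderivM rmorphD !rmorphM /=; ring.
have V (h k : germ R n) : vanish d.+1 h -> vanish d (h * k).
  by move=> Hh; apply: (@vanish_le _ _ d d.+1) => //; have := vanishM Hh (P0 k); rewrite addn0.
have V' (h k : germ R n) : vanish d h -> vanish d (h * k).
  by move=> Hh; have := vanishM Hh (P0 k); rewrite addn0.
have VM (h k : germ R n) : vanish d.+1 h -> vanish d (gpartial i (h * k)).
  by move=> Hh; apply: vanish_gpartial; have := vanishM Hh (P0 k); rewrite addn0.
apply: vanishD; first by apply: vanishD; apply: VM.
move=> a ad; rewrite gcoefN; apply/eqP; rewrite oppr_eq0; apply/eqP.
apply: (vanishD _ _ ad); last by apply: V'; apply: vanish_gpartial.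
apply: vanishD; last exact: V.
by apply: vanishD; [apply: V'; exact: vanish_gpartial | exact: V].
Qed.

Lemma gpartial_const n (i : 'I_n) (c : C) : gpartial i (gconst n c) = 0.
Proof. by rewrite gpartial_mpoly mderivC rmorph0. Qed.

Lemma gpartial_var n (i j : 'I_n) : gpartial i (gvar R j) = (i == j)%:R.
Proof.
rewrite gpartial_mpoly mderivX mnm1E eq_sym; case: eqP => [->|_].
  rewrite (_ : (U_(j) - U_(j))%MM = 0%MM); last by apply/mnmP => k; rewrite mnmBE subnn mnm0E.
  by rewrite scale1r mpolyX0 rmorph1.
by rewrite scale0r rmorph0.
Qed.

(** The difference [D] of the two sides is a derivation along the pullback that kills constants and
    variables, hence polynomials; truncation does the rest. *)
Lemma chain_rule m n (phi : holo_map R m n) f j :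
  gpartial j (pull phi f) = \sum_i pull phi (gpartial i f) * gpartial j (phi i).
Proof.
pose D f := gpartial j (pull phi f) - \sum_i pull phi (gpartial i f) * gpartial j (phi i).
have DD f1 f2 : D (f1 + f2) = D f1 + D f2.
  rewrite /D; under eq_bigr => i _ do rewrite raddfD /= rmorphD mulrDl.
  by rewrite big_split /= rmorphD raddfD /=; ring.
have DM f1 f2 : D (f1 * f2) = pull phi f1 * D f2 + D f1 * pull phi f2.
  rewrite /D rmorphM gpartialM /=.
  under eq_bigr => i _ do rewrite gpartialM rmorphD !rmorphM mulrDl /= mulrAC -[X in _ + X]mulrA.
  by rewrite big_split /= -mulr_suml -mulr_sumr; ring.
have Dc c : D (gconst n c) = 0.
  rewrite /D pull_const gpartial_const big1 ?subrr // => i _.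
  by rewrite gpartial_const rmorph0 mul0r.
have Dv i : D (gvar R i) = 0.
  rewrite /D pull_var (bigD1 i) //= gpartial_var eqxx rmorph1 mul1r.
  rewrite big1 ?addr0 ?subrr // => k ki.
  by rewrite gpartial_var (negbTE ki) rmorph0 mul0r.
have DX g k : D g = 0 -> D (g ^+ k) = 0.
  move=> Dg; elim: k => [|k IH]; first by rewrite expr0 -(rmorph1 (@gconst R n)) Dc.
  by rewrite exprS DM Dg IH mulr0 mul0r addr0.
have D0 : D 0 = 0 by rewrite -(rmorph0 (@gconst R n)) Dc.
have Dp p : D (germ_of_mpoly p) = 0.
  rewrite [p]mpolyE rmorph_sum; elim: (msupp p) => [|k s IH]; first by rewrite big_nil.
  rewrite big_cons DD IH addr0 -mul_mpolyC rmorphM DM Dc mul0r addr0.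
  rewrite mpolyXE_id rmorph_prod; elim: (index_enum _) => [|i s' IH'].
    by rewrite big_nil -(rmorph1 (@gconst R n)) Dc mulr0.
  rewrite big_cons DM rmorphXn (DX (gvar R i) _ (Dv i)) mul0r addr0 mulrCA.
  by rewrite IH' mulr0.
apply/eqP; rewrite -subr_eq0; apply/eqP/vanishP => d.
rewrite -/(D f) -[f](subrK (germ_of_mpoly (mtrunc d.+1 f))) DD Dp addr0.
have := vanish_trunc f (d := d.+1); move: (f - _) => g Hg.
apply: vanishD; first by apply: vanish_gpartial; apply: vanish_gcomp.
rewrite -sumrN; apply: vanish_sum => i; rewrite -mulrN.
have V : vanish d (pull phi (gpartial i g)) by apply: vanish_gcomp; apply: vanish_gpartial.
by have := vanishM V (@vanish0 _ _ (- gpartial j (phi i))); rewrite addn0.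
Qed.

Lemma pullback_formE m n (phi : holo_map R m n) w j :
  pullback_form phi w ord0 j = \sum_i pull phi (w ord0 i) * gpartial j (phi i).
Proof. by rewrite mxE. Qed.

Lemma pullback_comp l m n (phi : holo_map R m n) (psi : holo_map R l m) w :
  pullback_form psi (pullback_form phi w) = pullback_form (hcomp phi psi) w.
Proof.
apply/rowP => j; rewrite !pullback_formE.
under eq_bigr => i _ do rewrite pullback_formE rmorph_sum mulr_suml.
rewrite exchange_big; apply: eq_bigr => k _ /=.
rewrite chain_rule mulr_sumr; apply: eq_bigr => i _.
by rewrite rmorphM /= pull_comp mulrA.
Qed.

Lemma pullback_scale m n (phi : holo_map R m n) g (w : Defs.form R n) :
  pullback_form phi (g *: w) = pull phi g *: pullback_form phi w.
Proof.
apply/rowP => j; rewrite [RHS]mxE !pullback_formE mulr_sumr; apply: eq_bigr => i _.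
by rewrite mxE rmorphM /= mulrA.
Qed.

End ChainRule.

(** * Monomials and the last variable *)

Section Monomials.
Variable R : realType.
Local Notation C := R[i].

Definition gmono n (k : 'X_{1..n}) : germ R n := germ_of_mpoly 'X_[k].

Lemma gmonoE n (k m : 'X_{1..n}) : gmono k m = (k == m)%:R.
Proof. by rewrite gcoef_mpoly mcoeffX. Qed.

Lemma gmonoD n (k m : 'X_{1..n}) : gmono (k + m)%MM = gmono k * gmono m.
Proof. by rewrite /gmono mpolyXD rmorphM. Qed.

Lemma gmono0 n : gmono (0%MM : 'X_{1..n}) = 1.
Proof. by rewrite /gmono mpolyX0 rmorph1. Qed.

Lemma gmonoMn n (k : 'X_{1..n}) d : gmono (k *+ d)%MM = gmono k ^+ d.
Proof. by rewrite /gmono -rmorphXn /= -mpolyXn. Qed.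

Lemma gvar_mono n (i : 'I_n) : gvar R i = gmono U_(i)%MM.
Proof. by []. Qed.

Lemma gcoef_monoMD n (k m : 'X_{1..n}) (f : germ R n) : (gmono k * f) (k + m)%MM = f m.
Proof.
rewrite (gcoefM_bm _ _ (ltnSn _)) -[RHS](mcoeff_mtrunc f (d := (mdeg (k + m)).+1)).
  rewrite -[RHS](mcoeffMX _ k) commr_mpolyX; apply: (mcoeffM_trunc (ltnSn _)) => //.
  by move=> j jd; rewrite mcoeff_mtrunc.
by rewrite mdegD ltnS leq_addl.
Qed.

Lemma gcoef_monoM n (k m : 'X_{1..n}) (f : germ R n) :
  (gmono k * f) m = if (k <= m)%MM then f (m - k)%MM else 0.
Proof.
case: ifP => km; first by rewrite -{1}(submK km) addmC gcoef_monoMD.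
rewrite gcoefM; apply: big1 => -[[k1 ?] [k2 ?]] /= /eqP mk.
rewrite mcoeffX; case: eqP => [E|]; last by rewrite mul0r.
by move: km; rewrite mk -E lem_addr.
Qed.

Lemma convergent_reindex n n' (f : 'X_{1..n} -> C) (s : 'X_{1..n'} -> 'X_{1..n}) d :
  convergent f -> injective s -> (forall m, mdeg (s m) = mdeg m + d)%N ->
  convergent (f \o s).
Proof.
case=> r [b [r0 Hf]] sI sd; exists r, (b / r ^+ d); split=> // t ut.
rewrite ler_pdivlMr ?exprn_gt0 // mulr_suml.
have := Hf (map s t); rewrite map_inj_uniq // => /(_ ut); rewrite big_map; apply: le_trans.
by apply: ler_sum => m _; rewrite sd exprD mulrA.
Qed.

Definition reindex_germ n n' (f : germ R n) s d sI sd :=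
  Germ (@convergent_reindex n n' f s d (germ_convergent f) sI sd).

Lemma addm_deg n (k m : 'X_{1..n}) : mdeg (m + k)%MM = (mdeg m + mdeg k)%N.
Proof. exact: mdegD. Qed.

(* The quotient by the monomial k of the part of f divisible by it. *)
Definition quo_mono n (k : 'X_{1..n}) (f : germ R n) :=
  reindex_germ f (@addIm n k) (addm_deg k).

Lemma quo_monoE n (k m : 'X_{1..n}) (f : germ R n) : quo_mono k f m = f (m + k)%MM.
Proof. by []. Qed.

Lemma quo_monoK n (k : 'X_{1..n}) (f : germ R n) :
  (forall m, ~~ (k <= m)%MM -> f m = 0) -> gmono k * quo_mono k f = f.
Proof.
move=> Hf; apply: germP => m; rewrite gcoef_monoM.
by case: ifPn => km; [rewrite quo_monoE submK | rewrite Hf].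
Qed.

Lemma quo_monoM n (k : 'X_{1..n}) (f : germ R n) : quo_mono k (gmono k * f) = f.
Proof. by apply: germP => m; rewrite quo_monoE addmC gcoef_monoMD. Qed.

Section MonomialMaps.
Variables (m n : nat) (phi : holo_map R m n) (mu : 'I_n -> 'X_{1..m}).
Hypothesis phiE : forall i, phi i = gmono (mu i).

Definition mmul (k : 'X_{1..n}) : 'X_{1..m} := (\sum_i mu i *+ k i)%MM.

Lemma mu_neq0 i : mu i != 0%MM.
Proof.
apply/eqP => E; have := hcoord0 phi i; rewrite phiE gmonoE E eqxx => /eqP.
by rewrite oner_eq0.
Qed.

Lemma mdeg_mmul k : (mdeg k <= mdeg (mmul k))%N.
Proof.
rewrite /mmul mdeg_sum mdegE leq_sum // => i _.
by rewrite mdegMn leq_pmull // lt0n mdeg_eq0 mu_neq0.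
Qed.

Lemma prod_mono (k : 'X_{1..n}) : \prod_i phi i ^+ k i = gmono (mmul k).
Proof.
rewrite /mmul; elim: (index_enum _) => [|i s IH]; first by rewrite !big_nil gmono0.
by rewrite !big_cons gmonoD IH gmonoMn phiE.
Qed.

Lemma pull_monoE f a :
  pull phi f a = \sum_(k : 'X_{1..n < (mdeg a).+1}) f k * (mmul k == a)%:R.
Proof. by apply: eq_bigr => k _; rewrite prod_mono gmonoE. Qed.

(** Injectivity keeps distinct monomials of f from merging, so coefficients are only moved. *)
Lemma pull_mono_in (f : germ R n) k : injective mmul -> pull phi f (mmul k) = f k.
Proof.
move=> inj; rewrite pull_monoE.
have kd : (mdeg k < (mdeg (mmul k)).+1)%N by rewrite ltnS mdeg_mmul.
rewrite (bigD1 (BMultinom kd)) //= eqxx mulr1 big1 ?addr0 // => j jk.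
by rewrite (inj_eq inj) [_ == _](negbTE jk) mulr0.
Qed.

Lemma pull_mono_out (f : germ R n) a : (forall k, f k != 0 -> mmul k != a) -> pull phi f a = 0.
Proof.
move=> H; rewrite pull_monoE big1 // => k _.
have [->|/H/negbTE ->] := eqVneq (f k) 0; by rewrite ?mul0r ?mulr0.
Qed.

End MonomialMaps.
End Monomials.

Section LastVariable.
Variables (R : realType) (n : nat).
Local Notation C := R[i].
Implicit Types (f g h : germ R n.+1) (m : 'X_{1..n.+1}).
Local Notation Uy := (U_(ord_max) : 'X_{1..n.+1})%MM.

Definition mres m : 'X_{1..n} := [multinom m (fintype.lift ord_max j) | j < n].
Definition mext (k : 'X_{1..n}) (j : nat) : 'X_{1..n.+1} :=
  [multinom if unlift ord_max i is Some i' then k i' else j | i < n.+1].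

Lemma mext_max k j : mext k j ord_max = j.
Proof. by rewrite mnmE unlift_none. Qed.
Lemma mext_lift k j i : mext k j (fintype.lift ord_max i) = k i.
Proof. by rewrite mnmE liftK. Qed.
Lemma mres_ext k j : mres (mext k j) = k.
Proof. by apply/mnmP => i; rewrite mnmE mext_lift. Qed.
Lemma mext_res m : mext (mres m) (m ord_max) = m.
Proof. by apply/mnmP => i; rewrite mnmE; case: unliftP => [j ->|->] //; rewrite mnmE. Qed.
Lemma mresD m k : mres (m + k)%MM = (mres m + mres k)%MM.
Proof. by apply/mnmP => i; rewrite !mnmE. Qed.
Lemma mdeg_res m : mdeg m = (mdeg (mres m) + m ord_max)%N.
Proof.
rewrite !mdegE big_ord_recr /=; congr addn; apply: eq_bigr => i _.
by rewrite mnmE; congr (m _); apply: val_inj; rewrite /= /bump leqNgt ltn_ord.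
Qed.
Lemma mdeg_ext k j : mdeg (mext k j) = (mdeg k + j)%N.
Proof. by rewrite mdeg_res mres_ext mext_max. Qed.
Lemma mext_inj j : injective (mext^~ j).
Proof. by move=> k k' /(congr1 mres); rewrite !mres_ext. Qed.
Lemma mres_Uy d : mres (Uy *+ d)%MM = 0%MM.
Proof. by apply/mnmP => i; rewrite mnmE mulmnE mnm1E (negbTE (neq_lift _ _)) mnm0E. Qed.
Lemma Uy_max d : (Uy *+ d)%MM ord_max = d.
Proof. by rewrite mulmnE mnm1E eqxx mul1n. Qed.
Lemma lem_Uy d m : (Uy *+ d <= m)%MM = (d <= m ord_max)%N.
Proof.
apply/mnm_lepP/idP => [/(_ ord_max)|dm i]; first by rewrite Uy_max.
by rewrite mulmnE mnm1E; case: eqP => [<-|_]; rewrite ?mul1n.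
Qed.

Definition slice (j : nat) f : germ R n :=
  reindex_germ f (@mext_inj j) (fun k => mdeg_ext k j).
Lemma sliceE j f k : slice j f k = f (mext k j). Proof. by []. Qed.

Lemma proj_map0 (i : 'I_n) : gvar R (fintype.lift ord_max i) 0%MM = 0.
Proof. exact: id_map0. Qed.
Definition proj_map : holo_map R n.+1 n := HoloMap proj_map0.

Lemma mmul_proj k : mmul (fun i => U_(fintype.lift ord_max i))%MM k = mext k 0.
Proof.
apply/mnmP => i; rewrite mnm_sumE mnmE.
case: unliftP => [j ->|->].
  rewrite (bigD1 j) //= mulmnE mnm1E eqxx mul1n big1 ?addn0 // => j' jj.
  by rewrite mulmnE mnm1E (inj_eq lift_inj) (negbTE jj).
by apply: big1 => j _; rewrite mulmnE mnm1E eq_sym (negbTE (neq_lift _ _)).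
Qed.

Lemma pull_proj (g : germ R n) m :
  pull proj_map g m = if m ord_max == 0%N then g (mres m) else 0.
Proof.
have HE i : proj_map i = gmono _ U_(fintype.lift ord_max i)%MM by [].
have Hi : injective (mmul (fun i : 'I_n => U_(fintype.lift ord_max i))%MM : _ -> 'X_{1..n.+1}).
  by move=> k k'; rewrite !mmul_proj => /mext_inj.
case: eqP => [m0|m0].
  by rewrite -{1}[m]mext_res m0 -mmul_proj (pull_mono_in HE).
rewrite (pull_mono_out HE) // => k _; apply/eqP => E; apply: m0.
by rewrite -E mmul_proj mext_max.
Qed.

(** The bridge by which resultants, gcds and the Gauss lemma for polynomials in y apply to germs. *)
Definition iota_poly (P : {poly germ R n}) : germ R n.+1 :=
  (map_poly (pull proj_map) P).[gvar R ord_max].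

Lemma iota_polyB : zmod_morphism iota_poly.
Proof. by move=> P Q; rewrite /iota_poly rmorphB hornerD hornerN. Qed.
HB.instance Definition _ := GRing.isZmodMorphism.Build _ _ _ iota_polyB.
Lemma iota_polyM : monoid_morphism iota_poly.
Proof. by split=> [|P Q]; rewrite /iota_poly ?rmorph1 ?hornerC // rmorphM hornerM. Qed.
HB.instance Definition _ := GRing.isMonoidMorphism.Build _ _ _ iota_polyM.

Lemma iota_polyC (g : germ R n) : iota_poly g%:P = pull proj_map g.
Proof. by rewrite /iota_poly map_polyC hornerC. Qed.
Lemma iota_polyXn d : iota_poly 'X^d = gmono _ (Uy *+ d)%MM.
Proof. by rewrite /iota_poly rmorphXn /= map_polyX hornerXn gmonoMn. Qed.

Lemma iota_polyZXn (g : germ R n) d :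
  iota_poly (g *: 'X^d) = gmono _ (Uy *+ d)%MM * pull proj_map g.
Proof. by rewrite -mul_polyC rmorphM /= iota_polyC iota_polyXn mulrC. Qed.

Lemma gcoef_iota P m : iota_poly P m = P`_(m ord_max) (mres m).
Proof.
rewrite -[in LHS](coefK P) poly_def rmorph_sum /= gcoef_sum.
under eq_bigr => k _ do rewrite iota_polyZXn gcoef_monoM lem_Uy pull_proj mnmBE Uy_max.
have E k : (if (k <= m ord_max)%N then if (m ord_max - k == 0)%N then
   P`_k (mres (m - Uy *+ k)%MM) else 0 else 0) =
  if k == m ord_max then P`_(m ord_max) (mres m) else 0.
  have [->|km] := eqVneq k (m ord_max).
    rewrite leqnn subnn eqxx; congr (P`_ _ _); apply/mnmP => i.
    by rewrite !(mnmE _ i) mnmBE mulmnE mnm1E (negbTE (neq_lift _ _)) subn0.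
  case: leqP => // km'; rewrite subn_eq0 leqNgt ltn_neqAle km km' //.
under eq_bigr do rewrite E.
have [lt|ge] := ltnP (m ord_max) (size P).
  by rewrite -big_mkcond (big_pred1 (Ordinal lt)).
rewrite (nth_default _ ge) gcoef0 big1 // => k _.
by case: eqP => // km; have := leq_trans (ltn_ord k) ge; rewrite km ltnn.
Qed.

Lemma iota_poly_slice f d : (forall m, (d <= m ord_max)%N -> f m = 0) ->
  iota_poly (\poly_(k < d) slice k f) = f.
Proof.
move=> Hf; apply: germP => m; rewrite gcoef_iota coef_poly.
case: ltnP => dm; first by rewrite sliceE mext_res.
by rewrite gcoef0 Hf.
Qed.

Lemma iota_poly_inj : injective iota_poly.
Proof.
move=> P Q E; apply/polyP => k; apply: germP => m.
have := congr1 (fun f : germ R n.+1 => f (mext m k)) E.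
by rewrite !gcoef_iota mext_max mres_ext.
Qed.

(** Membership in the e-th power of the ideal generated by the variables other than y. *)
Definition xvanish e f := forall m, (mdeg (mres m) < e)%N -> f m = 0.

Lemma xvanish_vanish e f : xvanish e f -> vanish e f.
Proof. by move=> Hf m me; apply: Hf; apply: leq_ltn_trans me; rewrite mdeg_res leq_addr. Qed.

Lemma xvanishM e e' f g : xvanish e f -> xvanish e' g -> xvanish (e + e') (f * g).
Proof.
move=> Hf Hg m md; rewrite gcoefM; apply: big1 => -[[k1 ?] [k2 ?]] /= /eqP mk.
have [kd|kd] := ltnP (mdeg (mres k1)) e; first by rewrite Hf ?mul0r.
have := congr1 (mdeg \o mres) mk; rewrite /= mresD mdegD => E.
by rewrite Hg ?mulr0 // -(ltn_add2l e) (leq_ltn_trans _ md) // E leq_add2r.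
Qed.

Definition weierstrass_poly d (P : {poly germ R n}) :=
  [/\ P \is monic, size P = d.+1 & forall k, (k < d)%N -> P`_k 0%MM = 0].

(* Comparison of terms of lowest degree in the other variables. *)
Lemma weierstrass_uniq d P g (r : {poly germ R n}) : weierstrass_poly d P ->
  (size r <= d)%N -> iota_poly P * g = iota_poly r -> g = 0.
Proof.
move=> [Pm Ps P0] rs E.
have L1 : xvanish 1 (iota_poly (P - 'X^d)).
  move=> m; rewrite ltnS leqn0 mdeg_eq0 => /eqP m0.
  rewrite gcoef_iota m0 coefB coefXn gcoefB.
  have [lt|gt|->] := ltngtP (m ord_max) d.
  - by rewrite P0 // gcoef0 subrr.
  - by rewrite nth_default ?Ps // subrr.
  - by have := monicP Pm; rewrite lead_coefE Ps /= => ->; rewrite subrr.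
have V e : xvanish e g.
  elim: e => [|e IH] // m; rewrite ltnS leq_eqVlt => /orP[/eqP me|]; last exact: IH.
  have E2 : gmono _ (Uy *+ d)%MM * g = iota_poly r - iota_poly (P - 'X^d) * g.
    by rewrite -E -iota_polyXn rmorphB /=; ring.
  rewrite -(gcoef_monoMD (Uy *+ d)%MM) E2 gcoefB (xvanishM L1 IH) ?subr0; last first.
    by rewrite mresD mres_Uy add0m me.
  by rewrite gcoef_iota nth_default ?gcoef0 // (leq_trans rs) // mnmDE Uy_max leq_addr.
by apply: germP => m; rewrite gcoef0 (V (mdeg (mres m)).+1).
Qed.

End LastVariable.

(** * Weierstrass preparation *)

Section WeierstrassPreparation.
Variables (R : realType) (n : nat).
Local Notation C := R[i].
Implicit Types (f g h : germ R n.+1) (m : 'X_{1..n.+1}).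
Local Notation Uy d := (U_(ord_max) *+ d : 'X_{1..n.+1})%MM.

(* f(0, ..., 0, y) has order d *)
Definition yregular d f :=
  (forall k, (k < d)%N -> f (Uy k) = 0) /\ f (Uy d) != 0.

Lemma mres0 m : mres m = 0%MM -> m = Uy (m ord_max).
Proof.
move=> m0; rewrite -{1}[m]mext_res m0 -[RHS]mext_res mres_Uy; congr mext.
by rewrite Uy_max.
Qed.

Definition xyweight (r s : C) m : C := r ^+ mdeg (mres m) * s ^+ (m ord_max).

Lemma xyweight_weight (r s : C) : 0 < r -> 0 < s -> weight (xyweight r s).
Proof.
move=> r0 s0; split=> [m|m k|].
- by rewrite mulr_ge0 ?exprn_ge0 ?ltW.
- by rewrite /xyweight mresD mdegD mnmDE !exprD mulrACA.
have [t t0 /andP[/andP[_ tr] /andP[_ ts]]] := min_radius r0 s0.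
exists t => // m; rewrite mdeg_res exprD /xyweight ler_pM ?exprn_ge0 ?(ltW t0) //.
  by rewrite lerXn2r // nnegrE ltW.
by rewrite lerXn2r // nnegrE ltW.
Qed.

Lemma quo_monoB (k : 'X_{1..n.+1}) : zmod_morphism (@quo_mono R n.+1 k).
Proof. by move=> f g; apply: germP. Qed.
HB.instance Definition _ k := GRing.isZmodMorphism.Build _ _ _ (quo_monoB k).

(* Solves p + T (p w) = 1, T the quotient by y^d, by a Neumann series: w has
   positive order in the other variables, hence small norm on thin polydiscs. *)
Lemma weierstrass_neumann d (w : germ R n.+1) : xvanish 1 w ->
  exists2 p : germ R n.+1, p + quo_mono (Uy d) (p * w) = 1 & p 0%MM = 1.
Proof.
move=> w1; have [s [b [s0 Hb]]] := germ_convergent w.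
pose T := @quo_mono R n.+1 (Uy d); pose N p := - T (p * w).
have b0 := summable_by_ge0 Hb.
have sd0 : 0 < s ^+ d by rewrite exprn_gt0.
have b1 : 0 < 2 * (b + 1) by rewrite mulr_gt0 // ltr_wpDl.
(* With radii e s in the other variables and s in y, multiplication by w has norm at most e b ([Nw])
   and the quotient T by y^d has norm at most s^(-d) ([NT]). This e makes N a contraction of factor
   1/2. *)
have [e e0 /andP[/andP[_ e1] /andP[_ eb]]] := min_radius ltr01 (divr_gt0 sd0 b1).
pose W := xyweight (e * s) s.
have HW : weight W by apply: xyweight_weight => //; rewrite mulr_gt0.
have [W0 WD _] := HW.
have WE m : W m = e ^+ mdeg (mres m) * s ^+ mdeg m.
  by rewrite /W /xyweight exprMn -mulrA -exprD -mdeg_res.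
have Nw : wsummable W (e * b) w.
  move=> t ut; apply: le_trans (ler_wpM2l (ltW e0) (Hb t ut)); rewrite mulr_sumr.
  apply: ler_sum => m _; rewrite [leRHS]mulrCA.
  have [m0|m0] := posnP (mdeg (mres m)); first by rewrite w1 ?m0 // normr0 !mul0r.
  rewrite ler_wpM2l // WE ler_wpM2r ?exprn_ge0 ?(ltW s0) //.
  by rewrite -[leRHS]expr1 ler_wiXn2l ?(ltW e0).
have NT c g : wsummable W c g -> wsummable W (c / s ^+ d) (T g).
  move=> Hg t ut; rewrite ler_pdivlMr // mulr_suml.
  have := Hg [seq (m + Uy d)%MM | m <- t].
  rewrite map_inj_uniq => [/(_ ut)|]; last exact: addIm.
  rewrite big_map; apply: le_trans; apply: ler_sum => m _.
  rewrite quo_monoE WD (_ : W (Uy d) = s ^+ d) ?mulrA //.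
  by rewrite /W /xyweight mres_Uy mdeg0 expr0 mul1r Uy_max.
pose h k := iter k N 1.
have NN k : wsummable W (2^-1 ^+ k) (h k).
  elim: k => [|k IH].
    rewrite expr0 => t ut; have := @summable_by1 R n.+1 1 ler01 t ut.
    apply: le_trans; apply: ler_sum => m _; rewrite gcoef1 expr1n mulr1.
    have [->|_] := eqVneq m 0%MM; last by rewrite normr0 mul0r.
    rewrite WE mdeg0 (_ : mres 0%MM = 0%MM) ?mdeg0 ?expr0 ?mulr1 //.
    by rewrite -[X in mres X](mulm0n (U_(ord_max))%MM) mres_Uy.
  have := NT _ _ (wsummableM HW IH Nw).
  rewrite exprSr => H t ut.
  under eq_bigr => m _ do rewrite (_ : h k.+1 m = - T (h k * w) m) // normrN.
  apply: (le_trans (H t ut)); rewrite -mulrA ler_wpM2l ?exprn_ge0 ?invr_ge0 //.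
  rewrite ler_pdivrMr // [leRHS]mulrC ler_pdivlMr ?ltr0n //.
  rewrite ler_pdivlMr // in eb; apply: le_trans eb.
  by rewrite -mulrA ler_wpM2l ?(ltW e0) // mulrC ler_wpM2l ?lerDl ?ler01 ?ler0n.
have xN k p : xvanish k p -> xvanish k.+1 (N p).
  move=> Hp m mk; rewrite gcoefN quo_monoE (xvanishM Hp w1) ?oppr0 //.
  by rewrite mresD mres_Uy addm0 addn1.
have xh k : xvanish k (h k) by elim: k => [|k IH] //; apply: xN.
have half0 : 0 <= 2^-1 :> C by rewrite invr_ge0.
have [p Hp] := gseries HW (fun k => xvanish_vanish (xh k)) NN
  (fun N => @geometric_sum_le R _ N half0 (lexx _)).
exists p; last first.
  have := Hp 1 0%MM; rewrite mdeg0 big_ord1 gcoefB gcoef1 eqxx => /(_ isT)/eqP.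
  by rewrite subr_eq0 => /eqP.
apply/eqP; rewrite -subr_eq0; apply/eqP/vanishP => D.
(* T may lower the order by d, so D + d terms are taken for an error of order D. *)
pose S := \sum_(k < D + d) h k.
have ES : S + T (S * w) = 1 - h (D + d)%N.
  have -> : T (S * w) = - \sum_(k < D + d) h k.+1.
    by rewrite mulr_suml /T raddf_sum -sumrN; apply: eq_bigr => k _; rewrite /= /N opprK.
  rewrite /S; elim: (D + d)%N => [|k IH]; first by rewrite !big_ord0 /h /=; ring.
  by rewrite !big_ord_recr opprD addrACA IH /=; ring.
have -> : p + T (p * w) - 1 = (p - S) + T ((p - S) * w) - h (D + d)%N.
  have -> : h (D + d)%N = 1 - (S + T (S * w)) by rewrite ES; ring.
  by rewrite mulrBl /T raddfB /=; ring.
have V : vanish (D + d) (p - S) by apply: Hp.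
apply: vanishD; first apply: vanishD.
- by apply: vanish_le V; rewrite leq_addr.
- move=> m mD; rewrite quo_monoE; have := vanishM V (@vanish0 _ _ w).
  by apply; rewrite addn0 mdegD mdegMn mdeg1 mul1n ltn_add2r.
- move=> m mD; rewrite gcoefN (xvanish_vanish (xh _)) ?oppr0 //.
  by rewrite (leq_trans mD) // leq_addr.
Qed.

(** Write f = B + y^d u with B of degree less than d in y. The p attached by [weierstrass_neumann]
    to w = B / u gives q = p / u such that the quotient of q f by y^d is 1; hence q f = y^d - r with
    r of degree less than d in y. *)
Lemma weierstrass_preparation d f : yregular d f ->
  exists u P, [/\ u \is a GRing.unit, weierstrass_poly d P & f = u * iota_poly P].
Proof.
case=> f0 fd; pose T := @quo_mono R n.+1 (Uy d); pose u := T f.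
have uu : u \is a GRing.unit.
  by apply/germ_unitP; rewrite quo_monoE add0m.
pose B := f - gmono _ (Uy d) * u.
have BE m : B m = if (m ord_max < d)%N then f m else 0.
  rewrite gcoefB gcoef_monoM lem_Uy ltnNge; case: ifPn => dm /=; last by rewrite subr0.
  by rewrite submK ?subrr // lem_Uy.
have B1 : xvanish 1 B.
  move=> m; rewrite ltnS leqn0 mdeg_eq0 BE => /eqP/mres0 E.
  by case: ifP => // md; rewrite E f0.
have w1 : xvanish 1 (B * u^-1).
  by have := xvanishM B1 (_ : xvanish 0 u^-1); rewrite addn0; apply.
have [p Ep p0] := weierstrass_neumann d w1.
pose q := p * u^-1.
have qf : q * f = p * (B * u^-1) + gmono _ (Uy d) * p.
  rewrite -[in LHS](subrK (gmono _ (Uy d) * u) f) -/B /q mulrDr.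
  by rewrite -!mulrA (mulrC u^-1 B) [in X in _ + X](mulrC u^-1) mulrK // [in RHS](mulrC _ p).
pose r := gmono _ (Uy d) - q * f.
have Tr : T r = 0.
  have T1 : T (gmono _ (Uy d)) = 1 by rewrite /T -[X in quo_mono _ X]mulr1 quo_monoM.
  have -> : T r = T (gmono _ (Uy d)) - (T (p * (B * u^-1)) + T (gmono _ (Uy d) * p)).
    by rewrite -[X in _ - X]raddfD -raddfB /r qf.
  by rewrite T1 [T (gmono _ _ * p)]quo_monoM addrC -Ep addrC [_ + p]addrC subrr.
have rhi m : (d <= m ord_max)%N -> r m = 0.
  by rewrite -lem_Uy => dm; rewrite -(submK dm) -quo_monoE -/T Tr gcoef0.
have r0 k : (k < d)%N -> slice k r 0%MM = 0.
  move=> kd; rewrite sliceE /r gcoefB gmonoE qf gcoefD gcoef_monoM lem_Uy mext_max.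
  rewrite ifN -?ltnNge // addr0 (xvanishM (_ : xvanish 0 p) w1) ?mres_ext ?mdeg0 //.
  case: eqP => [E|]; rewrite ?subrr //; move: kd.
  by rewrite -(mext_max (0%MM : 'X_{1..n}) k) -E Uy_max ltnn.
exists q^-1, ('X^d - \poly_(k < d) slice k r).
have qu : q \is a GRing.unit.
  by rewrite unitrM unitrV uu andbT; apply/germ_unitP; rewrite p0 oner_eq0.
split; first by rewrite unitrV.
  have sz : (size (\poly_(k < d) slice k r) <= d)%N by apply: size_poly.
  split.
  - by rewrite monicE lead_coefDl ?lead_coefXn // size_polyXn size_polyN ltnS.
  - by rewrite size_polyDl ?size_polyXn // size_polyN ltnS.
  - by move=> k kd; rewrite coefB coefXn coef_poly kd (ltn_eqF kd) gcoefB gcoef0 r0 ?subrr.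
by rewrite rmorphB /= iota_polyXn iota_poly_slice // /r opprB addrC subrK mulKr.
Qed.

End WeierstrassPreparation.

(** * Factorization and elimination *)

Section Factorization.
Variables (R : realType) (n : nat).
Implicit Types (f g h p : germ R n).

Definition lead_monom f : 'X_{1..n} :=
  xget 0%MM [set m | f m != 0 /\ forall k, (k < m)%O -> f k = 0]%classic.
(** Monomials are compared by degree first, so this is the order of vanishing of a nonzero f. *)
Definition gorder f := mdeg (lead_monom f).

Lemma lead_monomP f : f != 0 ->
  f (lead_monom f) != 0 /\ forall k, (k < lead_monom f)%O -> f k = 0.
Proof.
case/min_monom=> m fm Hm; rewrite /lead_monom; case: xgetP => [_ _ //|].
by move=> /(_ m) /=; case.
Qed.

Lemma lead_monom_eq f m : f m != 0 -> (forall k, (k < m)%O -> f k = 0) ->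
  lead_monom f = m.
Proof.
move=> fm Hm; have f0 : f != 0 by apply: contraNneq fm => ->; rewrite gcoef0.
have [fl Hl] := lead_monomP f0.
by case: (ltgtP (lead_monom f) m) => // [/Hm E|/Hl E]; rewrite E eqxx in fl fm.
Qed.

Lemma gorderM f g : f != 0 -> g != 0 -> gorder (f * g) = (gorder f + gorder g)%N.
Proof.
move=> f0 g0; have [fl Hf] := lead_monomP f0; have [gl Hg] := lead_monomP g0.
rewrite /gorder -mdegD; congr mdeg; apply: lead_monom_eq.
  by rewrite min_monomM // mulf_neq0.
move=> k kl; rewrite gcoefM; apply: big1 => -[[k1 ?] [k2 ?]] /= /eqP E.
have [/Hf ->|ge1] := ltP k1 (lead_monom f); first by rewrite mul0r.
have [/Hg ->|ge2] := ltP k2 (lead_monom g); first by rewrite mulr0.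
by have := lem_add ge1 ge2; rewrite -E leNgt kl.
Qed.

Lemma gorder0_unit f : f != 0 -> (gorder f == 0%N) = (f \is a GRing.unit).
Proof.
move=> f0; have [fl Hf] := lead_monomP f0.
rewrite mdeg_eq0; apply/eqP/germ_unitP => [E|f00]; first by rewrite -E.
by apply: lead_monom_eq => // k; rewrite ltNge le0m.
Qed.

Lemma irreducible_neq0 f : irreducible_germ f -> f != 0.
Proof.
case=> fu fi; apply/eqP => f0; have [] := fi 0 0; rewrite ?f0 ?mul0r //;
  by move: fu; rewrite f0 => /negP.
Qed.

(** The order of vanishing is additive and positive on nonzero non-units, so it drops in a proper
    factor. *)
Lemma irreducible_factor f : f != 0 -> f \isn't a GRing.unit ->
  exists2 p, irreducible_germ p & gdvd p f.
Proof.
have [k] := ubnP (gorder f); elim: k f => // k IH f; rewrite ltnS => fk f0 fu.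
have [fi|] := pselect (irreducible_germ f); first by exists f => //; exists 1; rewrite mul1r.
rewrite /irreducible_germ => /not_andP[//|/existsNP[g /existsNP[h /not_implyP[E /not_orP[gu hu]]]]].
have g0 : g != 0 by apply: contraNneq f0 => g0; rewrite E g0 mul0r.
have h0 : h != 0 by apply: contraNneq f0 => h0; rewrite E h0 mulr0.
have gk : (gorder g < k)%N.
  apply: leq_trans fk; rewrite E gorderM // -addn1 leq_add2l lt0n gorder0_unit //.
  exact/negP.
have [|p pi [q Eq]] := IH g gk g0; first exact/negP.
by exists p => //; exists (h * q); rewrite E Eq mulrC mulrA.
Qed.

Definition prime_germ p :=
  [/\ p != 0, p \isn't a GRing.unit & forall f g, gdvd p (f * g) -> gdvd p f \/ gdvd p g].

Lemma gdvdD p f g : gdvd p f -> gdvd p g -> gdvd p (f + g).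
Proof. by case=> a -> [b ->]; exists (a + b); rewrite mulrDl. Qed.
Lemma gdvdN p f : gdvd p f -> gdvd p (- f).
Proof. by case=> a ->; exists (- a); rewrite mulNr. Qed.
Lemma gdvdMl p f g : gdvd p f -> gdvd p (g * f).
Proof. by case=> a ->; exists (g * a); rewrite mulrA. Qed.
Lemma gdvdMr p f g : gdvd p f -> gdvd p (f * g).
Proof. by rewrite mulrC; apply: gdvdMl. Qed.
Lemma gdvd0 p : gdvd p 0. Proof. by exists 0; rewrite mul0r. Qed.
Lemma gdvd_sum p (I : Type) (s : seq I) (P : pred I) (F : I -> germ R n) :
  (forall i, P i -> gdvd p (F i)) -> gdvd p (\sum_(i <- s | P i) F i).
Proof. by move=> HF; elim/big_ind: _ => //; [exact: gdvd0 | exact: gdvdD]. Qed.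

(** If [P]_i[and]Q[_j] are the first coefficients not divisible by p, the coefficient of index i + j
    of the product is their product modulo p. *)
Lemma prime_coef p (P Q : {poly germ R n}) : prime_germ p ->
  (forall k, gdvd p (P * Q)`_k) -> (forall k, gdvd p P`_k) \/ (forall k, gdvd p Q`_k).
Proof.
move=> [_ _ pp] H; apply: contrapT => /not_orP[/existsNP[i0 Hi0] /existsNP[j0 Hj0]].
have first_bad (S : {poly germ R n}) k0 : ~ gdvd p S`_k0 ->
    exists2 i, ~ gdvd p S`_i & forall k, (k < i)%N -> gdvd p S`_k.
  elim/ltn_ind: k0 => k IH Hk.
  have [A|/existsNP[j /not_implyP[jk Hj]]] := pselect (forall j, (j < k)%N -> gdvd p S`_j).
    by exists k.
  exact: IH jk Hj.
have [i Pi Hi] := first_bad _ _ Hi0; have [j Qj Hj] := first_bad _ _ Hj0.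
have := H (i + j)%N; rewrite coefM (bigD1 (inord i)) //= inordK ?ltnS ?leq_addr // addKn.
set s := \sum_(_ < _ | _) _ => Hs.
have {}Hs : gdvd p (P`_i * Q`_j).
  rewrite -[_ * _](addrK s); apply: gdvdD => //; apply: gdvdN; apply: gdvd_sum => k ki.
  have [lt|ge] := ltnP k i; first by apply: gdvdMr; apply: Hi.
  have {}ge : (i < k)%N.
    rewrite ltn_neqAle ge andbT; apply: contraNneq ki => E.
    by apply/eqP/val_inj; rewrite /= inordK // ltnS leq_addr.
  by apply: gdvdMl; apply: Hj; rewrite ltn_subLR ?ltn_add2r // -ltnS.
by case: (pp _ _ Hs).
Qed.

Lemma gdvd_poly p (P : {poly germ R n}) : (forall k, gdvd p P`_k) ->
  exists Q, P = p *: Q.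
Proof.
move=> H; have /choice[q Hq] : forall k, exists h, P`_k = h * p by move=> k; apply: H.
exists (\poly_(k < size P) q k); apply/polyP => k; rewrite coefZ coef_poly.
by case: ltnP => kP; [rewrite Hq mulrC | rewrite mulr0 nth_default].
Qed.

(** The Gauss lemma in denominator-free form: each irreducible factor of c divides all coefficients
    of G1 or all those of G2 and is cancelled there. The primality hypothesis is what the induction
    on the dimension will supply. *)
Lemma gauss_monic : (forall p, irreducible_germ p -> prime_germ p) ->
  forall c (P G1 G2 : {poly germ R n}), P \is monic -> c != 0 -> c *: P = G1 * G2 ->
  exists Q1 Q2, [/\ P = Q1 * Q2, size Q1 = size G1 & size Q2 = size G2].
Proof.
move=> irr_prime c P; have [k] := ubnP (gorder c).
elim: k c => // k IH c; rewrite ltnS => ck G1 G2 Pm c0 E.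
have [cu|cu] := boolP (c \is a GRing.unit).
  exists (c^-1 *: G1), G2; split=> //; last by rewrite size_scale ?invr_eq0.
  by rewrite -scalerAl -E scalerA mulVr // scale1r.
have [p pi [c' Ec]] := irreducible_factor c0 cu.
have [p0 pu pp] := irr_prime _ pi.
have c'0 : c' != 0 by apply: contraNneq c0 => E'; rewrite Ec E' mul0r.
have c'k : (gorder c' < k)%N.
  apply: leq_trans ck; rewrite Ec gorderM // -addn1 leq_add2l lt0n gorder0_unit //.
have pd j : gdvd p (G1 * G2)`_j.
  by rewrite -E coefZ Ec; exists (c' * P`_j); rewrite mulrAC.
have pI : injective (fun Q : {poly germ R n} => p *: Q).
  by move=> Q Q' /=; rewrite -!mul_polyC; apply: mulfI; rewrite polyC_eq0.
have [H|H] := prime_coef (irr_prime _ pi) pd; have [G' EG] := gdvd_poly H.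
  have [|Q1 [Q2 [EP S1 S2]]] := IH c' c'k G' G2 Pm c'0.
    by apply: pI; rewrite /= scalerA mulrC -Ec E EG scalerAl.
  by exists Q1, Q2; rewrite EG size_scale.
have [|Q1 [Q2 [EP S1 S2]]] := IH c' c'k G1 G' Pm c'0.
  by apply: pI; rewrite /= scalerA mulrC -Ec E EG scalerAr.
by exists Q1, Q2; rewrite EG size_scale.
Qed.

End Factorization.

Section Elimination.
Variables (R : realType) (n : nat).
Implicit Types (f g : germ R n.+1) (P Q : {poly germ R n}).
Hypothesis irr_prime : forall p : germ R n, irreducible_germ p -> prime_germ p.

(* Modulo the other variables a Weierstrass polynomial is a power of y. *)
Lemma weierstrass_factor d P Q1 Q2 : weierstrass_poly d P -> P = Q1 * Q2 ->
  iota_poly Q1 \is a GRing.unit -> (size Q1 <= 1)%N.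
Proof.
move=> [Pm Ps P0] E Q1u.
pose ev := fun h : germ R n => h 0%MM.
have evB : zmod_morphism ev by move=> a b; rewrite /ev gcoefB.
have evM : monoid_morphism ev.
  by split=> [|a b]; rewrite /ev ?gcoef1 ?eqxx // gcoefM0.
pose ev' : {rmorphism germ R n -> R[i]} :=
  HB.pack ev (GRing.isZmodMorphism.Build _ _ ev evB) (GRing.isMonoidMorphism.Build _ _ ev evM).
have EP : map_poly ev' P = 'X^d.
  apply/polyP => k; rewrite coef_map coefXn /= /ev.
  have [lt|gt|->] := ltngtP k d; first by rewrite P0.
    by rewrite nth_default ?Ps // gcoef0.
  by have := monicP Pm; rewrite lead_coefE Ps /= => ->; rewrite gcoef1 eqxx.
have EP2 : map_poly ev' Q1 * map_poly ev' Q2 = 'X^d by rewrite -EP E rmorphM.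
have lu : lead_coef Q1 \is a GRing.unit.
  have := monicP Pm; rewrite E lead_coefM => El.
  by apply/unitrPr; exists (lead_coef Q2).
have sQ1 : size (map_poly ev' Q1) = size Q1.
  by rewrite size_map_poly_id0 //=; apply/germ_unitP.
have r0 : ~~ root (map_poly ev' Q1) 0.
  move/germ_unitP: Q1u; rewrite gcoef_iota => h; apply: contraNN h.
  rewrite rootE horner_coef0 coef_map /= /ev mnm0E (_ : mres 0%MM = 0%MM) //.
  by rewrite -[X in mres X](mulm0n (U_(ord_max))%MM) mres_Uy.
(* At the origin Q1 has a nonzero constant term, so it is prime to y and the whole of y^d goes into
   Q2; this leaves degree 0 for Q1. *)
have D : 'X^d %| map_poly ev' Q2.
  rewrite -(Gauss_dvdpr _ (q := map_poly ev' Q1)); last first.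
    by rewrite coprimep_sym coprimep_expr // coprimepX.
  by rewrite EP2 dvdpp.
have X0 : 'X^d != 0 :> {poly R[i]} by rewrite -size_poly_eq0 size_polyXn.
have Q10 : map_poly ev' Q1 != 0 by apply: contraNneq X0 => Z; rewrite -EP2 Z mul0r.
have Q20 : map_poly ev' Q2 != 0 by apply: contraNneq X0 => Z; rewrite -EP2 Z mulr0.
have := dvdp_leq Q20 D; rewrite size_polyXn => sd.
have := congr1 (fun S : {poly R[i]} => size S) EP2.
rewrite size_mul // size_polyXn sQ1; move: sd; lia.
Qed.

(** The germ r is the resultant of the Weierstrass polynomials P and Q of f and g. Were it 0, their
    gcd would give a factorization P = Q1 Q2 with Q1 of positive degree; irreducibility of f makes
    Q2 a unit, hence constant in y, so P divides Q and f divides g. *)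
Lemma elimination d e f g : yregular d f -> yregular e g -> irreducible_germ f ->
  ~ gdvd f g -> exists2 r : germ R n, r != 0 &
  exists a b, pull (proj_map R n) r = a * f + b * g.
Proof.
move=> fr gr fi fg.
have [u [P [uu Pw Ef]]] := weierstrass_preparation fr.
have [v [Q [vu Qw Eg]]] := weierstrass_preparation gr.
have [Pm Ps P0] := Pw; have [Qm Qs Q0] := Qw.
have [fu fd] := fi.
have d0 : (0 < d)%N.
  rewrite lt0n; apply: contraNneq fu => E; apply/germ_unitP.
  by case: fr => _; rewrite E mulm0n.
(* The resultant identity requires nonconstant polynomials; for e = 0 the germ g is a unit and r = 1
   works. *)
have [e0|e0] := posnP e.
  exists 1; first exact: oner_neq0.
  exists 0, g^-1; rewrite rmorph1 mul0r add0r mulVr //; apply/germ_unitP.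
  by case: gr => _; rewrite e0 mulm0n.
have [||[A B] /= _ ER] := @resultant_in_ideal _ P Q; rewrite ?Ps ?Qs ?ltnS //.
exists (resultant P Q); last first.
  exists (iota_poly A * u^-1), (iota_poly B * v^-1).
  by rewrite -iota_polyC ER rmorphD !rmorphM /= Ef Eg -!mulrA !mulKr.
rewrite resultant_eq0 -leqNgt; rewrite leqNgt; apply/negP => sG; apply: fg.
set G := gcdp P Q in sG.
have /Pdiv.Idomain.dvdpP[[c S] /= c0 EG] : (G %| P)%R := dvdp_gcdl P Q.
rewrite mulrC in EG.
have [Q1 [Q2 [EP S1 S2]]] := gauss_monic irr_prime Pm c0 EG.
have Q1u : iota_poly Q1 \isn't a GRing.unit.
  by apply/negP => /(weierstrass_factor Pw EP); rewrite S1 leqNgt sG.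
have Q2u : iota_poly Q2 \is a GRing.unit.
  have EE : f = (u * iota_poly Q1) * iota_poly Q2 by rewrite -mulrA -rmorphM -EP.
  by have [|] := fd _ _ EE; rewrite // unitrM (negbTE Q1u) andbF.
have s2 : (size Q2 <= 1)%N.
  by apply: weierstrass_factor Pw _ Q2u; rewrite EP mulrC.
have PG : P %= G.
  have P_0 : P != 0 by apply: monic_neq0.
  have Q10 : Q1 != 0 by apply: contraNneq P_0 => E; rewrite EP E mul0r.
  have Q20 : Q2 != 0 by apply: contraNneq P_0 => E; rewrite EP E mulr0.
  rewrite eqp_sym -dvdp_size_eqp ?dvdp_gcdl // -S1 EP size_mul //.
  by have := size_poly_gt0 Q2; rewrite Q20; move: s2; case: (size Q2) => [|[|]] // _ _; rewrite addn1.
have PQ : (P %| Q)%R by rewrite (eqp_dvdl _ PG) dvdp_gcdr.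
have EQ := Pdiv.IdomainMonic.divp_eq Pm Q.
exists (v * iota_poly (Q %/ P) * u^-1).
have {}EQ : Q = Q %/ P * P by rewrite {1}EQ (eqP PQ) addr0.
have -> : v * iota_poly (Q %/ P) * u^-1 * f = v * (iota_poly (Q %/ P) * iota_poly P).
  by rewrite Ef -!mulrA mulKr.
by rewrite -rmorphM -EQ.
Qed.

End Elimination.

(** * Regularity along a coordinate axis and primality *)

Section Arcs.
Variable R : realType.
Local Notation C := R[i].

Lemma sub_map0 n (N : nat) (i : 'I_n.+2) :
  (if unlift ord_max i is Some j then gvar R j else gvar R (ord0 : 'I_n.+1) ^+ N.+1) 0%MM = 0.
Proof.
case: unliftP => [j _|_]; first exact: id_map0.
by rewrite gcoefX0 id_map0 expr0n.
Qed.
(* substitutes x_0^(N+1) for the last variable *)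
Definition sub_map n N : holo_map R n.+1 n.+2 := HoloMap (@sub_map0 n N).

Lemma sub_map_lift n N (j : 'I_n.+1) : sub_map n N (fintype.lift ord_max j) = gvar R j.
Proof. by rewrite /= liftK. Qed.
Lemma sub_map_max n N : sub_map n N ord_max = gvar R ord0 ^+ N.+1.
Proof. by rewrite /= unlift_none. Qed.

Lemma pull_ext m n (phi psi : holo_map R m n) f :
  (forall i, phi i = psi i) -> pull phi f = pull psi f.
Proof. by move/holo_mapP ->. Qed.

Lemma low_slice n (f : germ R n.+1) : f != 0 ->
  exists e h, f = gvar R ord_max ^+ e * h /\ slice 0 h != 0.
Proof.
move=> f0.
have [k Hk] : exists k, slice k f != 0.
  apply: contrapT => /forallNP H; case/eqP: f0; apply: germP => m; rewrite gcoef0.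
  have /negP := H (m ord_max); rewrite negbK => /eqP/(congr1 (fun g : germ R n => g (mres m))).
  by rewrite sliceE mext_res gcoef0.
have exP : exists k, (slice k f != 0) by exists k.
case: (ex_minnP exP) => e He Hmin.
have E : f = gmono _ (U_(ord_max) *+ e)%MM * quo_mono (U_(ord_max) *+ e)%MM f.
  rewrite quo_monoK // => m; rewrite lem_Uy -ltnNge => me.
  have : slice (m ord_max) f == 0 by apply: contraTT me => /Hmin; rewrite -leqNgt.
  by move/eqP/(congr1 (fun g : germ R n => g (mres m))); rewrite sliceE mext_res gcoef0.
exists e, (quo_mono (U_(ord_max) *+ e)%MM f); split; first by rewrite {1}E gmonoMn.
suff -> : slice 0 (quo_mono (U_(ord_max) *+ e)%MM f) = slice e f by [].
apply: germP => m; rewrite !sliceE quo_monoE; congr (f _).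
rewrite -[LHS]mext_res mresD mres_ext mres_Uy addm0; congr mext.
by rewrite mnmDE mext_max Uy_max.
Qed.

(** After removal of a power of the last variable, f restricts to a nonzero germ on its zero locus.
    Substituting a power of x_0 larger than the order of this restriction leaves its leading
    monomial untouched. *)
Lemma sub_nonzero n (f : germ R n.+2) : f != 0 -> exists N, pull (sub_map n N) f != 0.
Proof.
move=> /low_slice[e [h [-> h0]]]; pose N := gorder (slice 0 h).
exists N; rewrite rmorphM rmorphXn /= pull_var sub_map_max -exprM mulf_neq0 //.
  rewrite expf_neq0 //; apply/eqP => /(congr1 (fun g : germ R n.+1 => g U_(ord0)%MM)).
  by rewrite gvar_mono gmonoE eqxx gcoef0 => /eqP; rewrite oner_eq0.
have [lm _] := lead_monomP h0.
apply/eqP => E; case/negP: lm; apply/eqP.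
pose h1 := quo_mono U_(ord_max)%MM (h - pull (proj_map R n.+1) (slice 0 h)).
have Eh : h = pull (proj_map R n.+1) (slice 0 h) + gvar R ord_max * h1.
  rewrite gvar_mono quo_monoK; first by rewrite addrC subrK.
  move=> m; rewrite -[U_(_)%MM]mulm1n lem_Uy -ltnNge ltnS leqn0 => /eqP m0.
  rewrite gcoefB pull_proj m0 eqxx sliceE -{1}[m]mext_res m0 subrr //.
have E2 : pull (sub_map n N) h = slice 0 h + gvar R ord0 ^+ N.+1 * pull (sub_map n N) h1.
  rewrite {1}Eh rmorphD rmorphM /= pull_var sub_map_max pull_comp; congr (_ + _).
  rewrite -[RHS]pull_id; apply: pull_ext => i.
  by rewrite hcompE pull_var sub_map_lift.
have : (pull (sub_map n N) h) (lead_monom (slice 0 h)) = 0 by rewrite E gcoef0.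
rewrite E2 gcoefD.
rewrite gvar_mono -gmonoMn gcoef_monoM; case: ifP => [le|_]; last by rewrite addr0.
have := lemc_mdeg (lem_leo le).
by rewrite mdegMn mdeg1 mul1n -/(gorder _) -/N ltnn.
Qed.

(** The arc is moreover a graph over the first coordinate, which is what lets [shear] straighten it
    into the y-axis. *)
Lemma arc_nonzero n (f : germ R n.+1) : f != 0 ->
  exists2 gamma : holo_map R 1 n.+1, gamma ord0 = gvar R ord0 & pull gamma f != 0.
Proof.
elim: n f => [|n IH] f f0.
  exists (id_map R 1); rewrite ?pull_id //.
have [N HN] := sub_nonzero f0; have [gamma g0 Hg] := IH _ HN.
exists (hcomp (sub_map n N) gamma); last by rewrite -pull_comp.
rewrite hcompE (_ : ord0 = fintype.lift ord_max (ord0 : 'I_n.+1)); last exact: val_inj.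
by rewrite sub_map_lift pull_var.
Qed.

Section Shear.
Variables (n : nat) (gamma : holo_map R 1 n.+1).

Lemma single_map0 m (f : germ R m) : f 0%MM = 0 -> forall i : 'I_1, (fun=> f) i 0%MM = 0.
Proof. by []. Qed.
Definition single_map m (f : germ R m) f0 : holo_map R m 1 := HoloMap (@single_map0 m f f0).

Definition ymap := single_map (@id_map0 R n.+1 ord_max).
Definition zmap := single_map (@id_map0 R n.+1 ord0).

Lemma shear0 (i : 'I_n.+1) : (if unlift ord0 i is Some j
  then gvar R (fintype.lift ord_max j) + pull ymap (gamma i) else gvar R ord_max) 0%MM = 0.
Proof.
by case: unliftP => [j _|_]; rewrite ?gcoefD ?id_map0 ?pull0c ?hcoord0 ?addr0.
Qed.
(* (x', y) |-> (y, x' + gamma(y)), which carries the y-axis to gamma *)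
Definition shear : holo_map R n.+1 n.+1 := HoloMap shear0.

Lemma unshear0 (i : 'I_n.+1) : (if unlift ord_max i is Some j
  then gvar R (fintype.lift ord0 j) - pull zmap (gamma (fintype.lift ord0 j))
  else gvar R ord0) 0%MM = 0.
Proof.
by case: unliftP => [j _|_]; rewrite ?gcoefB ?id_map0 ?pull0c ?hcoord0 ?subr0.
Qed.
Definition unshear : holo_map R n.+1 n.+1 := HoloMap unshear0.

Lemma shear_ord0 : shear ord0 = gvar R ord_max.
Proof. by rewrite /= unlift_none. Qed.
Lemma shear_lift j : shear (fintype.lift ord0 j) =
  gvar R (fintype.lift ord_max j) + pull ymap (gamma (fintype.lift ord0 j)).
Proof. by rewrite /= liftK. Qed.
Lemma unshear_max : unshear ord_max = gvar R ord0.
Proof. by rewrite /= unlift_none. Qed.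
Lemma unshear_lift j : unshear (fintype.lift ord_max j) =
  gvar R (fintype.lift ord0 j) - pull zmap (gamma (fintype.lift ord0 j)).
Proof. by rewrite /= liftK. Qed.

Lemma shearK f : pull unshear (pull shear f) = f.
Proof.
rewrite pull_comp -[RHS]pull_id; apply: pull_ext => i; rewrite hcompE.
have [j ->|->] := unliftP ord0 i; last by rewrite shear_ord0 pull_var unshear_max.
rewrite shear_lift rmorphD /= pull_var unshear_lift pull_comp.
rewrite (@pull_ext _ _ (hcomp ymap unshear) zmap) ?subrK // => k.
by rewrite hcompE pull_var unshear_max.
Qed.

Lemma irreducible_shear f : irreducible_germ f -> irreducible_germ (pull shear f).
Proof.
case=> fu fi; split; first by rewrite pull_unit.
move=> g h E; have [] := fi (pull unshear g) (pull unshear h).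
- by rewrite -rmorphM -E /= shearK.
- by rewrite pull_unit; left.
- by rewrite pull_unit; right.
Qed.

Lemma gdvd_shear f g : gdvd (pull shear f) (pull shear g) -> gdvd f g.
Proof. by case=> h E; exists (pull unshear h); rewrite -[g]shearK E rmorphM /= shearK. Qed.

End Shear.

Section Axes.
Variable n : nat.

Lemma axis0 (j i : 'I_n) : (if i == j then gvar R (ord0 : 'I_1) else 0) 0%MM = 0.
Proof. by case: ifP => _; rewrite ?id_map0 ?gcoef0. Qed.
Definition axis (j : 'I_n) : holo_map R 1 n := HoloMap (axis0 j).

Lemma axisE j i : axis j i = if i == j then gvar R (ord0 : 'I_1) else 0.
Proof. by []. Qed.

Lemma mnm1_one (m : 'X_{1..1}) : m = (U_(ord0) *+ m ord0)%MM.
Proof. by apply/mnmP => i; rewrite (ord1 i) mulmnE mnm1E eqxx mul1n. Qed.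

Lemma pull_axis j f k : pull (axis j) f (U_(ord0) *+ k)%MM = f (U_(j) *+ k)%MM.
Proof.
have E (a : 'X_{1..n}) : \prod_i axis j i ^+ a i =
    if a == (U_(j) *+ a j)%MM then gmono _ (U_(ord0) *+ a j)%MM else 0.
  rewrite (bigD1 j) // axisE eqxx; have [a0|a0] := eqVneq a (U_(j) *+ a j)%MM.
    rewrite big1 /= ?mulr1 ?gmonoMn // => i ij.
    by rewrite a0 mulmnE mnm1E (eq_sym j i) (negbTE ij) mul0n expr0.
  have [i ij ai] : exists2 i, i != j & a i != 0%N.
    apply: contrapT => H; case/eqP: a0; apply/mnmP => i; rewrite mulmnE mnm1E.
    have [->|ij] := eqVneq j i; first by rewrite mul1n.
    by rewrite mul0n; apply: contrapT => /eqP ai; apply: H; exists i; rewrite // eq_sym.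
  rewrite (bigD1 i) ?ij // axisE (negbTE ij) expr0n (negbTE ai) /=.
  by rewrite mul0r mulr0.
have kd : (mdeg (U_(j) *+ k : 'X_{1..n})%MM < (mdeg (U_(ord0) *+ k : 'X_{1..1})%MM).+1)%N.
  by rewrite !mdegMn !mdeg1.
have Uj : (U_(j) *+ k : 'X_{1..n})%MM j = k by rewrite mulmnE mnm1E eqxx mul1n.
rewrite -[LHS]/(comp_coef f (axis j) _) /comp_coef; under eq_bigr => a _ do rewrite E.
rewrite (bigD1 (BMultinom kd)) //= big1 => [|a ak].
  by rewrite Uj eqxx gmonoE eqxx mulr1 addr0.
case: eqP => [a0|]; last by rewrite gcoef0 mulr0.
rewrite gmonoE; case: eqP => [e|_]; last by rewrite mulr0.
case/eqP: ak; apply: val_inj => /=; rewrite a0; congr (_ *+ _)%MM.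
by have := congr1 (fun b : 'X_{1..1} => b ord0) e; rewrite !mulmnE !mnm1E !eqxx !mul1n.
Qed.

End Axes.

Section YAxis.
Variable n : nat.
Local Notation yaxis := (axis (ord_max : 'I_n.+1)).

Lemma yregular_axis f : pull yaxis f != 0 -> exists d, yregular d f.
Proof.
move=> f0; have exP : exists d, f (U_(ord_max) *+ d)%MM != 0.
  apply: contrapT => /forallNP H; case/eqP: f0; apply: germP => m.
  by rewrite gcoef0 (mnm1_one m) pull_axis; apply/eqP/negPn/negP.
case: (ex_minnP exP) => d Hd Hmin; exists d; split=> // k kd.
by apply/eqP; apply: contraTT kd => /Hmin; rewrite -leqNgt.
Qed.

Lemma shear_yaxis (gamma : holo_map R 1 n.+1) : gamma ord0 = gvar R ord0 ->
  hcomp (shear gamma) yaxis = gamma.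
Proof.
move=> g0; apply: holo_mapP => i; rewrite hcompE.
have [j ->|->] := unliftP ord0 i; last by rewrite shear_ord0 pull_var /= eqxx.
rewrite shear_lift rmorphD /= pull_var /= eq_sym (negbTE (neq_lift _ _)) add0r pull_comp.
by rewrite -[RHS]pull_id; apply: pull_ext => k; rewrite hcompE pull_var /= eqxx (ord1 k).
Qed.

End YAxis.

(** Induction on n. If f divides g h but neither factor, elimination yields nonzero r = a f + b g
    and r' = a' f + b' h free of y, after a shear making all three regular in y. Then f divides r
    r', which [weierstrass_uniq] forbids since r r' has degree 0 in y and f is equivalent to a
    Weierstrass polynomial of positive degree. *)
Theorem irreducible_prime n (f : germ R n) : irreducible_germ f -> prime_germ f.
Proof.
elim: n f => [|n IH] f fi; have f0 := irreducible_neq0 fi; have [fu _] := fi.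
  case/negP: fu; apply/germ_unitP; apply: contraNneq f0 => E.
  by apply/eqP/germP => m; rewrite (nvar0_mnmE m) E gcoef0.
split=> // g h fgh; apply: contrapT => /not_orP[fg fh].
have g0 : g != 0 by apply/eqP => E; apply: fg; rewrite E; exact: gdvd0.
have h0 : h != 0 by apply/eqP => E; apply: fh; rewrite E; exact: gdvd0.
have [gamma gamma0] := arc_nonzero (mulf_neq0 f0 (mulf_neq0 g0 h0)).
rewrite -(shear_yaxis gamma0) -pull_comp.
pose Y k := pull (axis ord_max) (pull (shear gamma) k).
rewrite (_ : pull _ _ = Y f * (Y g * Y h)); last by rewrite /Y !rmorphM.
move=> YY; have Yf : Y f != 0 by apply: contraNneq YY => ->; rewrite mul0r.
have Yg : Y g != 0 by apply: contraNneq YY => ->; rewrite mul0r mulr0.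
have Yh : Y h != 0 by apply: contraNneq YY => ->; rewrite !mulr0.
have [d fr] := yregular_axis Yf; have [d1 gr] := yregular_axis Yg.
have [d2 hr] := yregular_axis Yh.
have fi' := irreducible_shear gamma fi.
have [r r0 [a [b Er]]] := elimination IH fr gr fi' (fun H => fg (gdvd_shear H)).
have [r' r'0 [a' [b' Er']]] := elimination IH fr hr fi' (fun H => fh (gdvd_shear H)).
have [q Eq] := fgh.
have [u [P [uu Pw EP]]] := weierstrass_preparation fr.
have d0 : (0 < d)%N.
  rewrite lt0n; apply: contraNneq fu => E; rewrite -(pull_unit (shear gamma)).
  by apply/germ_unitP; case: fr => _; rewrite E mulm0n.
have Err : iota_poly P * (u * (a * (a' * pull (shear gamma) f + b' * pull (shear gamma) h)
   + b * (pull (shear gamma) g * a' + b' * pull (shear gamma) q))) = iota_poly (r * r')%:P.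
  rewrite iota_polyC rmorphM /= Er Er' mulrA [iota_poly P * u]mulrC -EP.
  have E : pull (shear gamma) g * pull (shear gamma) h =
           pull (shear gamma) q * pull (shear gamma) f by rewrite -!rmorphM Eq.
  transitivity (a * pull (shear gamma) f * (a' * pull (shear gamma) f + b' * pull (shear gamma) h)
   + b * b' * (pull (shear gamma) q * pull (shear gamma) f)
   + b * a' * pull (shear gamma) g * pull (shear gamma) f); first by ring.
  by rewrite -E; ring.
have := weierstrass_uniq Pw (_ : (size (r * r')%:P <= d)%N) Err.
move=> /(_ (leq_trans (size_polyC_leq1 _) d0)) Z; rewrite Z mulr0 in Err.
have := iota_poly_inj (_ : iota_poly (r * r')%:P = iota_poly 0).
rewrite rmorph0 -Err => /(_ erefl)/eqP.
by rewrite polyC_eq0 mulf_eq0 (negbTE r0) (negbTE r'0).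
Qed.

End Arcs.

(** * Puiseux roots *)

Section Puiseux.
Variable R : realType.
Local Notation C := R[i].
Local Notation X := (ord0 : 'I_2).
Local Notation Y := (ord_max : 'I_2).

Lemma gcomp_bound m n (phi : holo_map R m n) f a B : (mdeg a < B)%N ->
  pull phi f a = \sum_(k : 'X_{1..n < B}) f k * (\prod_i phi i ^+ k i) a.
Proof.
move=> aB; have /eqP := gcomp_subst phi f aB; rewrite gcoefB subr_eq0 => /eqP ->.
rewrite /mtrunc raddf_sum gcoef_sum; apply: eq_bigr => k _.
by rewrite /= mmapZ gcoef_const mmapX.
Qed.

Definition mn2 (a b : nat) : 'X_{1..2} := (U_(X) *+ a + U_(Y) *+ b)%MM.

Lemma mn2_X a b : mn2 a b X = a.
Proof. by rewrite mnmDE !mulmnE !mnm1E /= mul1n mul0n addn0. Qed.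
Lemma mn2_Y a b : mn2 a b Y = b.
Proof. by rewrite mnmDE !mulmnE !mnm1E /= mul1n mul0n. Qed.

Lemma ord2_ind (P : 'I_2 -> Prop) : P X -> P Y -> forall i, P i.
Proof.
move=> PX PY [[|[|//]] Hi].
  by rewrite (_ : Ordinal Hi = X) //; apply: val_inj.
by rewrite (_ : Ordinal Hi = Y) //; apply: val_inj.
Qed.

Lemma mnm2P (m k : 'X_{1..2}) : m X = k X -> m Y = k Y -> m = k.
Proof. by move=> HX HY; apply/mnmP; apply: ord2_ind. Qed.

Lemma mn2_eta (m : 'X_{1..2}) : mn2 (m X) (m Y) = m.
Proof. by apply: mnm2P; rewrite ?mn2_X ?mn2_Y. Qed.

Lemma mdeg_mn2 a b : mdeg (mn2 a b) = (a + b)%N.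
Proof. by rewrite mdegD !mdegMn !mdeg1 !mul1n. Qed.

Lemma mn2_0r a : mn2 a 0 = (U_(X) *+ a)%MM.
Proof. by rewrite /mn2 mulm0n addm0. Qed.
Lemma mn2_0l b : mn2 0 b = (U_(Y) *+ b)%MM.
Proof. by rewrite /mn2 mulm0n add0m. Qed.

Lemma pair_map0 m (f g : germ R m) : f 0%MM = 0 -> g 0%MM = 0 ->
  forall i : 'I_2, (if i == X then f else g) 0%MM = 0.
Proof. by move=> f0 g0 i; case: ifP. Qed.
Definition pair_map m (f g : germ R m) f0 g0 : holo_map R m 2 := HoloMap (@pair_map0 m f g f0 g0).

Lemma pair_X m f g f0 g0 : @pair_map m f g f0 g0 X = f. Proof. by []. Qed.
Lemma pair_Y m f g f0 g0 : @pair_map m f g f0 g0 Y = g. Proof. by []. Qed.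

Lemma lift_X (j : 'I_1) : fintype.lift Y j = X.
Proof. by rewrite (ord1 j); apply: val_inj. Qed.

(** The Weierstrass polynomial of g is y - s(x). *)
Lemma implicit_function (g : germ R 2) : yregular 1 g ->
  exists s : germ R 1, exists s0 : s 0%MM = 0,
    pull (pair_map (id_map0 R (ord0 : 'I_1)) s0) g = 0.
Proof.
move=> /weierstrass_preparation[u [P [uu [Pm Ps P0] Eg]]].
have s0 : (- P`_0) 0%MM = 0 by rewrite gcoefN P0 ?oppr0.
exists (- P`_0), s0; set phi := pair_map _ _.
have EP : P = 'X + (P`_0)%:P.
  apply/polyP => k; rewrite coefD coefX coefC; case: k => [|[|k]] /=; rewrite ?add0r ?addr0 //.
    by have := monicP Pm; rewrite lead_coefE Ps.
  by rewrite nth_default ?Ps.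
rewrite Eg rmorphM EP rmorphD /= -['X]expr1 iota_polyXn iota_polyC mulm1n rmorphD /=.
rewrite -gvar_mono pull_var pair_Y pull_comp [pull _ P`_0](_ : _ = P`_0) ?addNr ?mulr0 //.
rewrite -[RHS]pull_id; apply: pull_ext => i; rewrite hcompE pull_var lift_X pair_X.
by rewrite (ord1 i).
Qed.

Lemma pull_zero m n (phi : holo_map R m n) f : (forall i, phi i = 0) ->
  pull phi f = gconst m (f 0%MM).
Proof.
move=> H.
have V : pull phi (f - gconst n (f 0%MM)) = 0.
  apply: germP => a; rewrite gcoef0 (gcomp_bound _ _ (ltnSn _)) big1 // => k _.
  have [->|k0] := eqVneq (k : 'X_{1..n}) 0%MM.
    by rewrite gcoefB gconstE eqxx mulr1 subrr mul0r.
  have [i ki] : exists i, k i != 0%N.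
    apply: contrapT => /forallNP K; case/eqP: k0; apply/mnmP => i.
    by rewrite mnm0E; apply/eqP/negPn/negP.
  have -> : \prod_j phi j ^+ k j = 0 by rewrite (bigD1 i) //= H expr0n (negbTE ki) mul0r.
  by rewrite gcoef0 mulr0.
by move/eqP: V; rewrite rmorphB subr_eq0 => /eqP ->; rewrite /= pull_const.
Qed.

Lemma iter_partial_coef n (i : 'I_n) j (f : germ R n) : forall m, exists2 c,
  (0 < c)%N & iter j (gpartial i) f m = f (m + U_(i) *+ j)%MM *+ c.
Proof.
elim: j => [|j IH] m; first by exists 1%N; rewrite // mulm0n addm0.
have [c c0 E] := IH (m + U_(i))%MM.
exists (c * (m i).+1)%N; first by rewrite muln_gt0 c0.
by rewrite -[LHS]/(iter j (gpartial i) f (m + U_(i))%MM *+ (m i).+1) E mulrnA mulmS addmA.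
Qed.

(* y |-> y + s(x) *)
Section Shift.
Variables (s : germ R 1) (s0 : s 0%MM = 0).

Lemma shift0 : (gvar R Y + pull (proj_map R 1) s) 0%MM = 0.
Proof. by rewrite gcoefD id_map0 pull0c s0 addr0. Qed.
Definition shift := pair_map (id_map0 R X) shift0.

Lemma partial_shift f : gpartial Y (pull shift f) = pull shift (gpartial Y f).
Proof.
rewrite chain_rule (bigD1 Y) //= (big_pred1 X) => [|i]; last by move: i; apply: ord2_ind.
rewrite !gpartial_var mulr0 addr0 raddfD /= gpartial_var eqxx.
rewrite (_ : gpartial Y (pull _ s) = 0) ?addr0 ?mulr1 //.
apply: germP => m; rewrite gcoef0.
have Z : pull (proj_map R 1) s (m + U_(Y))%MM = 0.
  by rewrite pull_proj mnmDE mnm1E eqxx addn1.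
by rewrite -[LHS]/(pull (proj_map R 1) s (m + U_(Y))%MM *+ (m Y).+1) Z mul0rn.
Qed.

Lemma iter_partial_shift j f :
  iter j (gpartial Y) (pull shift f) = pull shift (iter j (gpartial Y) f).
Proof. by elim: j => //= j ->; rewrite partial_shift. Qed.

Lemma shift_yregular d f : yregular d f -> yregular d (pull shift f).
Proof.
have E k : pull shift f (U_(Y) *+ k)%MM = f (U_(Y) *+ k)%MM.
  rewrite -[LHS]pull_axis -[RHS]pull_axis pull_comp; congr (gcoef _ _); apply: pull_ext; apply: ord2_ind.
    by rewrite hcompE pair_X pull_var.
  rewrite hcompE pair_Y rmorphD /= pull_var pull_comp pull_zero => [|i].
    by rewrite s0 rmorph0 addr0.
  by rewrite hcompE pull_var lift_X.
by case=> f0 fd; split=> [k kd|]; rewrite E //; exact: f0.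
Qed.

Lemma shift_graph f : pull (axis R X) (pull shift f) =
  pull (pair_map (id_map0 R (ord0 : 'I_1)) s0) f.
Proof.
rewrite pull_comp; apply: pull_ext; apply: ord2_ind; rewrite hcompE.
  by rewrite pair_X pull_var axisE eqxx.
rewrite pair_Y rmorphD /= pull_var axisE add0r pull_comp -[RHS]pull_id.
by apply: pull_ext => i; rewrite hcompE pull_var lift_X axisE eqxx (ord1 i).
Qed.

End Shift.

Definition ypoly (P : {poly C}) : germ R 2 := iota_poly (map_poly (@gconst R 1) P).

Lemma ypolyB : zmod_morphism ypoly.
Proof. by move=> P Q; rewrite /ypoly !rmorphB. Qed.
HB.instance Definition _ := GRing.isZmodMorphism.Build _ _ ypoly ypolyB.
Lemma ypolyM : monoid_morphism ypoly.
Proof. by split=> [|P Q]; rewrite /ypoly ?rmorph1 ?rmorphM. Qed.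
HB.instance Definition _ := GRing.isMonoidMorphism.Build _ _ ypoly ypolyM.

Lemma ypolyE P m : ypoly P m = if m X == 0%N then P`_(m Y) else 0.
Proof.
rewrite gcoef_iota coef_map [gcoef _ _]gconstE (_ : (mres m == 0%MM) = (m X == 0%N)).
  by case: eqP; rewrite ?mulr1 ?mulr0.
apply/eqP/eqP => [E|E]; last by apply/mnmP => i; rewrite mnmE lift_X E mnm0E.
by have := congr1 (fun k : 'X_{1..1} => k ord0) E; rewrite mnmE mnm0E lift_X.
Qed.

Section NewtonSubstitution.
Variables (p q : nat) (c : C).
Hypotheses (p0 : (0 < p)%N) (q0 : (0 < q)%N).

Lemma newton_X0 : (gvar R X ^+ q) 0%MM = 0.
Proof. by rewrite gcoefX0 id_map0 expr0n gtn_eqF. Qed.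
Lemma newton_Y0 : (gvar R X ^+ p * ypoly ('X + c%:P)) 0%MM = 0.
Proof. by rewrite gcoefM0 gcoefX0 id_map0 expr0n gtn_eqF // mul0r. Qed.

(* (x, y) |-> (x^q, x^p (c + y)) *)
Definition newton_map := pair_map newton_X0 newton_Y0.

Lemma newton_prod (k : 'X_{1..2}) m : (\prod_i newton_map i ^+ k i) m =
  if m X == (q * k X + p * k Y)%N then (('X + c%:P) ^+ k Y)`_(m Y) else 0.
Proof.
pose e := (q * k X + p * k Y)%N.
have -> : \prod_i newton_map i ^+ k i =
    gmono R (U_(X) *+ e)%MM * ypoly (('X + c%:P) ^+ k Y).
  rewrite (bigD1 X) //= (big_pred1 Y) => [|i]; last by move: i; apply: ord2_ind.
  by rewrite /= exprMn -!exprM mulrA -exprD gmonoMn [ypoly (_ ^+ _)]rmorphXn.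
rewrite gcoef_monoM ypolyE -/e.
have E : (U_(X) *+ e <= m)%MM = (e <= m X)%N.
  apply/mnm_lepP/idP => [/(_ X)|em]; first by rewrite mulmnE mnm1E eqxx mul1n.
  by apply: ord2_ind; rewrite mulmnE mnm1E ?eqxx ?mul1n.
rewrite E mnmBE mulmnE mnm1E eqxx mul1n mnmBE mulmnE mnm1E subn0 subn_eq0.
by case: ltngtP.
Qed.

Lemma newton_coef f m B : (mdeg m < B)%N -> pull newton_map f m =
  \sum_(k : 'X_{1..2 < B} | m X == (q * k X + p * k Y)%N)
    f k * (('X + c%:P) ^+ k Y)`_(m Y).
Proof.
move=> mB; rewrite (gcomp_bound _ _ mB) [RHS]big_mkcond; apply: eq_bigr => k _.
by rewrite newton_prod; case: ifP; rewrite ?mulr0.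
Qed.

End NewtonSubstitution.

Lemma coef_XsubC_exp (c : C) n : (('X - c%:P) ^+ n.+1)`_n = - c *+ n.+1.
Proof.
elim: n => [|n IH]; first by rewrite expr1 coefB coefX coefC sub0r.
rewrite exprSr mulrBr coefB coefMX coefMC /= IH.
have := lead_coef_exp ('X - c%:P) n.+1; rewrite lead_coefE size_exp_XsubC /= lead_coefXsubC expr1n => ->.
by rewrite mul1r [RHS]mulrSr.
Qed.

(* After the shift by s the coefficient of y^(d-1) vanishes, so the polynomial E of
   the first edge of the Newton polygon is not a d-th power; it has a root c of
   multiplicity less than d, at which the induction hypothesis applies. *)
Theorem puiseux_root d (h : germ R 2) : (0 < d)%N -> yregular d h ->
  exists N (psi : holo_map R 1 2),
    [/\ (0 < N)%N, psi X = gvar R ord0 ^+ N & pull psi h = 0].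
Proof.
elim/ltn_ind: d h => d IH h d0 hreg; have [h0 hd] := hreg.
(* The Tschirnhaus shift: g has order 1 on the y-axis, hence a root y = s(x), and moving this root
   to y = 0 kills every coefficient of x^a y^(d-1). *)
pose g := iter d.-1 (gpartial Y) h.
have greg : yregular 1 g.
  split=> [k|].
    rewrite ltnS leqn0 => /eqP ->; rewrite mulm0n /g.
    have [e e0 ->] := iter_partial_coef Y d.-1 h 0%MM.
    by rewrite add0m h0 ?mul0rn // prednK.
  rewrite /g; have [e e0 ->] := iter_partial_coef Y d.-1 h (U_(Y) *+ 1)%MM.
  by rewrite mulm1n -mulmS prednK // -mulr_natr mulf_neq0 // pnatr_eq0 -lt0n.
have [s [s0 Hs]] := implicit_function greg.
pose hs := pull (shift s0) h.
have hsreg : yregular d hs by apply: shift_yregular.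
have hsd1 a : hs (mn2 a d.-1) = 0.
  have := shift_graph s0 g; rewrite Hs -iter_partial_shift -/hs => E.
  have : pull (axis R X) (iter d.-1 (gpartial Y) hs) (U_(ord0) *+ a)%MM = 0.
    by rewrite E gcoef0.
  rewrite pull_axis; have [e e0 ->] := iter_partial_coef Y d.-1 hs (U_(X) *+ a)%MM.
  by rewrite -mulr_natr => /eqP; rewrite mulf_eq0 pnatr_eq0 gtn_eqF ?orbF // => /eqP.
have [Hx|Hx] := pselect (forall a, hs (mn2 a 0) = 0).
  exists 1%N, (pair_map (id_map0 R (ord0 : 'I_1)) s0); split=> //.
  rewrite -shift_graph -/hs; apply: germP => m.
  by rewrite (mnm1_one m) pull_axis -mn2_0r Hx gcoef0.
(* The slope a / (d - i) of the segment from (0, d) to (a, i), scaled by d! to be a natural number,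
   so that a least one exists. *)
pose val a i := (a * (d`! %/ (d - i)))%N.
have exv : exists v, `[< exists a i, [/\ (i < d)%N, hs (mn2 a i) != 0 & v = val a i] >].
  move/existsNP: Hx => [a /eqP ha]; exists (val a 0%N); apply/asboolP.
  by exists a, 0%N.
case: (ex_minnP exv) => v /asboolP[p [i0 [i0d hp Ev]]] vmin.
pose q := (d - i0)%N.
have q0 : (0 < q)%N by rewrite subn_gt0.
have p0 : (0 < p)%N.
  rewrite lt0n; apply: contraNneq hp => ->.
  by case: hsreg => H _; rewrite mn2_0l H.
(* The Newton polygon lies on or above the line q a + p b = p d through (0, d) and (p, i0). *)
have slope k : hs k != 0 -> (p * d <= q * k X + p * k Y)%N.
  move=> hk; have [kd|kd] := leqP d (k Y).
    by apply: leq_trans (leq_addl _ _); rewrite leq_mul2l kd orbT.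
  have := vmin (val (k X) (k Y)); rewrite Ev /val => /(_ _)/wrap[].
    by apply/asboolP; exists (k X), (k Y); rewrite mn2_eta.
  have fd i : (i < d)%N -> (d`! %/ (d - i) * (d - i))%N = d`!.
    by move=> id_; rewrite divnK // dvdn_fact // subn_gt0 id_ leq_subr.
  have := fd _ i0d; have := fd _ kd; have := fact_gt0 d.
  rewrite -/q; set A := (_ %/ q)%N; set B := (_ %/ _)%N; set D := (_`!)%N.
  have : (d = k Y + (d - k Y))%N by rewrite subnKC // ltnW.
  set w := (d - k Y)%N => Ed D0 EB EA le.
  rewrite [X in (p * X)%N]Ed mulnDr addnC leq_add2r -(leq_pmul2r D0).
  rewrite -{1}EA -EB.
  have := leq_mul le (leqnn (w * q)%N); lia.
(* Exceeds the degree of every exponent on that line and of every x^(p d) y^j with j <= d. *)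
pose B := (p * d + d).+1.
pose E : {poly C} := \sum_(k : 'X_{1..2 < B} | (p * d == q * k X + p * k Y)%N) hs k *: 'X^(k Y).
have coefE b : E`_b = \sum_(k : 'X_{1..2 < B} | (p * d == q * k X + p * k Y)%N && (k Y == b)) hs k.
  rewrite coef_sum [RHS]big_mkcondr; apply: eq_bigr => k _.
  by rewrite coefZ coefXn eq_sym; case: eqP; rewrite ?mulr1 ?mulr0.
have coefE1 a b : (p * d = q * a + p * b)%N -> E`_b = hs (mn2 a b).
  move=> ab; have kB : (mdeg (mn2 a b) < B)%N.
    rewrite mdeg_mn2 ltnS; have : (b <= d)%N.
      by rewrite -(leq_pmul2l p0) ab leq_addl.
    by move=> bd; apply: leq_add => //; rewrite ab (leq_trans _ (leq_addr _ _)) // leq_pmull.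
  rewrite coefE (bigD1 (BMultinom kB)) /= ?mn2_X ?mn2_Y ?ab ?eqxx //.
  rewrite big1 ?addr0 // => k /andP[/andP[/eqP E1 /eqP E2] /eqP ne].
  case: ne; apply: val_inj => /=; rewrite -[LHS]mn2_eta E2; congr mn2.
  by move: E1; rewrite E2 => /addIn/eqP; rewrite eqn_pmul2l // => /eqP.
have Ed : E`_d != 0.
  by rewrite (coefE1 0%N) ?muln0 // mn2_0l; case: hsreg.
have Ei0 : E`_i0 != 0.
  by rewrite (coefE1 p) // (mulnC q) -mulnDr subnK // ltnW.
have Ed1 : E`_d.-1 = 0.
  by rewrite coefE big1 // => k /andP[_ /eqP Ek]; rewrite -[bmnm k]mn2_eta Ek hsd1.
have sE : size E = d.+1.
  apply/eqP; rewrite eqn_leq; apply/andP; split; last first.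
    by rewrite ltnNge; apply: contra Ed => /leq_sizeP ->.
  apply/leq_sizeP => b db; rewrite coefE big1 // => k /andP[/eqP E1 /eqP Ek].
  have := leq_addl (q * k X)%N (p * k Y)%N; rewrite -E1 leq_pmul2l // Ek.
  by rewrite leqNgt db.
have E0 : E != 0 by rewrite -size_poly_eq0 sE.
have [c Ec] : exists c, root E c by apply/closed_rootP; rewrite sE eqSS -lt0n.
have [mu [Q Qc EQ]] := multiplicity_XsubC E c; rewrite E0 /= in Qc.
have Q0 : Q != 0 by apply: contraNneq Qc => ->; rewrite root0.
have sQ : (size Q + mu = d.+1)%N.
  by rewrite -sE EQ size_Mmonic ?monic_exp ?monicXsubC // size_exp_XsubC addnS.
have mu0 : (0 < mu)%N.
  by rewrite lt0n; apply: contraNneq Qc => m0; move: Ec; rewrite EQ m0 expr0 mulr1.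
have mud : (mu < d)%N.
  have sQ0 : (0 < size Q)%N by rewrite size_poly_gt0.
  have : (mu <= d)%N by rewrite -ltnS -sQ -[X in (X < _)%N]add0n ltn_add2r.
  (* If mu = d, then E is a constant times the d-th power of X - c; its coefficient of degree d - 1,
     a nonzero multiple of c, vanishes by [Ed1]. So c = 0 and E is a monomial of degree d, against
     [Ei0]. *)
  rewrite leq_eqVlt => /orP[/eqP mE|//]; exfalso.
  have /eqP/size_poly1P[e e0 Ee] : size Q = 1%N by move: sQ; rewrite mE; lia.
  have c0 : c = 0.
    have := Ed1; rewrite EQ Ee mE -[d in _ ^+ d](prednK d0) coefCM coef_XsubC_exp => /eqP.
    rewrite mulf_eq0 (negbTE e0) -mulr_natr mulf_eq0 oppr_eq0 pnatr_eq0 orbF => /eqP ->.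
    by [].
  case/negP: Ei0; rewrite EQ Ee c0 subr0 mE coefCM coefXn (ltn_eqF i0d) mulr0 //.
(* A term x^a y^b becomes x^(q a + p b) (c + y)^b, so x^(p d) factors out and the quotient restricts
   to E(c + y) on x = 0 up to degree d. Its order there is mu < d. *)
pose nm := newton_map c p0 q0.
pose K := pull nm hs.
have Klow m : ~~ (U_(X) *+ (p * d) <= m)%MM -> K m = 0.
  move=> mp; rewrite /K (newton_coef _ _ _ _ (ltnSn _)) big1 // => k /eqP mk.
  have [->|/slope hk] := eqVneq (hs k) 0; first by rewrite mul0r.
  case/negP: mp; apply/mnm_lepP; apply: ord2_ind; rewrite mulmnE mnm1E ?eqxx ?mul1n ?mk //.
pose K' := quo_mono (U_(X) *+ (p * d))%MM K.
have EK : K = gmono R (U_(X) *+ (p * d))%MM * K' by rewrite quo_monoK.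
have K'E j : (j <= d)%N -> K' (U_(Y) *+ j)%MM = (E \Po ('X + c%:P))`_j.
  move=> jd; rewrite quo_monoE addmC -/(mn2 _ _) /K (@newton_coef _ _ _ _ _ _ _ B); last first.
    by rewrite mdeg_mn2 ltnS leq_add2l.
  rewrite mn2_X mn2_Y /E raddf_sum coef_sum; apply: eq_bigr => k _.
  by rewrite /= comp_polyZ comp_Xn_poly coefZ.
have Ecomp : E \Po ('X + c%:P) = (Q \Po ('X + c%:P)) * 'X^mu.
  by rewrite EQ rmorphM rmorphXn /= comp_polyB comp_polyX comp_polyC addrK.
have Kreg : yregular mu K'.
  split=> [k kmu|]; rewrite K'E ?Ecomp ?coefMXn; first by rewrite kmu.
  - by rewrite (leq_trans (ltnW kmu)) // ltnW.
  - by rewrite ltnn subnn -horner_coef0 horner_comp !hornerE.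
  - exact: ltnW.
have [N [psi [N0 psiX Hpsi]]] := IH mu mud K' mu0 Kreg.
exists (N * q)%N, (hcomp (shift s0) (hcomp nm psi)); split.
- by rewrite muln_gt0 N0.
- by rewrite hcompE pair_X pull_var hcompE pair_X rmorphXn /= pull_var psiX exprM.
- by rewrite -pull_comp -pull_comp -/hs -/K EK rmorphM /= Hpsi mulr0.
Qed.

End Puiseux.

(** * Arcs separating hypersurfaces *)

Section SeparatingArcs.
Variable R : realType.
Local Notation C := R[i].
Local Notation X := (ord0 : 'I_2).
Local Notation Y := (ord_max : 'I_2).

Definition xmap : holo_map R 2 1 := single_map (id_map0 R X).

Lemma power_map0 N : (gvar R (ord0 : 'I_1) ^+ N.+1) 0%MM = 0.
Proof. by rewrite gcoefX0 id_map0 expr0n. Qed.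
Definition power_map N : holo_map R 1 1 := single_map (power_map0 N).

Lemma pull_power_neq0 N (f : germ R 1) : f != 0 -> pull (power_map N) f != 0.
Proof.
move=> f0; have E i : power_map N i = gmono R (U_(ord0) *+ N.+1)%MM by rewrite gmonoMn.
have mE k : mmul (fun _ : 'I_1 => U_(ord0) *+ N.+1)%MM k = (U_(ord0) *+ (N.+1 * k ord0))%MM.
  by apply/mnmP => i; rewrite /mmul big_ord1 !mulmnE mulnA.
have inj : injective (mmul (fun _ : 'I_1 => U_(ord0) *+ N.+1)%MM : _ -> 'X_{1..1}).
  move=> k k'; rewrite !mE => /(congr1 (fun m : 'X_{1..1} => m ord0)).
  rewrite !mulmnE mnm1E eqxx !mul1n => /eqP; rewrite eqn_pmul2l // => /eqP kk.
  by apply/mnmP => i; rewrite (ord1 i).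
apply: contraNneq f0 => Z; apply/eqP/germP => k.
by rewrite -(pull_mono_in E f k inj) Z !gcoef0.
Qed.

Section OneArc.
Variables (n : nat) (eta : holo_map R 1 n.+1) (N : nat) (delta : germ R 1).
Hypothesis delta0 : delta 0%MM = 0.

(* (x, y) |-> (eta(x^N), delta(x) + y) *)
Lemma arc_surface0 (i : 'I_n.+2) : (if unlift ord_max i is Some j
  then pull xmap (pull (power_map N) (eta j)) else pull xmap delta + gvar R Y) 0%MM = 0.
Proof.
by case: unliftP => [j _|_]; rewrite ?gcoefD !pull0c ?hcoord0 ?id_map0 ?delta0 ?addr0.
Qed.
Definition arc_surface : holo_map R 2 n.+2 := HoloMap arc_surface0.

Lemma arc_surface_lift j : arc_surface (fintype.lift ord_max j) =
  pull xmap (pull (power_map N) (eta j)).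
Proof. by rewrite /= liftK. Qed.
Lemma arc_surface_max : arc_surface ord_max = pull xmap delta + gvar R Y.
Proof. by rewrite /= unlift_none. Qed.

Lemma hcomp_xmap_X f : pull (axis R X) (pull xmap f) = f.
Proof.
rewrite pull_comp -[RHS]pull_id; apply: pull_ext => i.
by rewrite hcompE pull_var axisE eqxx (ord1 i).
Qed.

Lemma hcomp_xmap_Y (f : germ R 1) : f 0%MM = 0 -> pull (axis R Y) (pull xmap f) = 0.
Proof.
move=> f0; rewrite pull_comp pull_zero ?f0 ?rmorph0 // => i.
by rewrite hcompE pull_var axisE.
Qed.

Lemma arc_surface_yaxis : hcomp arc_surface (axis R Y) = axis R ord_max.
Proof.
apply: holo_mapP => i; rewrite hcompE axisE.
have [j ->|->] := unliftP ord_max i.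
  by rewrite arc_surface_lift hcomp_xmap_Y ?pull0c ?hcoord0 // eq_sym (negbTE (neq_lift _ _)).
by rewrite arc_surface_max rmorphD /= hcomp_xmap_Y // add0r pull_var axisE !eqxx.
Qed.

End OneArc.

(** The arc l = gamma lies in no hypersurface and is sheared into the y-axis. In the base, eta
    avoids the zeros of a germ r that eliminates y between f and every other g. A Puiseux root of f
    over eta then lies in f = 0 but in no g = 0, since r would otherwise vanish along eta after a
    power substitution. *)
Lemma separating_arcs n (s : seq (germ R n.+2)) :
  (forall f, f \in s -> irreducible_germ f) ->
  (forall f g, f \in s -> g \in s -> gdvd f g -> f = g) ->
  exists l : holo_map R 1 n.+2, (forall f, f \in s -> pull l f != 0) /\
  forall f, f \in s -> exists Phi : holo_map R 2 n.+2,
    [/\ hcomp Phi (axis R Y) = l, pull (axis R X) (pull Phi f) = 0 &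
        forall g, g \in s -> g != f -> pull (axis R X) (pull Phi g) != 0].
Proof.
move=> irr dist.
have [gamma gamma0 gprod] : exists2 gamma : holo_map R 1 n.+2, gamma ord0 = gvar R ord0 &
    pull gamma (\prod_(f <- s) f) != 0.
  apply: arc_nonzero; rewrite prodf_seq_neq0; apply/allP => f fs /=.
  by apply: irreducible_neq0; apply: irr.
have gne f : f \in s -> pull gamma f != 0.
  move=> fs; apply: contraNneq gprod => Z; rewrite (big_rem f) //= rmorphM.
  by rewrite /= Z mul0r.
exists gamma; split=> // f fs; pose T := shear gamma.
have Tax h : pull (axis R ord_max) (pull T h) = pull gamma h.
  by rewrite pull_comp shear_yaxis.
have reg g : g \in s -> exists d, yregular d (pull T g).
  by move=> /gne; rewrite -Tax => /yregular_axis.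
have [d freg] := reg f fs.
have d0 : (0 < d)%N.
  have [fu _] := irr f fs; rewrite lt0n; apply: contraNneq fu => E.
  rewrite -(pull_unit T); apply/germ_unitP; case: freg => _.
  by rewrite E mulm0n.
(* A product of the germs given by [elimination], one for each g other than f. *)
have [r r0 Hr] : exists2 r : germ R n.+1, r != 0 & forall g, g \in s -> g != f ->
    exists a b, pull (proj_map R n.+1) r = a * pull T f + b * pull T g.
  have : forall t : seq (germ R n.+2), {subset t <= s} -> exists2 r : germ R n.+1, r != 0 &
    forall g, g \in t -> g != f ->
    exists a b, pull (proj_map R n.+1) r = a * pull T f + b * pull T g.
    elim=> [|g t IHt] ts; first by exists 1; rewrite ?oner_neq0.
    have ts' : {subset t <= s} by move=> x xt; apply: ts; rewrite inE xt orbT.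
    have [r r0 Hr] := IHt ts'.
    have gs : g \in s by apply: ts; rewrite mem_head.
    have [gf|gf] := eqVneq g f.
      by exists r => // h; rewrite inE => /orP[/eqP ->|]; [rewrite gf eqxx|exact: Hr].
    have [e greg] := reg g gs.
    have [|r' r'0 [a [b Er']]] := elimination (@irreducible_prime R n.+1) freg greg
      (irreducible_shear gamma (irr f fs)).
      by move=> /gdvd_shear /(dist _ _ fs gs) E; rewrite E eqxx in gf.
    exists (r * r'); first by rewrite mulf_neq0.
    move=> h; rewrite inE => /orP[/eqP -> _|ht hf].
      exists (pull (proj_map R n.+1) r * a), (pull (proj_map R n.+1) r * b).
      by rewrite rmorphM /= Er' mulrDr !mulrA.
    have [a' [b' Er]] := Hr h ht hf.
    exists (pull (proj_map R n.+1) r' * a'), (pull (proj_map R n.+1) r' * b').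
    by rewrite mulrC rmorphM /= Er mulrDr !mulrA.
  by move=> /(_ s (fun x xs => xs)).
have [eta _ etar] := arc_nonzero r0.
(* [power_map N] raises to the power N + 1: the argument 0 keeps eta unchanged, and [N.-1] below
   produces the exponent N of the Puiseux root. *)
pose Psi : holo_map R 2 n.+2 := arc_surface eta 0 (@gcoef0 R 1 0%MM).
have Psireg : yregular d (pull Psi (pull T f)).
  case: freg => H1 H2; split=> [k kd|]; rewrite -pull_axis pull_comp arc_surface_yaxis pull_axis //.
  exact: H1.
have [N [psi [N0 psiX Hpsi]]] := puiseux_root d0 Psireg.
have N1 : N = N.-1.+1 by rewrite prednK.
pose Phi := arc_surface eta N.-1 (hcoord0 psi Y).
have EPhi : hcomp Phi (axis R X) = hcomp Psi psi.
  apply: holo_mapP => i; rewrite !hcompE.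
  have [j ->|->] := unliftP ord_max i.
    rewrite !arc_surface_lift hcomp_xmap_X !pull_comp; apply: pull_ext => k.
    rewrite hcompE -[power_map 0 k]/(gvar R ord0 ^+ 1) expr1 pull_var hcompE pull_var psiX.
    by rewrite -[LHS]/(gvar R ord0 ^+ N.-1.+1) -N1.
  rewrite !arc_surface_max !rmorphD /= hcomp_xmap_X !pull_var axisE /= addr0.
  by rewrite !rmorph0 add0r.
have EPhiX h : pull (axis R X) (pull (hcomp T Phi) h) = pull psi (pull Psi (pull T h)).
  by rewrite -pull_comp pull_comp EPhi -pull_comp.
exists (hcomp T Phi); split.
- by rewrite hcompA arc_surface_yaxis shear_yaxis.
- by rewrite EPhiX.
move=> g gs gf; rewrite EPhiX; apply/eqP => Z.
have [a [b Er]] := Hr g gs gf.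
have /eqP : pull psi (pull Psi (pull (proj_map R n.+1) r)) = 0.
  by rewrite Er !rmorphD !rmorphM /= Hpsi Z !mulr0 addr0.
rewrite pull_comp pull_comp -EPhi.
rewrite (_ : pull _ r = pull (power_map N.-1) (pull eta r)).
  by rewrite (negbTE (pull_power_neq0 _ etar)).
rewrite pull_comp; apply: pull_ext => i; rewrite !hcompE pull_var.
by rewrite hcompE arc_surface_lift hcomp_xmap_X.
Qed.

End SeparatingArcs.

(** * Newton polygons and monomial maps *)

Section NewtonChain.
Variable R : realType.
Local Notation C := R[i].
Local Notation X := (ord0 : 'I_2).
Local Notation Y := (ord_max : 'I_2).
Implicit Types (f g : germ R 2) (m : 'X_{1..2}).

Definition is_wt (p q : nat) g (v : nat) :=
  (exists2 m, g m != 0 & v = (p * m X + q * m Y)%N) /\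
  forall m, g m != 0 -> (v <= p * m X + q * m Y)%N.

(** The support function of the Newton polygon of g; the default 0 is reached only for g = 0. *)
Definition wt p q g : nat := xget 0%N [set v | is_wt p q g v]%classic.

Lemma is_wt_eq p q g v : is_wt p q g v -> wt p q g = v.
Proof.
move=> Hv; rewrite /wt; case: xgetP => [w _ Hw|/(_ v)//].
case: Hv Hw => [[m gm Ev] Hv] [[k gk Ek] Hw].
by apply/eqP; rewrite eqn_leq {1}Ev {2}Ek Hv ?Hw.
Qed.

Lemma wtP p q g : g != 0 -> is_wt p q g (wt p q g).
Proof.
move=> g0; suff [v Hv] : exists v, is_wt p q g v by rewrite (is_wt_eq Hv).
have [m0 gm0 _] := min_monom g0.
have ex : exists v, `[< exists2 m, g m != 0 & v = (p * m X + q * m Y)%N >].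
  by exists (p * m0 X + q * m0 Y)%N; apply/asboolP; exists m0.
case: (ex_minnP ex) => v /asboolP Hv Hmin; exists v; split=> // m gm.
by apply: Hmin; apply/asboolP; exists m.
Qed.

Section ChainMap.
Variables (k M : nat).
Hypothesis M0 : (0 < M)%N.

Definition chain_mu (i : 'I_2) : 'X_{1..2} := if i == X then mn2 k k.+1 else mn2 M M.

Lemma chain_map0 i : gmono R (chain_mu i) 0%MM = 0.
Proof.
rewrite gmonoE; case: eqP => // /(congr1 (fun m : 'X_{1..2} => m Y)).
by rewrite mnm0E /chain_mu; case: ifP => _; rewrite mn2_Y // => E; move: M0; rewrite E.
Qed.

(* (x, y) |-> (x^k y^(k+1), (xy)^M) *)
Definition chain_map : holo_map R 2 2 := HoloMap chain_map0.

Lemma mmul_chain m :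
  mmul chain_mu m = mn2 (k * m X + M * m Y) (k.+1 * m X + M * m Y).
Proof.
by apply: mnm2P; rewrite mnm_sumE big_ord_recl big_ord1 !mulmnE /chain_mu /= !(mn2_X, mn2_Y);
  congr (_ + M * m _)%N; apply: val_inj.
Qed.

Lemma chain_mu_inj : injective (mmul chain_mu).
Proof.
move=> m m'; rewrite !mmul_chain => E.
have EX := congr1 (fun a : 'X_{1..2} => a X) E; have EY := congr1 (fun a : 'X_{1..2} => a Y) E.
rewrite /= !(mn2_X, mn2_Y) in EX EY.
have E1 : m X = m' X by move: EX EY; rewrite !mulSn; lia.
apply: mnm2P => //; move: EX; rewrite E1 => /addnI/eqP.
by rewrite eqn_pmul2l // => /eqP.
Qed.

Lemma chain_map_axis i : pull (axis R X) (chain_map i) = 0.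
Proof.
rewrite /chain_map /= /chain_mu; have E a b : pull (axis R X) (gmono R (mn2 a b.+1)) = 0.
  rewrite /mn2 gmonoD !gmonoMn -!gvar_mono rmorphM !rmorphXn /= !pull_var !axisE /=.
  by rewrite expr0n mulr0.
by case: ifP => _; rewrite ?E // -(prednK M0) E.
Qed.

(** The two weights of m are the exponents of its image. As m minimizes both, its image divides all
    the others, and the quotient has constant term g m. *)
Lemma pull_chain g m : g m != 0 ->
  (forall m', g m' != 0 -> (k * m X + M * m Y <= k * m' X + M * m' Y)%N) ->
  (forall m', g m' != 0 -> (k.+1 * m X + M * m Y <= k.+1 * m' X + M * m' Y)%N) ->
  exists2 u : germ R 2, u \is a GRing.unit & pull chain_map g =
    gvar R X ^+ wt k M g * gvar R Y ^+ wt k.+1 M g * u.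
Proof.
move=> gm H1 H2.
have -> : wt k M g = (k * m X + M * m Y)%N by apply: is_wt_eq; split=> //; exists m.
have -> : wt k.+1 M g = (k.+1 * m X + M * m Y)%N by apply: is_wt_eq; split=> //; exists m.
pose K := pull chain_map g; exists (quo_mono (mmul chain_mu m) K).
  apply/germ_unitP; rewrite quo_monoE add0m /K (pull_mono_in (mu := chain_mu)) //.
  exact: chain_mu_inj.
rewrite !gvar_mono -!gmonoMn -gmonoD -[(_ + _)%MM]/(mn2 _ _) -mmul_chain quo_monoK // => a na.
apply: (pull_mono_out (mu := chain_mu)) => // m' gm'; apply: contraNneq na => <-.
apply/mnm_lepP; rewrite !mmul_chain.
by apply: ord2_ind; rewrite !(mn2_X, mn2_Y); [exact: H1 | exact: H2].
Qed.

End ChainMap.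

(** Division by D leaves k + 1/2 <= c B < k + 1, impossible for the integer c B. *)
Lemma parity_gap (k M D B c : int) : M = D * c -> 0 < D ->
  (2 * k + 1) * D <= 2 * M * B -> M * B < (k + 1) * D -> False.
Proof.
move=> -> D0 H1 H2.
have {}H1 : 2 * k + 1 <= 2 * (c * B) by rewrite -(ler_pM2r D0); lia.
have {}H2 : c * B < k + 1 by rewrite -(ltr_pM2r D0); lia.
lia.
Qed.

(* As every D <= A divides M, no slope of the Newton polygon of g that matters lies
   strictly between k / M and (k + 1) / M: a vertex minimizing the weight of slope
   (2 k + 1) / (2 M) does so at both ends. *)
Lemma common_minimizer g m0 A M : g m0 != 0 ->
  (forall m, g m != 0 -> (m0 Y <= m Y)%N) -> (m0 X <= A)%N -> M = A`! ->
  forall k, exists m, [/\ g m != 0,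
   forall m', g m' != 0 -> (k * m X + M * m Y <= k * m' X + M * m' Y)%N &
   forall m', g m' != 0 -> (k.+1 * m X + M * m Y <= k.+1 * m' X + M * m' Y)%N].
Proof.
move=> gm0 low m0A EM k.
have g0 : g != 0 by apply: contraNneq gm0 => ->; rewrite gcoef0.
have dvdM D : (0 < D <= A)%N -> exists c : int, M%:Z = D%:Z * c.
  by move=> HD; have /dvdnP[c Ec] := dvdn_fact HD; exists c%:Z; rewrite EM Ec mulnC PoszM.
have bound p q m : (0 < p)%N -> g m != 0 ->
    (p * m X + q * m Y <= p * m0 X + q * m0 Y)%N -> (m X <= A)%N.
  move=> p0 gm H; apply: leq_trans m0A; rewrite -(leq_pmul2l p0).
  have := low m gm; rewrite -(leq_pmul2l (m := q.+1)) // => _.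
  have : (q * m0 Y <= q * m Y)%N by rewrite leq_mul2l low ?orbT.
  lia.
(* The weight (2 k + 1, 2 M) is the sum of (k, M) and (k + 1, M). *)
have [[m gm Em] Hm] := wtP k.*2.+1 M.*2 g0.
have mA : (m X <= A)%N by apply: (@bound k.*2.+1 M.*2) => //; rewrite -Em Hm.
exists m; split=> // m' gm'; rewrite leqNgt; apply/negP => lt.
  (* a strict improvement at k, with abscissa at most A *)
  have [m1 gm1 [m1A lt1]] : exists2 m1, g m1 != 0 &
      (m1 X <= A)%N /\ (k * m1 X + M * m1 Y < k * m X + M * m Y)%N.
    (* For k = 0 the weight ignores the abscissa and a minimizer could be arbitrarily far away; m0,
       of least ordinate, is taken instead. *)
    have [k0|k0] := posnP k.
      exists m0 => //; split=> //; apply: leq_ltn_trans lt; rewrite k0 !mul0n !add0n.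
      by rewrite leq_mul2l low ?orbT.
    have [[m1 gm1 E1] H1] := wtP k M g0; exists m1 => //; split.
      by apply: (@bound k M) => //; rewrite -E1 H1.
    by apply: leq_ltn_trans lt; rewrite -E1 H1.
  have := Hm m1 gm1; rewrite Em => mid.
  have D0 : (m X < m1 X)%N by rewrite ltnNge; apply/negP => le; move: mid lt1; nia.
  have [|c Ec] := dvdM (m1 X - m X)%N; first by rewrite subn_gt0 D0 leq_subLR (leq_trans m1A) ?leq_addl.
  (* The reflection of k to - k - 1 turns an improvement at k, to the right of m, into the situation
     of an improvement at k + 1, to its left. *)
  apply: (@parity_gap (- k%:Z - 1) M%:Z (m1 X - m X)%N%:Z ((m1 Y)%:Z - (m Y)%:Z) c) => //.
  - by rewrite ltz_nat subn_gt0.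
  - by rewrite -subzn 1?ltnW //; move: mid; lia.
  - by rewrite -subzn 1?ltnW //; move: lt1; lia.
have := Hm m' gm'; rewrite Em => mid.
have D0 : (m' X < m X)%N by rewrite ltnNge; apply/negP => le; move: mid lt; nia.
have [|c Ec] := dvdM (m X - m' X)%N; first by rewrite subn_gt0 D0 leq_subLR (leq_trans mA) ?leq_addl.
apply: (@parity_gap k%:Z M%:Z (m X - m' X)%N%:Z ((m' Y)%:Z - (m Y)%:Z) c) => //.
- by rewrite ltz_nat subn_gt0.
- by rewrite -subzn 1?ltnW //; move: mid; lia.
- by rewrite -subzn 1?ltnW //; move: lt; lia.
Qed.

(** One M serves all germs of s and all k. At k = 0 the weight only sees divisibility by y, and at k
    = K only the order on the y-axis. *)
Lemma newton_chain (s : seq (germ R 2)) :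
  (forall g, g \in s -> exists d, yregular d g) ->
  exists M K, [/\ (0 < M)%N,
    forall k g, g \in s -> exists2 u : germ R 2, u \is a GRing.unit &
      forall M0 : (0 < M)%N, pull (chain_map k M0) g =
      gvar R X ^+ wt k M g * gvar R Y ^+ wt k.+1 M g * u,
    forall g d, g \in s -> yregular d g -> wt K M g = (M * d)%N,
    forall g, g \in s -> pull (axis R X) g = 0 -> (0 < wt 0 M g)%N &
    forall g, g \in s -> pull (axis R X) g != 0 -> wt 0 M g = 0%N].
Proof.
move=> reg.
have g0 g : g \in s -> g != 0.
  by move/reg=> [d [_ gd]]; apply: contraNneq gd => ->; rewrite gcoef0.
have [A HA] : exists A, forall g, g \in s -> exists m0, [/\ g m0 != 0,
    forall m, g m != 0 -> (m0 Y <= m Y)%N & (m0 X <= A)%N].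
  elim: s g0 {reg} => [|g s IH] g0; first by exists 0%N.
  have [A HA] := IH (fun h hs => g0 h (mem_behead (s := g :: s) hs)).
  have [[m gm Em] Hm] := wtP 0 1 (g0 g (mem_head _ _)).
  exists (maxn A (m X)) => h; rewrite inE => /orP[/eqP ->|/HA[m0 [? ? mA]]].
    exists m; split=> // [k gk|]; last exact: leq_maxr.
    by have := Hm k gk; rewrite Em !mul0n !mul1n.
  by exists m0; split=> //; rewrite (leq_trans mA) ?leq_maxl.
have [Dm HD] : exists Dm, forall g d, g \in s -> yregular d g -> (d <= Dm)%N.
  elim: s {g0 HA} reg => [|g s IH] reg; first by exists 0%N.
  have [Dm HD] := IH (fun h hs => reg h (mem_behead (s := g :: s) hs)).
  have [e [e0 ge]] := reg g (mem_head _ _).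
  exists (maxn Dm e) => h d; rewrite inE => /orP[/eqP ->|hs] hd.
    rewrite leq_max; apply/orP; right; case: hd => d0 _; rewrite leqNgt.
    by apply: contra ge => /d0 ->.
  by rewrite leq_max (HD h).
(* With K = M Dm and Dm a bound for the orders d, an exponent of positive abscissa already weighs at
   least K >= M d, the weight of y^d. *)
exists A`!, (A`! * Dm)%N; split.
- exact: fact_gt0.
- move=> k g gs; have [m0 [gm0 low m0A]] := HA g gs.
  have [m [gm H1 H2]] := common_minimizer gm0 low m0A erefl k.
  have [u uu E] := pull_chain (fact_gt0 A) gm H1 H2.
  by exists u => // M0; rewrite -E; apply: pull_ext => i.
- move=> g d gs gd; have dD := HD g d gs gd; case: gd => d0 gd.
  apply: is_wt_eq; split=> [|m gm].
    by exists (U_(Y) *+ d)%MM; rewrite // -mn2_0l mn2_X mn2_Y muln0.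
  have [mX|mX] := posnP (m X).
    rewrite mX muln0 add0n leq_mul2l; apply/orP; right; rewrite leqNgt.
    apply: contra gm => /d0; rewrite -[m]mn2_eta mX mn2_Y mn2_0l => ->; exact: eqxx.
  apply: leq_trans (leq_addr _ _); rewrite -mulnA leq_mul2l; apply/orP; right.
  by apply: leq_trans dD _; rewrite leq_pmulr.
- move=> g gs Z; have [[m gm Em] _] := wtP 0 A`! (g0 g gs).
  rewrite Em mul0n muln_gt0 fact_gt0 lt0n /=; apply: contraNneq gm => mY.
  by rewrite -[m]mn2_eta mY mn2_0r -pull_axis Z gcoef0.
- move=> g gs Z; have [m gm] := min_monom Z.
  rewrite (mnm1_one m) pull_axis -mn2_0r in gm; move=> _.
  by apply: is_wt_eq; split=> //; exists (mn2 (m ord0) 0); rewrite // mn2_Y mul0n muln0.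
Qed.

End NewtonChain.

(** * Divisors with normal crossings in the plane *)

Section HypersurfaceTheory.
Local Open Scope quotient_scope.
Variables (R : realType) (n : nat).
Implicit Types (f g p : germ R n) (H : hypersurface R n).

Lemma equation_irreducible H : irreducible_germ (equation H).
Proof. by apply/asboolP; exact: (valP (repr H)). Qed.

Lemma equation_prime H : prime_germ (equation H).
Proof. exact: irreducible_prime (equation_irreducible H). Qed.

Lemma hypersurface_eq H H' : gdvd (equation H) (equation H') -> H = H'.
Proof.
case=> q E; have [eu ei] := equation_irreducible H'.
have [eu' _] := equation_irreducible H.
have [qu|hu] := ei _ _ E; last by rewrite hu in eu'.
apply/esym; rewrite -[H]reprK -[H']reprK; apply/eqmodP/asboolP.
by exists q.
Qed.

Definition hyper p (pi : irreducible_germ p) : hypersurface R n :=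
  \pi_(hypersurface R n) (exist _ p (asboolT pi) : irr_germ R n).

Lemma equation_hyper p (pi : irreducible_germ p) :
  exists2 u, u \is a GRing.unit & equation (hyper pi) = u * p.
Proof.
have /eqmodP/asboolP[u uu E] : repr (hyper pi) = (exist _ p (asboolT pi) : irr_germ R n)
   %[mod hypersurface R n] by rewrite reprK.
by exists u.
Qed.

Lemma gvar_neq0 (i : 'I_n) : gvar R i != 0.
Proof.
apply/eqP => /(congr1 (fun f : germ R n => f U_(i)%MM)).
by rewrite gvar_mono gmonoE eqxx gcoef0 => /eqP; rewrite oner_eq0.
Qed.

Lemma gorder_gvar (i : 'I_n) : gorder (gvar R i) = 1%N.
Proof.
rewrite /gorder (@lead_monom_eq _ _ _ U_(i)%MM) ?mdeg1 // => [|k]; rewrite gvar_mono gmonoE.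
  by rewrite eqxx oner_eq0.
by case: eqP => // ->; rewrite ltxx.
Qed.

Lemma gvar_irreducible (i : 'I_n) : irreducible_germ (gvar R i).
Proof.
split=> [|g h E]; first by apply/germ_unitP/negP; rewrite id_map0 eqxx.
have g0 : g != 0 by apply: contraNneq (gvar_neq0 i) => g0; rewrite E g0 mul0r.
have h0 : h != 0 by apply: contraNneq (gvar_neq0 i) => h0; rewrite E h0 mulr0.
have := gorder_gvar i; rewrite E gorderM // -!gorder0_unit //.
by case: (gorder g) (gorder h) => [|[|a]] [|[|b]] //= _; [left|right].
Qed.

Lemma prime_dvdX p f a : prime_germ p -> gdvd p (f ^+ a) -> (0 < a)%N /\ gdvd p f.
Proof.
case=> p0 pu pp; elim: a => [[h E]|a IH].
  by case/negP: pu; apply: gunitP (esym E).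
by rewrite exprS => /pp[//|/IH[]].
Qed.

Lemma prime_dvd_unit p f : prime_germ p -> f \is a GRing.unit -> ~ gdvd p f.
Proof.
case=> p0 pu _ fu [h E]; case/negP: pu.
by move: fu; rewrite E unitrM => /andP[].
Qed.

Lemma big_dom (D : divisor R n) (t : seq (hypersurface R n)) (P : pred (hypersurface R n))
    (F : hypersurface R n -> R[i]) :
  uniq t -> {subset dom D <= t} ->
  \sum_(z <- dom D | P z) coeff z D * F z = \sum_(z <- t | P z) coeff z D * F z.
Proof.
move=> ut st; rewrite [RHS](bigID (fun z => z \in dom D)) /= [X in _ + X]big1 ?addr0.
  rewrite -big_filter -[RHS]big_filter; apply: perm_big.
  apply: uniq_perm; rewrite ?filter_uniq ?uniq_dom // => z; rewrite !mem_filter.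
  by case: (boolP (z \in dom D)) => [/st ->|]; rewrite ?andbT ?andbF.
by move=> z /andP[_ /coeff_outdom ->]; rewrite mul0r.
Qed.

End HypersurfaceTheory.

Section PlaneDivisors.
Variable R : realType.
Local Notation C := R[i].
Local Notation X := (ord0 : 'I_2).
Local Notation Y := (ord_max : 'I_2).

Definition HX : hypersurface R 2 := hyper (gvar_irreducible R X).
Definition HY : hypersurface R 2 := hyper (gvar_irreducible R Y).

Lemma gvar_XY : ~ gdvd (gvar R X) (gvar R Y).
Proof.
case=> h E; have : gvar R Y U_(Y)%MM = (h * gvar R X) U_(Y)%MM by rewrite -E.
rewrite mulrC !gvar_mono gmonoE eqxx gcoef_monoM ifF.
  by move/eqP; rewrite oner_eq0.
by apply/negP => /mnm_lepP/(_ X); rewrite !mnm1E.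
Qed.

Lemma HXY : HX != HY.
Proof.
apply/eqP => E; have [u uu EX] := equation_hyper (gvar_irreducible R X).
have [v vu EY] := equation_hyper (gvar_irreducible R Y).
apply: gvar_XY; exists (v^-1 * u).
by rewrite -mulrA -EX -/HX E EY mulKr.
Qed.

Lemma dvd_HX H : gdvd (equation H) (gvar R X) -> H = HX.
Proof.
have [u uu EX] := equation_hyper (gvar_irreducible R X).
by case=> h E; apply: hypersurface_eq; exists (u * h); rewrite EX E mulrA.
Qed.

Lemma dvd_HY H : gdvd (equation H) (gvar R Y) -> H = HY.
Proof.
have [u uu EX] := equation_hyper (gvar_irreducible R Y).
by case=> h E; apply: hypersurface_eq; exists (u * h); rewrite EX E mulrA.
Qed.

(** [zero_divisor] picks an arbitrary factorization; primality of each factor forces it to be x or y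
    up to a unit, so every choice gives the same divisor. *)
Lemma mono_factorization (s : seq (hypersurface R 2)) a b (u u' : germ R 2) :
  u \is a GRing.unit -> u' \is a GRing.unit ->
  gvar R X ^+ a * gvar R Y ^+ b * u = u' * \prod_(H <- s) equation H ->
  \sum_(H <- s) << H >> = << HX >> *+ a + << HY >> *+ b :> divisor R 2.
Proof.
elim: s a b u'  => [|H s IH] a b u' uu u'u E.
  have : gvar R X ^+ a * gvar R Y ^+ b * u \is a GRing.unit by rewrite E big_nil mulr1.
  have xu i : (gvar R (i : 'I_2) \is a GRing.unit) = false.
    by apply/germ_unitP; rewrite id_map0 eqxx.
  rewrite !unitrM => /andP[/andP[]].
  case: a {E} => [|a]; last by rewrite exprS unitrM xu.
  by case: b => [|b] _; [rewrite big_nil !mulr0n addr0|rewrite exprS unitrM xu].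
have pH := equation_prime H; have [_ _ pp] := pH.
have : gdvd (equation H) (gvar R X ^+ a * gvar R Y ^+ b * u).
  by rewrite E big_cons; exists (u' * \prod_(K <- s) equation K); rewrite -mulrA [equation H * _]mulrC.
case/pp=> [/pp[]|/(prime_dvd_unit pH)]; last by [].
- case/(prime_dvdX pH)=> a0 /dvd_HX EH.
  have [v vu Ev] := equation_hyper (gvar_irreducible R X).
  have := IH a.-1 b (u' * v) uu; rewrite unitrM u'u vu => /(_ isT).
  rewrite big_cons EH => ->; first by rewrite addrA -mulrS prednK.
  apply: (mulfI (gvar_neq0 R X)); rewrite !mulrA -exprS prednK // E big_cons EH Ev.
  by ring.
- case/(prime_dvdX pH)=> b0 /dvd_HY EH.
  have [v vu Ev] := equation_hyper (gvar_irreducible R Y).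
  have := IH a b.-1 (u' * v) uu; rewrite unitrM u'u vu => /(_ isT).
  rewrite big_cons EH => ->; first by rewrite addrCA -mulrS prednK.
  apply: (mulfI (gvar_neq0 R Y)); rewrite !mulrA.
  rewrite (_ : gvar R Y * _ * _ * u = gvar R X ^+ a * gvar R Y ^+ b * u).
    by rewrite E big_cons EH Ev; ring.
  by rewrite -{2}(prednK b0) exprS; ring.
Qed.

Lemma zero_divisor_mono a b (u : germ R 2) : u \is a GRing.unit ->
  zero_divisor (gvar R X ^+ a * gvar R Y ^+ b * u) = << HX >> *+ a + << HY >> *+ b.
Proof.
move=> uu; rewrite /zero_divisor; case: xgetP => [E _ [u' [s [u'u Ef ->]]]|].
  exact: mono_factorization uu u'u Ef.
have [v vu Ev] := equation_hyper (gvar_irreducible R X).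
have [w wu Ew] := equation_hyper (gvar_irreducible R Y).
move=> /(_ (\sum_(H <- nseq a HX ++ nseq b HY) << H >>)) [].
exists (u * (v ^+ a)^-1 * (w ^+ b)^-1), (nseq a HX ++ nseq b HY); split=> //.
  by rewrite !unitrM uu !unitrV !unitrX.
have prodN H k : \prod_(K <- nseq k H) equation K = equation H ^+ k :> germ R 2.
  by elim: k => [|k IH]; rewrite ?big_nil ?expr0 //= big_cons IH exprS.
rewrite big_cat !prodN /= -/HX -/HY Ev Ew !exprMn.
set A := v ^+ a; set B := w ^+ b.
transitivity ((A^-1 * A) * (B^-1 * B) * (gvar R X ^+ a * gvar R Y ^+ b * u)).
  by rewrite !mulVr ?unitrX // !mul1r.
by ring.
Qed.

(** Non-vanishing is enough, as the number cancels when two models are compared. The default 0 is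
    ruled out by exhibiting d = 1, and a genuine d = 0 because 1 is not in the ideal (f, g). *)
Lemma intersection_neq0 (f g u v : germ R 2) : u \is a GRing.unit -> v \is a GRing.unit ->
  f = u * gvar R X -> g = v * gvar R Y -> intersection_multiplicity f g != 0%N.
Proof.
move=> uu vu Ef Eg; have f0 : f 0%MM = 0 by rewrite Ef gcoefM0 id_map0 mulr0.
have g0 : g 0%MM = 0 by rewrite Eg gcoefM0 id_map0 mulr0.
rewrite /intersection_multiplicity; case: xgetP => [d _ [e He]|].
  apply/eqP => d0; subst d; have [c [[a [b]]]] := He 1; rewrite big_ord0 add0r => E _.
  have : (1 : germ R 2) 0%MM = 0 by rewrite E gcoefD !gcoefM0 f0 g0 !mulr0 addr0.
  by rewrite gcoef1 eqxx => /eqP; rewrite oner_eq0.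
move=> /(_ 1%N) []; exists (fun=> 1) => h.
exists (const_mx (h 0%MM)); split.
  pose A := quo_mono U_(X)%MM h.
  pose k := h - gconst 2 (h 0%MM) - gvar R X * A.
  have Ek : k = gvar R Y * quo_mono U_(Y)%MM k.
    rewrite gvar_mono quo_monoK // => m; rewrite lep1mP negbK => /eqP mY.
    rewrite /k !gcoefB gvar_mono gcoef_monoM lep1mP gconstE.
    have [mX|mX] := eqVneq (m X) 0%N.
      rewrite subr0 (_ : m = 0%MM) ?eqxx ?mulr1 ?subrr //.
      by apply: mnm2P; rewrite mnm0E // (eqP mY).
    rewrite /A quo_monoE submK ?lep1mP // (_ : (m == 0%MM) = false) ?mulr0 ?subr0 ?subrr //.
    by apply: contraNF mX => /eqP ->; rewrite mnm0E.
  exists (A * u^-1), (quo_mono U_(Y)%MM k * v^-1).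
  rewrite big_ord1 mxE mulr1 Ef Eg -!mulrA !mulKr // ![_ * gvar _ _]mulrC -Ek /k.
  by ring.
move=> c [a [b E]]; apply/rowP => i; rewrite (ord1 i) mxE E.
rewrite gcoefD gcoefD !gcoefM0 f0 g0 !mulr0 !addr0 big_ord1 gcoefM0 gconstE eqxx mulr1.
by rewrite gcoef1 eqxx mulr1.
Qed.

Lemma divisor_index_XY :
  exists2 iota : C, iota != 0 & forall a b,
  divisor_index (a *: << HX >> + b *: << HY >> : divisor R 2) HX = - a^-1 * (b * iota).
Proof.
have [v vu Ev] := equation_hyper (gvar_irreducible R X).
have [w wu Ew] := equation_hyper (gvar_irreducible R Y).
exists (intersection_multiplicity (equation HX) (equation HY))%:R.
  by rewrite pnatr_eq0 (intersection_neq0 vu wu).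
move=> a b; rewrite /divisor_index; set D := (_ + _ : divisor R 2).
have cX : coeff HX D = a by rewrite coeffD !coeffZ !coeffU eqxx eq_sym (negbTE HXY) !mulr1 !mulr0 addr0.
have cY : coeff HY D = b by rewrite coeffD !coeffZ !coeffU eqxx (negbTE HXY) !mulr1 !mulr0 add0r.
have sD : {subset dom D <= [:: HX; HY]}.
  move=> z; rewrite mem_dom coeffD !coeffZ !coeffU !inE !mul1r; apply: contraR.
  rewrite negb_or (eq_sym z) (eq_sym z) => /andP[/negbTE -> /negbTE ->].
  by rewrite !mulr0 addr0.
rewrite (big_dom (t := [:: HX; HY])) //; last by rewrite /= inE HXY.
by rewrite !big_cons big_nil eqxx /= eq_sym HXY cX cY addr0.
Qed.

End PlaneDivisors.

(** * Flow of a vector field *)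

Section CauchyEstimates.
Variables (R : realType) (n : nat).
Local Notation C := R[i].

(** In r^(N+1) - t^(N+1) = (r - t) \sum_i r^(N-i) t^i each of the N + 1 terms is at least t^N. This
    yields the Cauchy estimate for derivatives. *)
Lemma power_gap (r t : C) N : 0 <= t -> t <= r ->
  t ^+ N *+ N.+1 * (r - t) <= r ^+ N.+1.
Proof.
move=> t0 tr; have r0 := le_trans t0 tr.
apply: (@le_trans _ _ (r ^+ N.+1 - t ^+ N.+1)); last first.
  by rewrite gerDl oppr_le0 exprn_ge0.
rewrite subrXX mulrC ler_wpM2l ?subr_ge0 // -[X in _ *+ X](card_ord N.+1) -sumr_const.
apply: ler_sum => i _ /=.
have {1}-> : N = (N - i + i)%N by rewrite subnK // -ltnS.
by rewrite exprD ler_wpM2r ?exprn_ge0 // lerXn2r // nnegrE.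
Qed.

Lemma summable_opp (r b : C) (f : germ R n) : summable_by r b f -> summable_by r b (- f).
Proof.
by move=> Hf s us; under eq_bigr => m _ do rewrite gcoefN normrN; apply: Hf.
Qed.

Lemma summable_partial (r t b : C) (i : 'I_n) (f : germ R n) : 0 <= t -> t < r ->
  summable_by r b f -> summable_by t (b / (r - t)) (gpartial i f).
Proof.
move=> t0 tr Hf s us; rewrite ler_pdivlMr ?subr_gt0 // mulr_suml.
have := Hf [seq (m + U_(i))%MM | m <- s].
rewrite map_inj_uniq => [/(_ us)|]; last exact: addIm.
rewrite big_map; apply: le_trans; apply: ler_sum => m _.
rewrite /= /partial normrMn mdegD mdeg1 addn1 -mulr_natr -!mulrA ler_wpM2l // mulrA.
apply: le_trans (power_gap _ t0 (ltW tr)).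
rewrite ler_wpM2r ?subr_ge0 ?(ltW tr) // mulrC mulr_natr ler_wpMn2l ?exprn_ge0 //.
by rewrite ltnS mdegE (bigD1 i) //= leq_addr.
Qed.

End CauchyEstimates.

(** A crude Stirling bound: k^k <= (2 k) (2 k - 1) ... (k + 1) = binomial(2 k, k) k!, and the
    binomial is at most 4^k. *)
Lemma expnn_fact k : (k ^ k <= 4 ^ k * k`!)%N.
Proof.
have H : (k ^ k <= (k + k) ^_ k)%N.
  have : forall j, (j <= k)%N -> (k ^ j <= (k + k) ^_ j)%N.
    elim=> [|j IH] jk; first by rewrite expn0 ffactn0.
    by rewrite expnSr ffactnSr; apply: leq_mul; [apply: IH; exact: ltnW | lia].
  by apply.
apply: (leq_trans H); rewrite -bin_ffact leq_mul2r; apply/orP; right.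
rewrite (_ : 4 = 2 * 2)%N // expnMn -expnD -[X in (2 ^ X)%N]/(k + k)%N.
by rewrite -[(2 ^ _)%N]/((1 + 1) ^ (k + k))%N expnDn (bigD1 (inord k)) //= inordK ?ltnS ?leq_addr //
   !exp1n !muln1 leq_addr.
Qed.

Section Flow.
Variable R : realType.
Local Notation C := R[i].
Local Notation X := (ord0 : 'I_2).
Local Notation Y := (ord_max : 'I_2).
Variables (a b : germ R 2).
Implicit Types (f g : germ R 2).

(* the derivation along the field dual to the form a dx + b dy *)
Definition lie f := - b * gpartial X f + a * gpartial Y f.

Lemma lieB : zmod_morphism lie.
Proof. by move=> f g; rewrite /lie !raddfB /=; ring. Qed.
HB.instance Definition _ := GRing.isZmodMorphism.Build _ _ lie lieB.

Lemma lieM f g : lie (f * g) = lie f * g + f * lie g.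
Proof. by rewrite /lie !gpartialM; ring. Qed.

Lemma lie_const c : lie (gconst 2 c) = 0.
Proof. by rewrite /lie !gpartial_const !mulr0 addr0. Qed.

Lemma lie_x : lie (gvar R X) = - b.
Proof. by rewrite /lie !gpartial_var eqxx mulr1 mulr0 addr0. Qed.

Lemma lie_y : lie (gvar R Y) = a.
Proof. by rewrite /lie !gpartial_var eqxx mulr1 mulr0 add0r. Qed.

Lemma vanish_lie d f : vanish d.+1 f -> vanish d (lie f).
Proof.
move=> Hf; apply: vanishD.
  by have := vanishM (@vanish0 _ _ (- b)) (@vanish_gpartial _ _ X _ _ Hf); rewrite add0n.
by have := vanishM (@vanish0 _ _ a) (@vanish_gpartial _ _ Y _ _ Hf); rewrite add0n.
Qed.

Lemma vanish_iter_lie k d f : vanish d f -> vanish (d - k) (iter k lie f).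
Proof.
elim: k => [|k IH] Hf; first by rewrite subn0.
case: (ltnP k d) => kd; last by rewrite (eqP (leqW kd : (d - k.+1 == 0)%N)).
by rewrite iterS; apply: vanish_lie; rewrite subnSK //; apply: IH.
Qed.

Lemma summable_lie (r t c M f0 : C) f : 0 <= t -> t < r ->
  summable_by r c a -> summable_by r M b -> summable_by r f0 f ->
  summable_by t ((c + M) * (f0 / (r - t))) (lie f).
Proof.
move=> t0 tr Ha Hb Hf; have r0 := le_trans t0 (ltW tr).
have tt : 0 <= t <= r by rewrite t0 ltW.
have Ha' := summable_by_le tt Ha; have Hb' := summable_by_le tt (summable_opp Hb).
rewrite addrC mulrDl; apply: add_summable_by => //.
  by apply: (mul_summable_by t0 Hb'); apply: summable_partial.
by apply: (mul_summable_by t0 Ha'); apply: summable_partial.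
Qed.

(* k successive Cauchy estimates, each shrinking the radius by r / (2 k) *)
Lemma summable_iter_lie (r c M f0 : C) f k : 0 < r ->
  summable_by r c a -> summable_by r M b -> summable_by r f0 f ->
  summable_by (r / 2) (f0 * ((c + M) * (2 / r)) ^+ k * (k ^ k)%:R) (iter k (lie) f).
Proof.
move=> r0 Ha Hb Hf; have [k0|k0] := posnP k.
  rewrite k0 expr0 !mulr1; apply: summable_by_le Hf.
  rewrite divr_ge0 ?(ltW r0) //= ler_pdivrMr // mulr_natr mulr2n lerDr ltW //.
pose e := r / (2 * k)%:R.
have k1 : 0 < (2 * k)%:R :> C by rewrite ltr0n muln_gt0.
have e0 : 0 < e by rewrite divr_gt0.
have ek : e * k%:R = r / 2.
  by rewrite /e natrM invfM -!mulrA mulVf ?mulr1 // pnatr_eq0 -lt0n.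
have c0 := summable_by_ge0 Ha; have M0 := summable_by_ge0 Hb.
have H j : (j <= k)%N ->
    summable_by (r - e * j%:R) (f0 * ((c + M) / e) ^+ j) (iter j lie f).
  elim: j => [|j IH] jk; first by rewrite mulr0 subr0 expr0 mulr1.
  have {}IH := IH (ltnW jk).
  have rj i : (i <= k)%N -> 0 <= r - e * i%:R <= r.
    move=> ik; rewrite subr_ge0 gerDl oppr_le0 mulr_ge0 ?(ltW e0) // andbT.
    apply: (@le_trans _ _ (e * k%:R)); first by rewrite ler_wpM2l ?(ltW e0) // ler_nat.
    by rewrite ek ler_pdivrMr // mulr_natr mulr2n lerDr ltW.
  have [] := andP (rj _ jk) => t0 _.
  have lt : r - e * j.+1%:R < r - e * j%:R.
    by rewrite ltrD2l ltrN2 ltr_pM2l // ltr_nat.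
  have := summable_lie t0 lt (summable_by_le (rj _ (ltnW jk)) Ha)
     (summable_by_le (rj _ (ltnW jk)) Hb) IH.
  rewrite (_ : (c + M) * _ = f0 * ((c + M) / e) ^+ j.+1) //.
  have -> : r - e * j%:R - (r - e * j.+1%:R) = e by rewrite -natr1; ring.
  by rewrite exprSr; ring.
have := H k (leqnn k); rewrite ek (_ : r - r / 2 = r / 2); last first.
  by rewrite {1}(splitr r) addrK.
congr (summable_by _ _ _); rewrite -mulrA natrX -exprMn; congr (_ * _ ^+ _).
rewrite -mulrA; congr (_ * _); rewrite /e natrM invfM invrK.
by rewrite mulrAC [_ / r]mulrC.
Qed.

Definition flow_term f k : germ R 2 :=
  gconst 2 (k`!%:R)^-1 * (gmono R (U_(Y) *+ k)%MM *
    pull (proj_map R 1) (pull (axis R X) (iter k lie f))).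

Lemma mres_X (m : 'X_{1..2}) : mres m = (U_(ord0) *+ m X)%MM.
Proof. by rewrite [LHS]mnm1_one mnmE lift_X. Qed.

Lemma flow_termE f k m : flow_term f k m =
  if m Y == k then iter k lie f (mn2 (m X) 0) / k`!%:R else 0.
Proof.
rewrite gcoef_const gcoef_monoM lem_Uy pull_proj mnmBE Uy_max subn_eq0.
rewrite mres_X pull_axis mnmBE mulmnE mnm1E mul0n subn0 -mn2_0r.
by case: ltngtP => _; rewrite ?mulr0 // mulrC.
Qed.

(** On radius r / 2 the k-th iterate has norm at most f0 L^k k^k, and k^k / k! <= 4^k, so the series
    in y is dominated by a geometric one. *)
Lemma flow_convergent f : convergent (series_coef (flow_term f)).
Proof.
have [ra [c [ra0 Ha]]] := germ_convergent a.
have [rb [M [rb0 Hb]]] := germ_convergent b.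
have [rf [f0 [rf0 Hf]]] := germ_convergent f.
have [r1 r10 /andP[h1 h2]] := min_radius ra0 rb0.
have [r r0 /andP[h3 h4]] := min_radius r10 rf0.
have {h1 Ha}Ha := summable_by_le h3 (summable_by_le h1 Ha).
have {h2 Hb}Hb := summable_by_le h3 (summable_by_le h2 Hb).
have {h4 Hf}Hf := summable_by_le h4 Hf.
have c0 := summable_by_ge0 Ha; have M0 := summable_by_ge0 Hb; have f00 := summable_by_ge0 Hf.
pose L := (c + M) * (2 / r).
have L0 : 0 <= L by rewrite mulr_ge0 ?addr_ge0 ?divr_ge0 // ltW.
(* The radius in y, chosen so that 4 L sg <= 1/2; the added 1 covers L = 0. *)
pose sg := (2 * (4 * L + 1))^-1.
have L1 : 0 < 4 * L + 1 by rewrite ltr_wpDl // mulr_ge0.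
have sg0 : 0 < sg by rewrite invr_gt0 mulr_gt0.
have r2 : 0 < r / 2 by rewrite divr_gt0.
pose W := @xyweight R 1 (r / 2) sg.
have HW : weight W by apply: xyweight_weight.
have [W0 _ _] := HW.
have Lsg : L * 4 * sg <= 2^-1.
  rewrite /sg ler_pdivrMr ?mulr_gt0 // mulrA mulVf ?pnatr_eq0 // mul1r.
  by rewrite mulrC lerDl ler01.
have Lsg0 : 0 <= L * 4 * sg by rewrite mulr_ge0 ?(ltW sg0) // mulr_ge0.
apply: (wsummable_convergent HW (b := f0 * 2)).
apply: (@wsummable_series _ _ W (fun k => f0 * (L * 4 * sg) ^+ k)) => // [k s us|N]; last first.
  rewrite -mulr_sumr ler_wpM2l //; exact: geometric_sum_le.
pose t := [seq mn2 (m X) 0 | m : 'X_{1..2} <- s & m Y == k].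
have ut : uniq t.
  rewrite map_inj_in_uniq ?filter_uniq // => m m'; rewrite !mem_filter => /andP[/eqP mk _] /andP[/eqP m'k _].
  move/(congr1 (fun q : 'X_{1..2} => q X)); rewrite !mn2_X => E.
  by apply: mnm2P; rewrite ?mk.
have := @summable_iter_lie _ _ _ _ _ k r0 Ha Hb Hf t ut.
rewrite big_map big_filter -/L => H.
apply: (@le_trans _ _ ((sg ^+ k / k`!%:R) * (f0 * L ^+ k * (k ^ k)%:R))); last first.
  have -> : sg ^+ k / k`!%:R * (f0 * L ^+ k * (k ^ k)%:R) =
     f0 * (L * sg) ^+ k * ((k ^ k)%:R / k`!%:R).
    rewrite (exprMn k L sg); move: (sg ^+ k) (L ^+ k) (k ^ k)%:R (k`!%:R^-1) => w1 w2 w3 w4.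
    by ring.
  have -> : f0 * (L * 4 * sg) ^+ k = f0 * (L * sg) ^+ k * (4 ^ k)%:R.
    by rewrite (mulrAC L) (exprMn k (L * sg)) natrX mulrA.
  apply: ler_wpM2l; first by rewrite mulr_ge0 // exprn_ge0 // mulr_ge0 // ltW.
  by rewrite ler_pdivrMr ?ltr0n ?fact_gt0 // -natrM ler_nat expnn_fact.
apply: le_trans (ler_wpM2l _ H); last by rewrite divr_ge0 ?exprn_ge0 // ltW.
rewrite mulr_sumr [leRHS]big_mkcond.
rewrite le_eqVlt; apply/orP; left; apply/eqP/eq_bigr => m _.
rewrite flow_termE; case: eqP => [mk|_]; last by rewrite normr0 mul0r.
rewrite /W /xyweight mres_X mdegMn mdeg1 mul1n mk mdeg_mn2 addn0.
by rewrite normrM normfV normr_nat; ring.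
Qed.

(* \sum_k (lie^k f)(x, 0) y^k / k!, that is f along the flow issued from y = 0 *)
Definition flow f : germ R 2 := Germ (flow_convergent f).

Lemma flowE f m : flow f m = iter (m Y) lie f (mn2 (m X) 0) / (m Y)`!%:R.
Proof.
rewrite [LHS]/(series_coef _ _) /series_coef.
have my : (m Y < (mdeg m).+1)%N by rewrite ltnS -[m]mn2_eta mdeg_mn2 mn2_Y leq_addl.
under eq_bigr => k _ do rewrite flow_termE.
rewrite (bigD1 (Ordinal my)) //= eqxx big1 ?addr0 // => k km.
by rewrite ifF //; apply: contraNF km => /eqP E; apply/eqP/val_inj.
Qed.

Lemma flowB : zmod_morphism flow.
Proof.
move=> f g; apply: germP => m; rewrite gcoefB !flowE -mulrBl.
have -> : iter (m Y) lie (f - g) = iter (m Y) lie f - iter (m Y) lie g; last by rewrite gcoefB.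
by elim: (m Y) => //= k ->; rewrite raddfB.
Qed.
HB.instance Definition _ := GRing.isZmodMorphism.Build _ _ flow flowB.

Lemma partial_flow f : gpartial Y (flow f) = flow (lie f).
Proof.
apply: germP => m; rewrite -[LHS]/(flow f (m + U_(Y))%MM *+ (m Y).+1) !flowE.
have -> : (m + U_(Y))%MM X = m X by rewrite mnmDE mnm1E addn0.
have -> : (m + U_(Y))%MM Y = (m Y).+1 by rewrite mnmDE mnm1E eqxx addn1.
rewrite iterSr factS natrM invfM -[LHS]mulr_natr -mulrA; congr (_ * _).
by rewrite mulrAC mulVf ?mul1r // pnatr_eq0.
Qed.

Lemma flow_axis f : pull (axis R X) (flow f) = pull (axis R X) f.
Proof.
apply: germP => m; rewrite (mnm1_one m) !pull_axis flowE !mulmnE !mnm1E /= mul0n mul1n.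
by rewrite divr1 mn2_0r.
Qed.

Lemma flow_const c : flow (gconst 2 c) = gconst 2 c.
Proof.
apply: germP => m; rewrite flowE; case: (posnP (m Y)) => [m0|m0].
  by rewrite m0 divr1 /= -[in RHS](mn2_eta m) m0.
rewrite -(prednK m0) iterSr lie_const.
have -> : iter (m Y).-1 lie 0 = 0 by elim: (m Y).-1 => //= k ->; rewrite raddf0.
rewrite gcoef0 mul0r gconstE (_ : (m == 0%MM) = false) ?mulr0 //.
by apply: contraTF m0 => /eqP ->; rewrite mnm0E.
Qed.

(** Uniqueness for the flow equation: the defect of multiplicativity vanishes on y = 0, and by the
    Leibniz rule its derivative in y is a sum of two such defects. Hence induction on the exponent
    of y. *)
Lemma flowM : monoid_morphism flow.
Proof.
split=> [|f g]; first by rewrite -(rmorph1 (@gconst R 2)) flow_const.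
apply/eqP; rewrite -subr_eq0; apply/eqP/germP => m; rewrite gcoef0.
have [k Ek] : exists k, m Y = k by exists (m Y).
elim: k m f g Ek => [|k IH] m f g Ek.
  have : pull (axis R X) (flow (f * g) - flow f * flow g) = 0.
    by rewrite rmorphB rmorphM /= !flow_axis rmorphM subrr.
  move/(congr1 (fun h : germ R 1 => h (U_(ord0) *+ m X)%MM)).
  by rewrite pull_axis gcoef0 -mn2_0r (_ : mn2 (m X) 0 = m) // -[RHS]mn2_eta Ek.
have : gpartial Y (flow (f * g) - flow f * flow g) (mn2 (m X) k) = 0.
  have -> : gpartial Y (flow (f * g) - flow f * flow g) =
     (flow (lie f * g) - flow (lie f) * flow g) + (flow (f * lie g) - flow f * flow (lie g)).
    by rewrite raddfB /= gpartialM !partial_flow lieM raddfD /=; ring.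
  by rewrite gcoefD !IH ?mn2_Y ?addr0.
set D := (_ - _ : germ R 2).
have Em : (mn2 (m X) k + U_(Y))%MM = m.
  apply: mnm2P; rewrite mnmDE mnm1E /= ?mn2_X ?mn2_Y ?addn0 //.
  by rewrite Ek [(k + _)%N]addn1.
rewrite -[Z in Z = _ -> _]/(D (mn2 (m X) k + U_(Y))%MM *+ (mn2 (m X) k Y).+1) Em.
by rewrite -[Z in Z = _ -> _]mulr_natr => /eqP; rewrite mulf_eq0 pnatr_eq0 orbF => /eqP.
Qed.
HB.instance Definition _ := GRing.isMonoidMorphism.Build _ _ flow flowM.

Lemma vanish_flow d f : vanish d f -> vanish d (flow f).
Proof.
move=> Hf m md; rewrite flowE (vanish_iter_lie (k := m Y) Hf) ?mul0r //.
by rewrite mdeg_mn2 addn0 ltn_subRL; move: md; rewrite -{1}[m]mn2_eta mdeg_mn2 addnC.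
Qed.

Lemma flow0 f : flow f 0%MM = f 0%MM.
Proof. by rewrite flowE mnm0E divr1 mnm0E mn2_0r mulm0n. Qed.

Lemma flow_map0 i : flow (gvar R i) 0%MM = 0.
Proof. by rewrite flow0 id_map0. Qed.
Definition flow_map : holo_map R 2 2 := HoloMap flow_map0.

Lemma pull_flow f : pull flow_map f = flow f.
Proof.
apply: (germ_morph_ext (s1 := pull flow_map) (s2 := flow)).
- by move=> d g; apply: vanish_gcomp.
- exact: vanish_flow.
- by move=> c; rewrite /= pull_const flow_const.
- by move=> i; rewrite /= pull_var.
Qed.

Lemma flow_map_axis : hcomp flow_map (axis R X) = axis R X.
Proof. by apply: holo_mapP => i; rewrite hcompE /= flow_axis pull_var. Qed.

(** Write f = y^e h with h nonzero on the axis. The flow preserves restrictions to the axis, and the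
    flow of y is nonzero because its derivative in y restricts to a there: the field is not tangent
    to the axis. *)
Lemma flow_inj f : pull (axis R X) a != 0 -> f != 0 -> flow f != 0.
Proof.
move=> a0 f0; have [e [h [-> h0]]] := low_slice f0.
have h1 : flow h != 0.
  apply: contraNneq h0 => Z; apply/eqP/germP => m; rewrite sliceE gcoef0.
  rewrite (_ : mext m 0 = (U_(X) *+ m ord0)%MM).
    by rewrite -pull_axis -flow_axis Z rmorph0 gcoef0.
  by apply: mnm2P; rewrite ?mext_max -?(lift_X ord0) ?mext_lift -mn2_0r ?mn2_Y ?lift_X ?mn2_X.
rewrite rmorphM rmorphXn mulf_neq0 // expf_neq0 //.
apply: contraNneq a0 => Z; have := partial_flow (gvar R Y).
by rewrite lie_y Z raddf0 => E; rewrite -flow_axis -E rmorph0.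
Qed.

End Flow.

(** * Foliations and divisorial models *)

Section PulledBackFoliations.
Variable R : realType.
Local Notation C := R[i].
Local Notation X := (ord0 : 'I_2).
Local Notation Y := (ord_max : 'I_2).

Lemma partial_axis f : pull (axis R X) (gpartial X f) = gpartial ord0 (pull (axis R X) f).
Proof.
apply: germP => m; rewrite (mnm1_one m) pull_axis.
rewrite -[RHS]/(pull (axis R X) f (U_(ord0) *+ m ord0 + U_(ord0))%MM *+ _).
rewrite -mulmSr pull_axis -[LHS]/(f (U_(X) *+ m ord0 + U_(X))%MM *+ _) -mulmSr.
by rewrite !mulmnE !mnm1E !eqxx.
Qed.

Lemma sum_ord2 (V : nmodType) (E : 'I_2 -> V) : \sum_i E i = E X + E Y.
Proof. by rewrite big_ord_recl big_ord1; congr (_ + E _); apply: val_inj. Qed.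

Lemma axis_mapE : axis_map R = axis R X.
Proof. exact: holo_mapP. Qed.

Lemma zero_form_comp m n (phi : holo_map R m n) (w : Defs.form R n) :
  (forall i, phi i = 0) -> pullback_form phi w = 0.
Proof.
move=> H; apply/rowP => j; rewrite pullback_formE mxE big1 // => i _.
by rewrite H raddf0 mulr0.
Qed.

(* The flow of G issued from the axis y = 0 would otherwise exhibit F as
   dicritical. *)
Lemma axis_invariant n (F : foliation R n) (phi : holo_map R 2 n) (G : foliation R 2) :
  ~ dicritical_foliation F -> pullback_to phi F G ->
  pullback_form (hcomp phi (axis_map R)) F = 0 -> invariant_hypersurface G (HY R).
Proof.
move=> ndic [phi0 [g Eg]] axF.
pose a := G ord0 X; pose b := G ord0 Y.
have g0 : g != 0 by apply: contraNneq phi0 => Z; rewrite Eg Z scale0r.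
have a0 : pull (axis R X) a = 0.
  apply: contrapT => /eqP a0; apply: ndic.
  pose psi := flow_map a b; pose Phi := hcomp phi psi; exists Phi.
  pose k := flow a b a * gpartial X (psi X) + flow a b b * gpartial X (psi Y).
  (* The image of d/dy under psi is the dual field of G, which G annihilates; only a multiple k of
     dx remains, and k restricts to a on the axis. *)
  have EG : pullback_form psi G = k *: dform (gvar R X).
    apply/rowP => j; rewrite pullback_formE [RHS]mxE mxE sum_ord2 !pull_flow -/a -/b.
    move: j; apply: ord2_ind; rewrite gpartial_var; first by rewrite eqxx mulr1.
    rewrite mulr0 /= !partial_flow lie_x lie_y -!rmorphM -rmorphD.
    by rewrite (_ : _ + _ = 0) ?rmorph0 //; ring.
  have k0 : k != 0.
    apply: contraNneq a0 => Z; have := congr1 (pull (axis R X)) Z.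
    rewrite rmorph0 /k rmorphD !rmorphM /= !partial_axis !flow_axis !pull_var !axisE /=.
    by rewrite raddf0 mulr0 addr0 gpartial_var eqxx mulr1 => ->.
  have EF : pullback_form Phi F = (pull psi g * k) *: dform (gvar R X).
    by rewrite -pullback_comp Eg pullback_scale EG scalerA.
  split; last first.
    by rewrite /Phi hcompA axis_mapE flow_map_axis -axis_mapE.
  split; last by exists (pull psi g * k).
  apply/eqP => Z; have : pullback_form Phi F ord0 X = 0 by rewrite Z mxE.
  rewrite EF mxE mxE gpartial_var eqxx mulr1 => /eqP.
  by rewrite mulf_eq0 (negbTE k0) orbF pull_flow (negbTE (flow_inj b a0 g0)).
(* With b dy killed along y = 0 in any case, divisibility of a by y is exactly invariance of the
   axis. *)
have Ea : a = gvar R Y * quo_mono U_(Y)%MM a.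
  rewrite gvar_mono quo_monoK // => m; rewrite lep1mP negbK => /eqP mY.
  by rewrite -[m]mn2_eta mY mn2_0r -pull_axis a0 gcoef0.
move=> m psi; have [w wu Ew] := equation_hyper (gvar_irreducible R Y).
rewrite [equation _]Ew pullE rmorphM /= pull_var => /eqP; rewrite mulf_eq0 => /orP[|/eqP psiY].
  by move/eqP => Z; move: wu; rewrite -(pull_unit psi) Z unitr0.
apply/rowP => j; rewrite pullback_formE mxE sum_ord2 psiY raddf0 mulr0 addr0.
by rewrite -/a Ea rmorphM /= pull_var psiY !mul0r.
Qed.

Lemma integrable2 (w : Defs.form R 2) : integrable_form w.
Proof.
move=> i j k; move: i; apply: ord2_ind; move: j; apply: ord2_ind; move: k; apply: ord2_ind;
  by ring.
Qed.

(** Removing a common non-unit factor lowers the order of a fixed nonzero coefficient. *)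
Lemma coprime_reduction (w : Defs.form R 2) : w != 0 ->
  exists g (G : foliation R 2), w = g *: (G : 'rV_2).
Proof.
move=> w0; have [i wi] : exists i, w ord0 i != 0.
  apply: contrapT => /forallNP H; case/eqP: w0; apply/rowP => i.
  by rewrite mxE; apply/eqP/negPn/negP.
have [k] := ubnP (gorder (w ord0 i)); elim: k w wi {w0} => // k IH w wi; rewrite ltnS => wk.
have [cop|] := pselect (forall g, (forall j, gdvd g (w ord0 j)) -> g \is a GRing.unit).
  by exists 1, (Foliation (@integrable2 w) cop); rewrite scale1r.
move=> /existsNP[g /not_implyP[/choice[q Hq] /negP gu]].
pose w' : Defs.form R 2 := \row_j q j.
have Ew : w = g *: (w' : 'rV_2) by apply/rowP => j; rewrite !mxE Hq mulrC.
have Ei : w ord0 i = g * w' ord0 i by rewrite {1}Ew mxE.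
have wi' : w' ord0 i != 0 by apply: contraNneq wi => Z; rewrite Ei Z mulr0.
have g0 : g != 0 by apply: contraNneq wi => Z; rewrite Ei Z mul0r.
have [|h [G EG]] := IH w' wi'.
  apply: leq_trans wk; rewrite Ei gorderM // -[X in (X < _)%N]add0n ltn_add2r.
  by rewrite lt0n gorder0_unit.
by exists (g * h), G; rewrite Ew EG scalerA.
Qed.

Lemma pullback_foliation n (F : foliation R n) (phi : holo_map R 2 n) :
  pullback_form phi F != 0 -> exists G : foliation R 2, pullback_to phi F G.
Proof. by move=> H; have [g [G EG]] := coprime_reduction H; exists G; split=> //; exists g. Qed.

End PulledBackFoliations.

Section Models.
Variable R : realType.
Local Notation C := R[i].
Local Notation X := (ord0 : 'I_2).
Local Notation Y := (ord_max : 'I_2).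

Lemma support_equation_perm n (D D' : divisor R n) : dom D =i dom D' ->
  support_equation D = support_equation D'.
Proof. by move=> E; apply: perm_big; apply: uniq_perm; rewrite ?uniq_dom. Qed.

Lemma into_support_perm m n (phi : holo_map R m n) (D D' : divisor R n) :
  dom D =i dom D' -> into_support phi D -> into_support phi D'.
Proof. by move=> E; rewrite /into_support (support_equation_perm E). Qed.

Lemma pullback_divisor_dom m n (phi : holo_map R m n) (D D' : divisor R n) :
  dom D =i dom D' -> pullback_divisor phi D' =
  \sum_(H <- dom D) coeff H D' *: zero_divisor (gcomp (equation H) phi).
Proof. by move=> E; apply: perm_big; apply: uniq_perm; rewrite ?uniq_dom. Qed.

Lemma into_supportP m n (phi : holo_map R m n) (D : divisor R n) :
  into_support phi D -> exists2 H, H \in dom D & pull phi (equation H) = 0.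
Proof.
rewrite /into_support pullE rmorph_prod => /eqP.
by rewrite prodf_seq_eq0 => /hasP[H HD /eqP E]; exists H.
Qed.

(** If D = 0, the support is empty and even the constant map is transverse, but it pulls every form
    back to 0. *)
Lemma model_neq0 n (F : foliation R n) (D : divisor R n) :
  divisorial_model D F -> D != 0.
Proof.
case=> _ H; apply/eqP => D0.
pose phi : holo_map R 2 n := HoloMap (fun _ : 'I_n => @gcoef0 R 2 0%MM).
have [|] := H phi.
  by rewrite D0 => /into_supportP[K]; rewrite dom0.
by rewrite zero_form_comp ?eqxx.
Qed.

(** A pulled back divisor equal to 0 would have empty support, yet that support must contain the
    invariant axis. *)
Lemma model_nondicritical n (F : foliation R n) (D : divisor R n) :
  generalized_hypersurface F -> divisorial_model D F -> ~ dicritical_divisor D.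
Proof.
move=> [ndic _] [supp H] [phi [tr ax pb0]].
have [pF HG] := H phi tr; have [G pG] := pullback_foliation pF.
have [_ [suppG _]] := HG G pG.
have [K KD EK] := into_supportP ax.
have axF : pullback_form (hcomp phi (axis_map R)) F = 0 by apply: (supp K).1.
have := (suppG (HY R)).2 (axis_invariant ndic pG axF).
by rewrite pb0 dom0.
Qed.

Lemma divisor_index_scale (l : C) (D : divisor R 2) G : l != 0 ->
  divisor_index (l *: D) G = divisor_index D G.
Proof.
move=> l0; rewrite /divisor_index.
have -> : \sum_(H <- dom (l *: D) | H != G) coeff H (l *: D) *
     (intersection_multiplicity (equation G) (equation H))%:R =
  l * \sum_(H <- dom D | H != G) coeff H D *
     (intersection_multiplicity (equation G) (equation H))%:R.
  rewrite mulr_sumr; under [RHS]eq_bigr => H _ do rewrite mulrA -coeffZ.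
  by apply: perm_big; apply: uniq_perm; rewrite ?uniq_dom //; apply: domZ.
rewrite coeffZ invfM !mulNr; congr (- _); move: (coeff G D)^-1 (\sum_(_ <- _ | _) _) => c S.
by rewrite mulrCA !mulrA mulfV // mul1r.
Qed.

Lemma model_scale n (F : foliation R n) (D : divisor R n) (l : C) : l != 0 ->
  divisorial_model D F -> divisorial_model (l *: D) F.
Proof.
move=> l0 [supp H]; have dZ : dom (l *: D) =i dom D by apply: domZ.
split=> [K|phi tr]; first by rewrite dZ.
have tr' : transverse phi D by move=> i; apply: tr; apply: into_support_perm i => z; rewrite dZ.
have [pF HG] := H phi tr'; split=> // G pG; have [gG [suppG ind]] := HG G pG.
split=> //.
have -> : pullback_divisor phi (l *: D) = l *: pullback_divisor phi D.
  rewrite (@pullback_divisor_dom _ _ _ D) => [|z]; last by rewrite dZ.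
  by rewrite scaler_sumr; apply: eq_bigr => K _; rewrite coeffZ scalerA.
split=> [K|K]; rewrite domZ // => KD.
by rewrite divisor_index_scale //; apply: ind.
Qed.

Lemma gorder1P (f : germ R 1) : f != 0 -> f (U_(ord0) *+ gorder f)%MM != 0 /\
  forall k, (k < gorder f)%N -> f (U_(ord0) *+ k)%MM = 0.
Proof.
move=> f0; have [fl Hf] := lead_monomP f0; split=> [|k kf].
  rewrite (_ : (_ *+ _)%MM = lead_monom f) // [RHS]mnm1_one; congr (_ *+ _)%MM.
  by rewrite /gorder mdegE big_ord1.
by apply: Hf; apply: lt_mdeg_ltmc; rewrite mdegMn mdeg1 mul1n.
Qed.

(** The weight w H is the order of the equation of H on the arc l, so that L is the end value of the
    chain up to the factor M. It does not depend on H, which makes all coefficients proportional at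
    once. *)
Lemma model_ratio n (F : foliation R n.+2) (D D' : divisor R n.+2) :
  generalized_hypersurface F -> divisorial_model D F -> divisorial_model D' F ->
  exists (w : hypersurface R n.+2 -> nat),
    let L (E : divisor R n.+2) := \sum_(H <- dom D) coeff H E * (w H)%:R in
    forall H, H \in dom D -> L D != 0 /\ L D * coeff H D' = L D' * coeff H D.
Proof.
move=> [ndic _] [supp HD] [supp' HD'].
have domE : dom D =i dom D'.
  by move=> H; apply/idP/idP => [/(supp H)/(supp' H)|/(supp' H)/(supp H)].
pose s := [seq equation H | H <- dom D].
have sD H : H \in dom D -> equation H \in s by exact: map_f.
have [|f g /mapP[H HHD ->] /mapP[K KD ->] /hypersurface_eq -> //|l [ls arcs]] :=
  @separating_arcs R n s; first by move=> f /mapP[H _ ->]; exact: equation_irreducible.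
exists (fun H => gorder (pull l (equation H))) => L H0 H0D.
have [Phi [PhiY Phi0 PhiX]] := arcs _ (sD _ H0D).
pose g H := pull Phi (equation H).
have gY H : pull (axis R Y) (g H) = pull l (equation H) by rewrite pull_comp PhiY.
have greg H : H \in dom D -> yregular (gorder (pull l (equation H))) (g H).
  move=> HHD; have [h1 h2] := gorder1P (ls _ (sD _ HHD)).
  by split=> [k kd|]; rewrite -pull_axis gY // h2.
have [M [K [M0 chain wK w0 w0']]] : exists M K, [/\ (0 < M)%N,
    forall k H, H \in dom D -> exists2 u : germ R 2, u \is a GRing.unit &
      forall M0 : (0 < M)%N, pull (chain_map R k M0) (g H) =
      gvar R X ^+ wt k M (g H) * gvar R Y ^+ wt k.+1 M (g H) * u,
    forall H, H \in dom D -> wt K M (g H) = (M * gorder (pull l (equation H)))%N,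
    (0 < wt 0 M (g H0))%N &
    forall H, H \in dom D -> H != H0 -> wt 0 M (g H) = 0%N].
  have [h hs|M [K [M0 c1 c2 c3 c4]]] := @newton_chain R [seq g H | H <- dom D].
    by case/mapP: hs => H HHD ->; exists (gorder (pull l (equation H))); apply: greg.
  exists M, K; split=> //.
  - by move=> k H HHD; apply: c1; apply: map_f.
  - by move=> H HHD; apply: c2; [exact: map_f | exact: greg].
  - by apply: c3; [exact: map_f | exact: Phi0].
  - move=> H HHD HH0; apply: c4; first exact: map_f.
    apply: PhiX; first exact: sD.
    apply: contraNneq HH0 => E; apply/eqP; apply: hypersurface_eq.
    by rewrite E; exists 1; rewrite mul1r.
pose A k (E : divisor R n.+2) : C := \sum_(H <- dom D) coeff H E * (wt k M (g H))%:R.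
have A0 E : A 0%N E = coeff H0 E * (wt 0 M (g H0))%:R.
  rewrite /A (big_rem H0) //= big_seq big1 ?addr0 // => H.
  by rewrite mem_rem_uniq ?uniq_dom // inE => /andP[HH0 HHD]; rewrite w0' // mulr0.
have H0D' : H0 \in dom D' by rewrite -domE.
have c0 : coeff H0 D != 0 by rewrite -mem_dom.
have c0' : coeff H0 D' != 0 by rewrite -mem_dom.
(* Non-vanishing is carried along: the index along [x = 0] is available only while [x = 0] is in the
   support. *)
have main k : A k D != 0 /\ A k D * coeff H0 D' = A k D' * coeff H0 D.
  elim: k => [|k [Ak0 IH]].
    rewrite !A0; split; last by ring.
    by rewrite mulf_neq0 // pnatr_eq0 -lt0n.
  have Ak0' : A k D' != 0.
    by apply: contraNneq (mulf_neq0 Ak0 c0') => Z; rewrite IH Z mul0r.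
  pose phi := hcomp Phi (chain_map R k M0).
  have phiE H : H \in dom D -> exists2 u : germ R 2, u \is a GRing.unit &
      gcomp (equation H) phi = gvar R X ^+ wt k M (g H) * gvar R Y ^+ wt k.+1 M (g H) * u.
    by move=> HHD; have [u uu E] := chain k H HHD; exists u; rewrite // pullE -pull_comp E.
  have tr : transverse phi D.
    case/into_supportP=> H HHD; rewrite -pullE; have [u uu ->] := phiE H HHD => /eqP.
    rewrite !mulf_eq0 !expf_eq0 !(negbTE (gvar_neq0 R _)) !andbF /=.
    by move/eqP => Z; rewrite Z unitr0 in uu.
  have tr' : transverse phi D' by move=> i; apply: tr; apply: into_support_perm i => z; rewrite domE.
  have pb E : dom D =i dom E ->
      pullback_divisor phi E = A k E *: << HX R >> + A k.+1 E *: << HY R >>.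
    move=> dE; rewrite (pullback_divisor_dom _ dE) /A !scaler_suml -big_split.
    rewrite big_seq [RHS]big_seq; apply: eq_bigr => H HHD.
    have [u uu ->] := phiE H HHD; rewrite zero_divisor_mono //= scalerDr.
    by rewrite -!scalerA !scaler_nat.
  have [pF HG] := HD phi tr; have [G pG] := pullback_foliation pF.
  have [_ [suppG indG]] := HG G pG.
  have [_ HG'] := HD' phi tr'; have [_ [suppG' indG']] := HG' G pG.
  (* The chain map contracts the axis y = 0 to the origin. *)
  have axF : pullback_form (hcomp phi (axis_map R)) F = 0.
    apply: zero_form_comp => i; rewrite hcompE axis_mapE hcompE pull_comp.
    rewrite pull_zero => [|j]; first by rewrite hcoord0 rmorph0.
    by rewrite hcompE chain_map_axis.
  have HYin := (suppG (HY R)).2 (axis_invariant ndic pG axF).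
  rewrite (pb D) // in HYin indG; rewrite (pb D' domE) in indG'.
  have cX a b : coeff (HX R) (a *: << HX R >> + b *: << HY R >> : divisor R 2) = a.
    by rewrite coeffD !coeffZ !coeffU eqxx eq_sym (negbTE (HXY R)) !mulr1 !mulr0 addr0.
  have cY a b : coeff (HY R) (a *: << HX R >> + b *: << HY R >> : divisor R 2) = b.
    by rewrite coeffD !coeffZ !coeffU eqxx (negbTE (HXY R)) !mulr1 !mulr0 add0r.
  have Ak1 : A k.+1 D != 0 by move: HYin; rewrite mem_dom cY.
  split=> //.
  have [iota iota0 ind] := divisor_index_XY R.
  have := indG (HX R); rewrite mem_dom cX => /(_ Ak0) I1.
  have := indG' (HX R); rewrite mem_dom cX => /(_ Ak0') I2.
  (* Both indices equal the Camacho-Sad index of the same G, and the nonzero intersection number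
     iota cancels. *)
  have : A k.+1 D / A k D = A k.+1 D' / A k D'.
    apply: (mulfI (_ : - iota != 0)); first by rewrite oppr_eq0.
    have E : - (A k D)^-1 * (A k.+1 D * iota) = - (A k D')^-1 * (A k.+1 D' * iota).
      by rewrite -!ind I1 -I2.
    transitivity (- (A k D)^-1 * (A k.+1 D * iota)); first by ring.
    by rewrite E; ring.
  move/eqP; rewrite eqr_div // => /eqP E.
  apply: (mulfI Ak0); rewrite mulrCA IH mulrA [A k.+1 D * _]E mulrA.
  by congr (_ * _); rewrite mulrC.
have [AK0 EK] := main K.
have AE E : A K E = M%:R * L E.
  rewrite /A /L mulr_sumr big_seq [RHS]big_seq; apply: eq_bigr => H HHD.
  by rewrite wK // natrM mulrCA.
have M0' : M%:R != 0 :> C by rewrite pnatr_eq0 -lt0n.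
rewrite !AE in AK0 EK; split; first by apply: contraNneq AK0 => ->; rewrite mulr0.
by apply: (mulfI M0'); rewrite !mulrA.
Qed.

End Models.

Theorem proposition20 (R : realType) (n : nat) (hn : (2 <= n)%N)
  (F : foliation R n) (hF : generalized_hypersurface F)
  (D : divisor R n) (hD : divisorial_model D F) :
  ~ dicritical_divisor D /\
  forall D' : divisor R n,
    divisorial_model D' F <-> projectively_equivalent D D'.
Proof.
split=> [|D']; first exact: model_nondicritical hF hD.
split=> [hD'|[_ _ [l l0 ->]]]; last exact: model_scale.
have D0 := model_neq0 hD; have D'0 := model_neq0 hD'; split=> //.
case: n hn F hF D hD D' hD' D0 D'0 => [|[|n]] // _ F hF D hD D' hD' D0 D'0.
have [w /= H] := model_ratio hF hD hD'.
set L := fun E : divisor R n.+2 => \sum_(K <- dom D) coeff K E * (w K)%:R in H.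
have [K KD] : exists K, K \in dom D.
  move: D0; rewrite -dom_eq0; case: (dom D) => [|K t] // _.
  by exists K; rewrite mem_head.
have [LD0 _] := H K KD.
have domE : dom D =i dom D'.
  have [[supp _] [supp' _]] := (hD, hD').
  by move=> J; apply/idP/idP => [/(supp J)/(supp' J)|/(supp' J)/(supp J)].
(* Both supports consist of the invariant hypersurfaces of F, so the coefficients outside [dom D]
   are 0 on both sides. *)
have E : D' = (L D' / L D) *: D.
  apply/eqP/freeg_eqP => J; rewrite coeffZ.
  have [JD|JD] := boolP (J \in dom D).
    by have [_ EJ] := H J JD; apply: (mulfI LD0); rewrite EJ mulrA [L D * _]mulrC divfK.
  by rewrite !coeff_outdom ?mulr0 // -domE.
exists (L D' / L D) => //.
by apply: contraNneq D'0 => Z; rewrite E Z scale0r.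
Qed.
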